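(* Let $\Omega\subseteq\mathbb{H}$ be a non-empty circular domain and let $f=f_0+f_v\in\mathcal{SR}(\Omega)$. If each connected component of $\Omega_I=\Omega\cap\mathbb{C}_I$ ($I\in\mathbb{S}$) is simply connected, $f_v^s$ is not identically zero, and the zero set of $f_v$ does not contain non-real zeroes of odd isolated multiplicity, then, where $f_v^s$ does not vanish, $$\exp_*(f)=\exp_*(f_0)\left(\cos_*\left(\sqrt{f_v^s}\right)+\frac{\sin_*\left(\sqrt{f_v^s}\right)}{\sqrt{f_v^s}}\,f_v\right),$$ where $\sqrt{f_v^s}$ denotes a function in $\mathcal{SR}_{\mathbb{R}}(\Omega)$ whose square is $f_v^s$ (such a function exists under these hypotheses).
   Context: $\mathbb{H}$ is the algebra of quaternions (with the Euclidean topology of $\mathbb{R}^4$), with conjugation $q\mapsto q^c$, $\mathbb{S}=\{q\in\mathbb{H}: q^2=-1\}$, and $\mathbb{C}_I=\mathrm{Span}_{\mathbb{R}}(1,I)$ for $I\in\mathbb{S}$. For $D\subseteq\mathbb{C}=\{\alpha+\imath\beta:\alpha,\beta\in\mathbb{R}\}$ invariant under complex conjugation, $\Omega_D=\{\alpha+\beta I:\alpha+\imath\beta\in D,\ I\in\mathbb{S}\}$; sets of this form are called circular, and a circular domain is a connected open circular subset of $\mathbb{H}$. For $q=\alpha+\beta I$, $\mathbb{S}_q=\{\alpha+\beta J: J\in\mathbb{S}\}$. The simple connectedness condition on $\Omega_I$ holds for some $I\in\mathbb{S}$ if and only if it holds for all. A stem function is $F=F_1+\imath F_2:D\to\mathbb{H}\otimes_{\mathbb{R}}\mathbb{C}$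 ($F_1,F_2$ $\mathbb{H}$-valued) with $F(\overline z)=\overline{F(z)}$, where $\overline{p+\imath q}=p-\imath q$. It induces the slice function $f=\mathcal{I}(F):\Omega_D\to\mathbb{H}$, $f(\alpha+\beta I)=F_1(\alpha+\imath\beta)+I F_2(\alpha+\imath\beta)$. On a circular domain $\Omega=\Omega_D$, $f=\mathcal I(F)$ is slice-regular if $F$ is holomorphic for the natural complex structures of $\mathbb{C}$ and $\mathbb{H}\otimes_{\mathbb{R}}\mathbb{C}$; $\mathcal{SR}(\Omega)$ is the set of slice-regular functions, and $\mathcal{SR}_{\mathbb{R}}(\Omega)$ is the subset of slice-preserving ones, i.e. those with $F_1,F_2$ real-valued. The $*$-product is $\mathcal I(F)*\mathcal I(G)=\mathcal I(FG)$, with $(p+\imath q)(p'+\imath q')=pp'-qq'+\imath(pq'+qp')$; if one factor is slice-preserving it is the pointwise product. For $f=\mathcal I(F_1+\imath F_2)\in\mathcal{SR}(\Omega)$: $f^c=\mathcal I(F_1^c+\imath F_2^c)$, $f_0=\frac{f+f^c}{2}$, $f_v=\frac{f-f^c}{2}$ (so $f=f_0+f_v$), $f^s=f*f^c$, and $f_v^s$ means $(f_v)^s$. With $f^{*n}$ the $n$-th $*$-power ($f^{*0}=1$), $\exp_*(f)=\sum_{n\in\mathbb{N}}\frac{f^{*n}}{n!}$, $\cos_*(f)=\sum_{n\in\mathbb{N}}\frac{(-1)^nf^{*(2n)}}{(2n)!}$, $\sin_*(f)=\sum_{n\in\mathbb{N}}\frac{(-1)^nf^{*(2n+1)}}{(2n+1)!}$;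 these converge uniformly on compact subsets of $\Omega$ to elements of $\mathcal{SR}(\Omega)$. Multiplicities: let $g\in\mathcal{SR}(\Omega)$. For a sphere $\mathbb{S}_{x+yI}\subset\Omega$ with $y\ne0$, if $g(q)=\big((q-x)^2+y^2\big)^m (q-p_1)*\cdots*(q-p_n)*h(q)$ with $m,n\geq0$, $p_1,\dots,p_n\in\mathbb{S}_{x+yI}$, $p_{\ell}\neq\overline{p_{\ell+1}}$ for all $\ell$, and $h\in\mathcal{SR}(\Omega)$ without zeroes in $\mathbb{S}_{x+yI}$, then $2m$ is the spherical multiplicity of $\mathbb{S}_{x+yI}$ and, if $n>0$, $n$ is the isolated multiplicity of $p_1$. *)

(* Defs.v *)
From HB Require Import structures.
From mathcomp Require Import all_boot all_order all_algebra.
From mathcomp Require Import all_classical all_reals all_analysis.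
From mathcomp Require Import complex ring.

Set Implicit Arguments.
Unset Strict Implicit.
Unset Printing Implicit Defensive.

Import Order.TTheory GRing.Theory Num.Theory.
Import numFieldNormedType.Exports.

Local Open Scope classical_set_scope.
Local Open Scope ring_scope.
Local Open Scope complex_scope.

(* Quaternions with coefficients in K: [quat R] is the algebra H, and
   [quat R[i]] is its complexification H (x)_R C, a vector space over C = R[i]. *)
Record quat (K : Type) := Quat { q0 : K; q1 : K; q2 : K; q3 : K }.

Lemma quat_eq (K : Type) (p q : quat K) :
  q0 p = q0 q -> q1 p = q1 q -> q2 p = q2 q -> q3 p = q3 q -> p = q.
Proof. by case: p q => [? ? ? ?] [? ? ? ?] /= -> -> -> ->. Qed.

Definition prod_of_quat (K : Type) (q : quat K) : K * K * K * K :=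
  (q0 q, q1 q, q2 q, q3 q).
Definition quat_of_prod (K : Type) (u : K * K * K * K) : quat K :=
  Quat u.1.1.1 u.1.1.2 u.1.2 u.2.

Lemma prod_of_quatK (K : Type) : cancel (@prod_of_quat K) (@quat_of_prod K).
Proof. by case. Qed.

HB.instance Definition _ (K : choiceType) :=
  Choice.copy (quat K) (can_type (@prod_of_quatK K)).

Section QuatAlgebra.
Variable K : numFieldType.
Implicit Types (p q r : quat K) (a : K).

Definition qzero : quat K := Quat 0 0 0 0.
Definition qone : quat K := Quat 1 0 0 0.
Definition qopp q : quat K := Quat (- q0 q) (- q1 q) (- q2 q) (- q3 q).
Definition qadd p q : quat K :=
  Quat (q0 p + q0 q) (q1 p + q1 q) (q2 p + q2 q) (q3 p + q3 q).
Definition qscale a q : quat K :=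
  Quat (a * q0 q) (a * q1 q) (a * q2 q) (a * q3 q).
Definition qmul p q : quat K :=
  Quat (q0 p * q0 q - q1 p * q1 q - q2 p * q2 q - q3 p * q3 q)
       (q0 p * q1 q + q1 p * q0 q + q2 p * q3 q - q3 p * q2 q)
       (q0 p * q2 q - q1 p * q3 q + q2 p * q0 q + q3 p * q1 q)
       (q0 p * q3 q + q1 p * q2 q - q2 p * q1 q + q3 p * q0 q).

Lemma qaddA : associative qadd.
Proof. by move=> p q r; apply: quat_eq => /=; ring. Qed.
Lemma qaddC : commutative qadd.
Proof. by move=> p q; apply: quat_eq => /=; ring. Qed.
Lemma qadd0q : left_id qzero qadd.
Proof. by move=> q; apply: quat_eq => /=; ring. Qed.
Lemma qaddNq : left_inverse qzero qopp qadd.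
Proof. by move=> q; apply: quat_eq => /=; ring. Qed.

HB.instance Definition _ :=
  GRing.isZmodule.Build (quat K) qaddA qaddC qadd0q qaddNq.

Lemma qmulA : associative qmul.
Proof. by move=> p q r; apply: quat_eq => /=; ring. Qed.
Lemma qmul1q : left_id qone qmul.
Proof. by move=> q; apply: quat_eq => /=; ring. Qed.
Lemma qmulq1 : right_id qone qmul.
Proof. by move=> q; apply: quat_eq => /=; ring. Qed.
Lemma qmulDl : left_distributive qmul +%R.
Proof. by move=> p q r; apply: quat_eq => /=; ring. Qed.
Lemma qmulDr : right_distributive qmul +%R.
Proof. by move=> p q r; apply: quat_eq => /=; ring. Qed.
Lemma qone_neq0 : qone != 0.
Proof. by apply/eqP => /(congr1 (@q0 K)) /eqP; rewrite /= oner_eq0. Qed.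

HB.instance Definition _ := GRing.Zmodule_isNzRing.Build (quat K)
  qmulA qmul1q qmulq1 qmulDl qmulDr qone_neq0.

Lemma qscaleA a b q : qscale a (qscale b q) = qscale (a * b) q.
Proof. by apply: quat_eq => /=; ring. Qed.
Lemma qscale1 : left_id 1 qscale.
Proof. by move=> q; apply: quat_eq => /=; ring. Qed.
Lemma qscaleDr : right_distributive qscale +%R.
Proof. by move=> a p q; apply: quat_eq => /=; ring. Qed.
Lemma qscaleDl q : {morph qscale^~ q : a b / a + b}.
Proof. by move=> a b; apply: quat_eq => /=; ring. Qed.

HB.instance Definition _ := GRing.Zmodule_isLmodule.Build K (quat K)
  qscaleA qscale1 qscaleDr qscaleDl.

Lemma q0D p q : q0 (p + q) = q0 p + q0 q. Proof. by []. Qed.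
Lemma q1D p q : q1 (p + q) = q1 p + q1 q. Proof. by []. Qed.
Lemma q2D p q : q2 (p + q) = q2 p + q2 q. Proof. by []. Qed.
Lemma q3D p q : q3 (p + q) = q3 p + q3 q. Proof. by []. Qed.
Lemma q0N q : q0 (- q) = - q0 q. Proof. by []. Qed.
Lemma q1N q : q1 (- q) = - q1 q. Proof. by []. Qed.
Lemma q2N q : q2 (- q) = - q2 q. Proof. by []. Qed.
Lemma q3N q : q3 (- q) = - q3 q. Proof. by []. Qed.
Lemma q0Z a q : q0 (a *: q) = a * q0 q. Proof. by []. Qed.
Lemma q1Z a q : q1 (a *: q) = a * q1 q. Proof. by []. Qed.
Lemma q2Z a q : q2 (a *: q) = a * q2 q. Proof. by []. Qed.
Lemma q3Z a q : q3 (a *: q) = a * q3 q. Proof. by []. Qed.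
Lemma q0M p q :
  q0 (p * q) = q0 p * q0 q - q1 p * q1 q - q2 p * q2 q - q3 p * q3 q.
Proof. by []. Qed.
Lemma q1M p q :
  q1 (p * q) = q0 p * q1 q + q1 p * q0 q + q2 p * q3 q - q3 p * q2 q.
Proof. by []. Qed.
Lemma q2M p q :
  q2 (p * q) = q0 p * q2 q - q1 p * q3 q + q2 p * q0 q + q3 p * q1 q.
Proof. by []. Qed.
Lemma q3M p q :
  q3 (p * q) = q0 p * q3 q + q1 p * q2 q - q2 p * q1 q + q3 p * q0 q.
Proof. by []. Qed.
Lemma q01 : q0 (1 : quat K) = 1. Proof. by []. Qed.
Lemma q11 : q1 (1 : quat K) = 0. Proof. by []. Qed.
Lemma q21 : q2 (1 : quat K) = 0. Proof. by []. Qed.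
Lemma q31 : q3 (1 : quat K) = 0. Proof. by []. Qed.

Definition quatE := ((q0D, q1D, q2D, q3D), (q0N, q1N, q2N, q3N),
  (q0Z, q1Z, q2Z, q3Z), (q0M, q1M, q2M, q3M), (q01, q11, q21, q31)).

Lemma qscaleAl a p q : a *: (p * q) = (a *: p) * q.
Proof. by apply: quat_eq; rewrite !quatE; ring. Qed.

HB.instance Definition _ := GRing.Lmodule_isLalgebra.Build K (quat K) qscaleAl.

Lemma qscaleAr a p q : a *: (p * q) = p * (a *: q).
Proof. by apply: quat_eq; rewrite !quatE; ring. Qed.

HB.instance Definition _ := GRing.Lalgebra_isAlgebra.Build K (quat K) qscaleAr.

(* The l1-norm of the coordinates, which makes sense over every K and induces
   the product topology of K^4; it is not the quaternionic modulus. *)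
Definition ql1norm q : K := `|q0 q| + `|q1 q| + `|q2 q| + `|q3 q|.

Lemma ql1normD p q : ql1norm (p + q) <= ql1norm p + ql1norm q.
Proof.
rewrite /ql1norm !quatE.
have -> : `|q0 p| + `|q1 p| + `|q2 p| + `|q3 p| +
    (`|q0 q| + `|q1 q| + `|q2 q| + `|q3 q|) =
    (`|q0 p| + `|q0 q|) + (`|q1 p| + `|q1 q|) +
    (`|q2 p| + `|q2 q|) + (`|q3 p| + `|q3 q|) by ring.
by rewrite !lerD ?ler_normD.
Qed.

Lemma ql1normZ a q : ql1norm (a *: q) = `|a| * ql1norm q.
Proof. by rewrite /ql1norm !quatE !normrM !mulrDr. Qed.

Lemma ql1norm0_eq0 q : ql1norm q = 0 -> q = 0.
Proof.
move/eqP; rewrite /ql1norm !paddr_eq0 ?addr_ge0// !normr_eq0.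
by move=> /andP[/andP[/andP[/eqP ? /eqP ?] /eqP ?] /eqP ?]; apply: quat_eq.
Qed.

HB.instance Definition _ := Lmodule_isNormed.Build K (quat K)
  ql1normD ql1normZ ql1norm0_eq0.

(* K-linear: on [quat R[i]] this is (p + iota q)^c = p^c + iota q^c. *)
Definition qconj q : quat K := Quat (q0 q) (- q1 q) (- q2 q) (- q3 q).

Definition qnorm2 q : K := q0 q ^+ 2 + q1 q ^+ 2 + q2 q ^+ 2 + q3 q ^+ 2.

Lemma qmul_conj q : q * qconj q = (qnorm2 q)%:A.
Proof. by apply: quat_eq; rewrite !quatE /qnorm2 /=; ring. Qed.

Lemma qconj_mul q : qconj q * q = (qnorm2 q)%:A.
Proof. by apply: quat_eq; rewrite !quatE /qnorm2 /=; ring. Qed.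

Lemma qnorm2M p q : qnorm2 (p * q) = qnorm2 p * qnorm2 q.
Proof. by rewrite /qnorm2 !quatE; ring. Qed.

Definition qunit : pred (quat K) := fun q => qnorm2 q != 0.
Definition qinv q : quat K :=
  if qnorm2 q != 0 then (qnorm2 q)^-1 *: qconj q else q.

Lemma qmulVq : {in qunit, left_inverse 1 qinv *%R}.
Proof.
move=> q; rewrite unfold_in /qunit /qinv => nq; rewrite nq.
by rewrite -scalerAl qconj_mul scalerA mulVf// scale1r.
Qed.

Lemma qmulqV : {in qunit, right_inverse 1 qinv *%R}.
Proof.
move=> q; rewrite unfold_in /qunit /qinv => nq; rewrite nq.
by rewrite -scalerAr qmul_conj scalerA mulVf// scale1r.
Qed.

Lemma qunitP p q : q * p = 1 /\ p * q = 1 -> qunit p.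
Proof.
move=> [qp _]; have : qnorm2 (q * p) = 1.
  by rewrite qp /qnorm2 !quatE; ring.
rewrite qnorm2M /qunit => e; apply/eqP => p0.
by move/eqP: e; rewrite p0 mulr0 eq_sym oner_eq0.
Qed.

Lemma qinv_out : {in [predC qunit], qinv =1 id}.
Proof. by move=> q; rewrite inE /= unfold_in /qunit /qinv => /negbTE ->. Qed.

HB.instance Definition _ := GRing.NzRing_hasMulInverse.Build (quat K)
  qmulVq qmulqV qunitP qinv_out.

End QuatAlgebra.

Section SliceRegular.
Variable R : realType.

Local Notation C := R[i].
Local Notation H := (quat R).
Local Notation HC := (quat R[i]).

Implicit Types (D : set C) (Omega : set H) (F : C -> HC) (f g s : H -> H).

(* w = part1 w + iota part2 w, for w in H (x)_R C *)
Definition part1 (w : HC) : H :=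
  Quat (complex.Re (q0 w)) (complex.Re (q1 w))
       (complex.Re (q2 w)) (complex.Re (q3 w)).
Definition part2 (w : HC) : H :=
  Quat (complex.Im (q0 w)) (complex.Im (q1 w))
       (complex.Im (q2 w)) (complex.Im (q3 w)).
Definition tensor (p q : H) : HC :=
  Quat (q0 p +i* q0 q) (q1 p +i* q1 q) (q2 p +i* q2 q) (q3 p +i* q3 q).

Definition bar (w : HC) : HC := tensor (part1 w) (- part2 w).

Lemma tensorK (w : HC) : tensor (part1 w) (part2 w) = w.
Proof. by case: w => [[? ?] [? ?] [? ?] [? ?]]. Qed.

Lemma part1_tensor p q : part1 (tensor p q) = p.
Proof. by case: p. Qed.

Lemma part2_tensor p q : part2 (tensor p q) = q.
Proof. by case: q. Qed.

Lemma tensorM (p q p' q' : H) :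
  tensor p q * tensor p' q' = tensor (p * p' - q * q') (p * q' + q * p').
Proof.
apply: quat_eq; rewrite !quatE /tensor.
all: apply/eqP; rewrite eq_complex /=; apply/andP; split; apply/eqP; ring.
Qed.

Lemma tensorZ (a b : R) (p q : H) :
  (a +i* b) *: tensor p q = tensor (a *: p - b *: q) (a *: q + b *: p).
Proof. by apply: quat_eq. Qed.

(* The imaginary units, i.e. the 2-sphere S. *)
Definition imS : set H := [set I | I * I = -1].

Definition slice_plane (I : H) : set H :=
  [set q | exists a b : R, q = a%:A + b *: I].

Definition conj_invariant D := forall z, D z -> D z^*.

Definition circularization D : set H :=
  [set q | exists a b : R, exists I : H,
     [/\ D (a +i* b), imS I & q = a%:A + b *: I]].

Definition circular Omega :=
  exists2 D, conj_invariant D & Omega = circularization D.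

Definition circular_domain Omega :=
  [/\ circular Omega, open Omega & connected Omega].

Definition sphere (x y : R) : set H :=
  [set q | exists2 J, imS J & q = x%:A + y *: J].

Definition stem D F := forall z, D z -> F z^* = bar (F z).

Definition induces D F f :=
  forall (a b : R) (I : H), D (a +i* b) -> imS I ->
    f (a%:A + b *: I) = part1 (F (a +i* b)) + I * part2 (F (a +i* b)).

(* Complex derivative: the scalars are K = C. *)
Definition holomorphic D F :=
  forall z, D z -> derivable (F : (C : numFieldType) -> HC) z 1.

(* Only the values of f on Omega matter. *)
Definition slice_regular Omega f :=
  exists D F, [/\ conj_invariant D, Omega = circularization D,
    stem D F, holomorphic D F & induces D F f].

Definition qreal (q : H) := exists a : R, q = a%:A.

Definition slice_preserving_regular Omega f :=
  exists D F, [/\ conj_invariant D, Omega = circularization D,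
    stem D F, holomorphic D F & induces D F f] /\
    forall z, D z -> qreal (part1 (F z)) /\ qreal (part2 (F z)).

(* The slice function I(F), as a total function: q = a + b I with a = q0 q,
   b = |Im q| and I = Im q / |Im q|.  When q is real the second summand is 0,
   in accordance with F2 = 0 on the real axis for a stem function. *)
Definition qim (q : H) : H := Quat 0 (q1 q) (q2 q) (q3 q).
Definition qimnorm (q : H) : R := Num.sqrt (qnorm2 (qim q)).
Definition slice_fun F : H -> H := fun q =>
  let z := q0 q +i* qimnorm q in
  part1 (F z) + ((qimnorm q)^-1 *: qim q) * part2 (F z).

(* Recovers the stem function from the slice function, by the representation
   formula along J = i: F1 = (f(a + b J) + f(a - b J)) / 2 and
   F2 = - J (f(a + b J) - f(a - b J)) / 2. *)
Definition stem_of f : C -> HC := fun z =>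
  let J : H := Quat 0 1 0 0 in
  let u := f ((complex.Re z)%:A + complex.Im z *: J) in
  let v := f ((complex.Re z)%:A - complex.Im z *: J) in
  tensor (2^-1 *: (u + v)) (- (2^-1 *: (J * (u - v)))).

Lemma imS_i : imS (Quat 0 1 0 0).
Proof.
by apply: quat_eq; rewrite !quatE /=; ring.
Qed.

Lemma stem_ofE D F f z :
  conj_invariant D -> stem D F -> induces D F f -> D z -> stem_of f z = F z.
Proof.
move=> Dc sF fF; case: z => a b Dz; rewrite /stem_of /=.
set J : H := Quat 0 1 0 0.
have JJ : J * J = -1 := imS_i.
have -> : a%:A - b *: J = a%:A + (- b) *: J by rewrite scaleNr.
have Dz' : D (a +i* (- b)) by exact: Dc Dz.
rewrite (fF _ _ _ Dz imS_i) (fF _ _ _ Dz' imS_i) -/J.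
have -> : F (a +i* (- b)) = bar (F (a +i* b)) by exact: sF Dz.
rewrite /bar part1_tensor part2_tensor -[RHS]tensorK.
set x := part1 _; set y := part2 _.
have half (t : H) : 2^-1 *: (t + t) = t.
  by apply: quat_eq; rewrite !quatE; field.
congr tensor.
  by rewrite mulrN addrACA subrr addr0 half.
rewrite mulrN opprD opprK addrACA subrr add0r mulrDr mulrA JJ.
by rewrite mulN1r half opprK.
Qed.

Lemma imSE (I : H) : imS I -> q0 I = 0 /\ qnorm2 I = 1.
Proof.
rewrite /imS /= => e.
have h0 := congr1 (@q0 R) e; have h1 := congr1 (@q1 R) e.
have h2 := congr1 (@q2 R) e; have h3 := congr1 (@q3 R) e.
move: h0 h1 h2 h3; rewrite !quatE /qnorm2 /=.
move: (q0 I) (q1 I) (q2 I) (q3 I) => a b c d h0 h1 h2 h3.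
have ha : a = 0.
  have : a * (a ^+ 2 + 1) = 0.
    have -> : a * (a ^+ 2 + 1) = a * (a * a - b * b - c * c - d * d - -1) +
      2^-1 * (b * (a * b + b * a + c * d - d * c) +
              c * (a * c - b * d + c * a + d * b) +
              d * (a * d + b * c - c * b + d * a)) by field.
    by rewrite h0 h1 h2 h3 subrr oppr0 !mulr0 !addr0 mulr0 addr0.
  move/eqP; rewrite mulf_eq0 => /orP[/eqP //|].
  by rewrite gt_eqF// ltr_wpDl// sqr_ge0.
split=> //; apply: oppr_inj; rewrite -h0 ha; ring.
Qed.

Lemma slice_funE D F :
  conj_invariant D -> stem D F -> induces D F (slice_fun F).
Proof.
move=> Dc sF a b I Dz /imSE[I0 I1].
have qi : qim (a%:A + b *: I) = b *: I.
  by apply: quat_eq; rewrite !quatE /= ?I0; ring.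
have qn : qimnorm (a%:A + b *: I) = `|b|.
  rewrite /qimnorm qi -sqrtr_sqr; congr Num.sqrt.
  by rewrite -[RHS]mulr1 -I1 /qnorm2 !quatE; ring.
rewrite /slice_fun qn qi !quatE I0 mulr0 mulr1 addr0 scalerA.
have [b0|b0|b0] := ltgtP b 0.
- have Fz : F (a +i* (- b)) = bar (F (a +i* b)) by exact: sF Dz.
  rewrite ltr0_norm// Fz /bar part1_tensor part2_tensor invrN mulNr mulVf ?lt_eqF//.
  by rewrite scaleN1r mulrNN.
- by rewrite gtr0_norm// mulVf ?gt_eqF// scale1r.
- have /(congr1 part2) := sF _ Dz; rewrite /bar part2_tensor /= b0 oppr0 normr0.
  set u := part2 _ => uN; suff -> : u = 0 by rewrite !mulr0.
  have : 2 *: u = 0 by rewrite scaler_nat mulr2n {1}uN addNr.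
  by move/eqP; rewrite scaler_eq0 pnatr_eq0 => /eqP.
Qed.

Definition star f g : H -> H := slice_fun (fun z => stem_of f z * stem_of g z).

Definition starpow f (n : nat) : H -> H := iter n (star f) (fun=> 1).

Definition conj_slice f : H -> H := slice_fun (fun z => qconj (stem_of f z)).

Definition real_part f : H -> H := fun q => 2^-1 *: (f q + conj_slice f q).
Definition vector_part f : H -> H := fun q => 2^-1 *: (f q - conj_slice f q).

(* f^s *)
Definition symmetrization f : H -> H := star f (conj_slice f).

Definition exp_star f : H -> H := fun q =>
  limn (series (fun n => (n`!%:R)^-1 *: starpow f n q)).
Definition cos_star f : H -> H := fun q =>
  limn (series (fun n => ((-1) ^+ n / (2 * n)`!%:R) *: starpow f (2 * n) q)).
Definition sin_star f : H -> H := fun q =>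
  limn (series (fun n =>
    ((-1) ^+ n / (2 * n).+1`!%:R) *: starpow f (2 * n).+1 q)).

(* [n] is the isolated multiplicity of [p] as a zero of [g]; the factors
   ((q - x)^2 + y^2)^m are slice-preserving, so that their *-product with the
   rest is the pointwise product. *)
Definition isolated_multiplicity Omega g (p : H) (n : nat) :=
  exists (x y : R) (m : nat) (ps : seq H) h,
    [/\ y != 0, sphere x y `<=` Omega,
        slice_regular Omega h & forall q, sphere x y q -> h q != 0] /\
    [/\ size (p :: ps) = n,
        forall p', p' \in p :: ps -> sphere x y p',
        path (fun p1 p2 => p1 != qconj p2) p ps &
        forall q, Omega q ->
          g q = ((q - x%:A) ^+ 2 + (y ^+ 2)%:A) ^+ m
                * foldr (fun p' r => star (fun q' => q' - p') r) h (p :: ps) q].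

End SliceRegular.

Section SimplyConnected.
Variables (R : realType) (T : topologicalType).
Implicit Types (A : set T) (gamma : R -> T).

Definition unit_square : set (R * R) := `[0, 1]%classic `*` `[0, 1]%classic.

Definition path_in A gamma :=
  {within `[0, 1]%classic, continuous gamma} /\
  (forall t, t \in `[0, 1] -> A (gamma t)).

Definition path_connected A :=
  forall a b, A a -> A b ->
    exists gamma, [/\ path_in A gamma, gamma 0 = a & gamma 1 = b].

(* Homotopy relative to the base point of the loop. *)
Definition null_homotopic A gamma :=
  exists h : R * R -> T,
    [/\ {within unit_square, continuous h},
        forall u, unit_square u -> A (h u),
        forall t, t \in `[0, 1] -> h (0, t) = gamma t,
        forall t, t \in `[0, 1] -> h (1, t) = gamma 0 &
        forall s, s \in `[0, 1] -> h (s, 0) = gamma 0 /\ h (s, 1) = gamma 0].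

Definition simply_connected A :=
  path_connected A /\
  forall gamma, path_in A gamma -> gamma 0 = gamma 1 -> null_homotopic A gamma.

End SimplyConnected.

(* Main.v *)
Require Import Defs.
From mathcomp Require Import all_boot all_order all_algebra.
From mathcomp Require Import all_classical all_reals all_analysis.
From mathcomp Require Import complex ring lra.

(** Let F be the stem function of f on the planar open set D underlying Omega,
    and let F_1, F_2, F_3 be the complex coordinates of its vector part.  The
    stem function of f_v^s is S = F_1^2 + F_2^2 + F_3^2, and a slice-preserving
    square root of f_v^s is the same thing as a holomorphic T on D with T^2 = S
    that commutes with complex conjugation.

    The formula is pointwise.  At z with S z <> 0 put w = F z = w_0 + v and
    c = T z, so that v^2 = - c^2.  Then every power of w is a combination of 1
    and v whose coefficients are the half sum of (w_0 + ic)^n and (w_0 - ic)^n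
    and their difference divided by 2ic ([quat_pow]).  Since evaluation of stem
    functions on a slice is compatible with complex scalars ([slice_evalZ]),
    summation only involves the complex exponential, and the formula follows
    from its addition theorem ([cexpD], [exp_star_formula]).

    For the existence of T, S is nowhere locally zero ([not_locally_zero]) and all
    its zeros have even order.  At a real zero this holds because S
    is nonnegative on the real axis ([nonneg_order_even]).  At a nonreal zero
    z_0, factor the stem function of f_v as P^m (z - p_1) ... (z - p_n) G,
    where P is the real quadratic polynomial vanishing on the sphere
    of z_0, the p_i lie on that sphere and the norm of G does not vanish at z_0.
    The norm is multiplicative and z - p_i has norm P, hence S has order 2m + n
    at z_0, and n is an isolated multiplicity ([odd_order_zero]).  So near each
    point S has a holomorphic square root, unique up to sign ([local_sqrt],
    [sqr_germs]).  These roots form a double covering, which a simply connected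
    component trivialises: over a homotopy the covering is trivial, because it is
    trivial over small squares and can be glued along edges ([monodromy]).  The
    root obtained on the closed upper half of D is extended by reflection, which
    creates no singularity on the real axis since S is nonnegative there
    ([holomorphic_sqrt]).

    All of this rests on one local fact ([local_structure]): a function that is
    complex differentiable at every point near z_0 is zero near z_0 or is
    (z - z_0)^k times such a function without zeros.  For a circle
    z_0 + circ t and a point z inside put c t = z_0 + circ t - z.  In the
    coordinates w = z + s c(t) the form F(w) dw / (w - z) is
    F(w) (ds / s + (c' / c) dt); by Goursat's argument its integral over a
    rectangle in (s, t) vanishes, the sides t = 0 and t = 1 cancel, and s -> 0
    gives that the Cauchy integral of F at z is F z times a winding integral
    ([cauchy_star_formula]).  Both factors are Cauchy-type integrals, which are
    differentiable and expand in powers of z - z_0, and the winding integral is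
    nonzero for z close to z_0. *)

Set Implicit Arguments.
Unset Strict Implicit.
Unset Printing Implicit Defensive.

Import Order.TTheory GRing.Theory Num.Theory.
Import numFieldNormedType.Exports.
Import Normc.

Local Open Scope classical_set_scope.
Local Open Scope ring_scope.

(** * Complex numbers: modulus, derivatives, primitives along the line *)

Section ComplexNorm.
Local Open Scope complex_scope.
Variable R : realType.
Local Notation C := R[i].
Implicit Types (F G : C -> C) (z w : C).

Lemma normE z : `|z| = (normc z)%:C. Proof. by []. Qed.

Lemma normc_ge0 z : 0 <= normc z.
Proof. by case: z => a b; rewrite /normc sqrtr_ge0. Qed.

Lemma normc_eq0 z : (normc z == 0) = (z == 0).
Proof.
by apply/eqP/eqP => [/eq0_normc //|->]; rewrite normc0.
Qed.

Lemma normc_gt0 z : (0 < normc z) = (z != 0).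
Proof. by rewrite lt_def normc_ge0 andbT normc_eq0. Qed.

Lemma ler_normcD z w : normc (z + w) <= normc z + normc w.
Proof. exact: le_normcD. Qed.

Lemma normcNE z : normc (- z) = normc z.
Proof. exact: normcN. Qed.

Lemma normc_sub z w : normc (z - w) = normc (w - z).
Proof. by rewrite -normcNE opprB. Qed.

Lemma ler_normcB z w : normc (z - w) <= normc z + normc w.
Proof. by rewrite -(normcNE w) ler_normcD. Qed.

Lemma ler_normc_dist z w t : normc (z - t) <= normc (z - w) + normc (w - t).
Proof. by rewrite (le_trans _ (ler_normcD _ _))// addrA subrK. Qed.

Lemma lerB_normc z w : normc z - normc w <= normc (z - w).
Proof. by rewrite lerBlDr (le_trans _ (ler_normcD _ _))// subrK. Qed.

Lemma normcX z n : normc (z ^+ n) = normc z ^+ n.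
Proof. by elim: n => [|n ih]; rewrite ?expr0 ?normc1// !exprS normcM ih. Qed.

Lemma normc_real (x : R) : normc x%:C = `|x|.
Proof. by rewrite /normc /= expr0n /= addr0 sqrtr_sqr. Qed.

Lemma normc_i : normc ('i : C) = 1.
Proof. by rewrite /normc /= expr0n add0r expr1n sqrtr1. Qed.

Lemma Re_le_normc z : `|complex.Re z| <= normc z.
Proof.
case: z => a b /=; rewrite -sqrtr_sqr ler_wsqrtr//.
by rewrite lerDl sqr_ge0.
Qed.

Lemma Im_le_normc z : `|complex.Im z| <= normc z.
Proof.
case: z => a b /=; rewrite -sqrtr_sqr ler_wsqrtr//.
by rewrite lerDr sqr_ge0.
Qed.

Lemma normc_le_ReIm z : normc z <= `|complex.Re z| + `|complex.Im z|.
Proof.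
case: z => a b.
have -> : normc (a +i* b) = normc (a%:C + 'i * b%:C).
  by congr normc; apply/eqP; rewrite eq_complex /=; apply/andP; split; apply/eqP; ring.
by rewrite (le_trans (ler_normcD _ _))// normcM normc_i !normc_real mul1r.
Qed.

Lemma normc_conj z : normc z^* = normc z.
Proof. by case: z => a b /=; rewrite sqrrN. Qed.

Lemma nbhs_normcP z (P : set C) :
  nbhs (z : (C : numFieldType)) P <-> exists2 d : R, 0 < d & forall w, normc (w - z) < d -> P w.
Proof.
split.
  move=> /nbhs_ballP[/= d d0 dP].
  have [r0 dE] : 0 < complex.Re d /\ d = (complex.Re d)%:C.
    move: d0; rewrite ltcE/= => /andP[/eqP i0 r0]; split => //.
    by apply/eqP; rewrite eq_complex/= eqxx i0/=.
  exists (complex.Re d) => // w wz; apply: dP.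
  by rewrite /ball/= normE dE ltcR normc_sub.
move=> [d d0 dP]; apply/nbhs_ballP; exists d%:C => /=; first by rewrite ltcR.
by move=> w; rewrite /ball/= normE ltcR normc_sub; exact: dP.
Qed.

Lemma open_normcP (D : set C) :
  open (D : set (C : numFieldType)) <-> 
    forall z, D z -> exists2 d : R, 0 < d & forall w, normc (w - z) < d -> D w.
Proof.
rewrite openE; split=> DO z Dz; first by apply/nbhs_normcP; exact: DO.
by apply/nbhs_normcP; exact: DO.
Qed.

End ComplexNorm.

Section ComplexDerivative.
Local Open Scope complex_scope.
Variable R : realType.
Local Notation C := R[i].
Implicit Types (F G : C -> C) (z w : C).

Definition cderivable F z :=
  derivable (F : (C : numFieldType) -> (C : numFieldType)) z 1.

(** The epsilon-delta form of differentiability, with real bounds: it is what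
    Goursat's argument consumes, while sums, products and quotients are
    differentiated through [cderivable]. *)
Definition has_cderivative F z l := forall e : R, 0 < e -> exists2 d : R, 0 < d &
  forall w, normc (w - z) < d -> normc (F w - F z - l * (w - z)) <= e * normc (w - z).

Lemma cderivableP F z : cderivable F z <-> exists l, has_cderivative F z l.
Proof.
split.
  move=> /cvg_ex[/= l Hl]; exists l => e e0.
have Fl := (@cvgrPdist_le (C : numFieldType) (C : numFieldType) _ _ (dnbhs_filter _) _ _).1 Hl.
  have := Fl e%:C; rewrite ltcR => /(_ e0).
  rewrite near_withinE near_simpl => /nbhs_normcP[d d0 dP].
  exists d => // w wd.
  have [->|wz] := eqVneq w z; first by rewrite !subrr mulr0 subrr normc0 mulr0.
  have wz0 : w - z != 0 by rewrite subr_eq0.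
  have := dP (w - z); rewrite subr0 => /(_ wd wz0).
  rewrite /= normE lecR.
  have -> : (w - z) *: 1 + z = w by rewrite [_ *: _]mulr1 subrK.
  move=> H.
  have -> : F w - F z - l * (w - z) =
     - (l - (w - z)^-1 *: (F w - F z)) * (w - z).
    rewrite -[_ *: _]/((w - z)^-1 * (F w - F z)); move: wz0.
    by move: (w - z) (F w - F z) => a b a0; field.
  by rewrite normcM normcNE ler_pM2r// normc_gt0.
move=> [l Fl]; apply/cvg_ex; exists l.
apply/(@cvgrPdist_le (C : numFieldType) (C : numFieldType) _ _ (dnbhs_filter _)) => e e0.
move: (e0); rewrite ltcE => /andP[/eqP i0 r0].
have eE : e = (complex.Re e)%:C by apply/eqP; rewrite eq_complex/= eqxx i0/=.
have [d d0 dP] := Fl _ r0.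
rewrite near_withinE near_simpl; apply/nbhs_normcP; exists d => // h.
rewrite subr0 => hd h0 /=.
have := dP (h + z); rewrite addrK => /(_ hd) H.
rewrite normE eE lecR.
have -> : h *: 1 + z = h + z by rewrite [_ *: _]mulr1.
rewrite -(@ler_pM2r _ (normc h)) ?normc_gt0//.
rewrite (le_trans _ H)// -normcM -normcNE -mulNr opprB.
rewrite -[_ *: (_ - _)]/(h^-1 * (F (h + z) - F z)) mulrBl.
by rewrite mulrAC mulVf// mul1r.
Qed.

Lemma cderivable_continuous F z : cderivable F z ->
  forall e : R, 0 < e -> exists2 d : R, 0 < d &
  forall w, normc (w - z) < d -> normc (F w - F z) <= e.
Proof.
move=> /cderivableP[l Fl] e e0.
have [d d0 dP] := Fl 1 ltr01.
pose M := 1 + normc l.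
have M0 : 0 < M by rewrite ltr_pwDl// normc_ge0.
exists (Num.min d (e / M)) => [|w]; first by rewrite lt_min d0 divr_gt0.
rewrite lt_min => /andP[wd we].
have -> : F w - F z = (F w - F z - l * (w - z)) + l * (w - z) by rewrite subrK.
rewrite (le_trans (ler_normcD _ _))//.
rewrite (le_trans (lerD (dP _ wd) (lexx _)))// normcM -mulrDl -/M.
by rewrite mulrC -ler_pdivlMr// ltW.
Qed.

Lemma cderivable_near F G z (r : R) : 0 < r ->
  (forall w, normc (w - z) < r -> F w = G w) -> cderivable F z -> cderivable G z.
Proof.
move=> r0 FG /cderivableP[l Fl]; apply/cderivableP; exists l => e e0.
have [d d0 dP] := Fl _ e0.
exists (Num.min d r) => [|w]; first by rewrite lt_min d0 r0.
rewrite lt_min => /andP[wd wr].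
by rewrite -!FG ?subrr ?normc0// dP.
Qed.

Lemma cderivable_cst (k : C) z : cderivable (fun=> k) z.
Proof. exact: derivable_cst. Qed.

Lemma cderivable_id z : cderivable id z.
Proof. exact: derivable_id. Qed.

Lemma cderivableD F G z :
  cderivable F z -> cderivable G z -> cderivable (fun w => F w + G w) z.
Proof. exact: derivableD. Qed.

Lemma cderivableB F G z :
  cderivable F z -> cderivable G z -> cderivable (fun w => F w - G w) z.
Proof. exact: derivableB. Qed.

Lemma cderivableM F G z :
  cderivable F z -> cderivable G z -> cderivable (fun w => F w * G w) z.
Proof. exact: derivableM. Qed.

Lemma cderivableV F z :
  F z != 0 -> cderivable F z -> cderivable (fun w => (F w)^-1) z.
Proof. exact: derivableV. Qed.

Lemma cderivableX F n z : cderivable F z -> cderivable (fun w => F w ^+ n) z.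
Proof.
move=> dF; elim: n => [|n ih]; first exact: cderivable_cst.
have -> : (fun w => F w ^+ n.+1) = (fun w => F w * F w ^+ n).
  by apply/funext => w; rewrite exprS.
exact: cderivableM.
Qed.

End ComplexDerivative.

Section Primitive.
Local Open Scope complex_scope.
Variable R : realType.
Local Notation C := R[i].
Implicit Types (Phi phi : R -> C).

Lemma ReD (z w : C) : complex.Re (z + w) = complex.Re z + complex.Re w.
Proof. by case: z w => ? ? []. Qed.
Lemma ImD (z w : C) : complex.Im (z + w) = complex.Im z + complex.Im w.
Proof. by case: z w => ? ? []. Qed.
Lemma ReN (z : C) : complex.Re (- z) = - complex.Re z.
Proof. by case: z. Qed.
Lemma ImN (z : C) : complex.Im (- z) = - complex.Im z.
Proof. by case: z. Qed.
Lemma ReM (z w : C) : complex.Re (z * w) =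
  complex.Re z * complex.Re w - complex.Im z * complex.Im w.
Proof. by case: z w => ? ? []. Qed.
Lemma ImM (z w : C) : complex.Im (z * w) =
  complex.Re z * complex.Im w + complex.Im z * complex.Re w.
Proof. by case: z w => ? ? []. Qed.

Definition ccont phi := continuous (fun t => complex.Re (phi t)) /\ continuous (fun t => complex.Im (phi t)).

(** The interval ]-1, 2[ is a neighbourhood of [0, 1], so that the endpoints of
    the segment of integration need no one-sided derivatives. *)
Definition is_primitive Phi phi := forall t : R, -1 < t < 2 ->
  is_derive t 1 (fun u => complex.Re (Phi u)) (complex.Re (phi t)) /\
  is_derive t 1 (fun u => complex.Im (Phi u)) (complex.Im (phi t)).

Lemma continuous_primitive (u : R -> R) : continuous u ->
  exists U : R -> R, forall t : R, -1 < t < 2 -> is_derive t 1 U (u t).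
Proof.
move=> cu.
pose U (x : R) := (\int[lebesgue_measure]_(t in [set` `[(-1 : R), x]]) (u t))%R.
exists U => t /andP[t1 t2].
have iu : lebesgue_measure.-integrable `[(-1 : R), 2] (EFin \o u).
  apply: continuous_compact_integrable; first exact: segment_compact.
  exact: continuous_subspaceT.
have [dU UE] := continuous_FTC1_closed t2 iu t1 (cu t).
by apply: DeriveDef; [exact: dU|rewrite -derive1E; exact: UE].
Qed.

Lemma ccont_primitive phi : ccont phi -> exists Phi, is_primitive Phi phi.
Proof.
move=> [/continuous_primitive[U HU] /continuous_primitive[V HV]].
by exists (fun t => U t +i* V t) => t ht; split; [exact: HU|exact: HV].
Qed.

Lemma is_primitiveD Phi Psi phi psi : is_primitive Phi phi -> is_primitive Psi psi ->
  is_primitive (fun t => Phi t + Psi t) (fun t => phi t + psi t).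
Proof.
move=> p q t ht; have [p1 p2] := p t ht; have [q1 q2] := q t ht; split.
- have -> : (fun u => complex.Re (Phi u + Psi u)) =
    (fun u => complex.Re (Phi u)) + (fun u => complex.Re (Psi u)).
    by apply/funext => u; rewrite fctE ?ReD ?ImD.
  by apply: is_derive_eq; rewrite ?ReD ?ImD.
- have -> : (fun u => complex.Im (Phi u + Psi u)) =
    (fun u => complex.Im (Phi u)) + (fun u => complex.Im (Psi u)).
    by apply/funext => u; rewrite fctE ?ReD ?ImD.
  by apply: is_derive_eq; rewrite ?ReD ?ImD.
Qed.

Lemma is_primitiveZ (k : C) Phi phi : is_primitive Phi phi ->
  is_primitive (fun t => k * Phi t) (fun t => k * phi t).
Proof.
case: k => a b p t ht; have [p1 p2] := p t ht; split.
- have -> : (fun u => complex.Re ((a +i* b) * Phi u)) =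
    (a \*: (fun u => complex.Re (Phi u))) - (b \*: (fun u => complex.Im (Phi u))).
    by apply/funext => u; rewrite !fctE ?ReM ?ImM.
  by apply: is_derive_eq; rewrite ?ReM ?ImM.
- have -> : (fun u => complex.Im ((a +i* b) * Phi u)) =
    (a \*: (fun u => complex.Im (Phi u))) + (b \*: (fun u => complex.Re (Phi u))).
    by apply/funext => u; rewrite !fctE ?ReM ?ImM.
  by apply: is_derive_eq; rewrite ?ReM ?ImM.
Qed.

Lemma is_primitiveB Phi Psi phi psi : is_primitive Phi phi -> is_primitive Psi psi ->
  is_primitive (fun t => Phi t - Psi t) (fun t => phi t - psi t).
Proof.
move=> p q; have := is_primitiveD p (is_primitiveZ (-1) q).
by congr is_primitive; apply/funext => t; rewrite mulN1r.
Qed.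

Lemma derivative_bound (u du : R -> R) (a b M : R) : -1 < a -> a <= b -> b < 2 ->
  (forall t : R, -1 < t < 2 -> is_derive t 1 u (du t)) ->
  (forall t, a <= t <= b -> `|du t| <= M) -> `|u b - u a| <= M * (b - a).
Proof.
move=> a0 ab b1 Hu HM.
have cu : {within `[a, b], continuous u}.
  apply: derivable_within_continuous => x; rewrite in_itv/= => /andP[ax xb].
  have [] // := Hu x; by rewrite (lt_le_trans a0)//= (le_lt_trans xb).
have Hu' (x : R) : x \in `]a, b[ -> is_derive x 1 u (du x).
  rewrite in_itv/= => /andP[ax xb].
  by apply: Hu; rewrite (lt_trans a0)//= (lt_trans xb).
have [c] := MVT_segment ab Hu' cu.
rewrite in_itv/= => cab ->; rewrite normrM (ger0_norm (_ : 0 <= b - a)) ?subr_ge0//.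
by rewrite ler_wpM2r ?subr_ge0// HM.
Qed.

(** The mean value theorem holds for the real and the imaginary part
    separately, whence the factor 2. *)
Lemma primitive_bound Phi phi (a b M : R) : is_primitive Phi phi -> -1 < a -> a <= b -> b < 2 ->
  (forall t, a <= t <= b -> normc (phi t) <= M) ->
  normc (Phi b - Phi a) <= 2 * M * (b - a).
Proof.
move=> p a0 ab b1 HM.
rewrite (le_trans (normc_le_ReIm _))// -mulrA mulr_natl mulr2n lerD//.
- have -> : complex.Re (Phi b - Phi a) = complex.Re (Phi b) - complex.Re (Phi a).
    by rewrite ?ReD ?ReN ?ImD ?ImN.
  apply: (derivative_bound (u := fun u => complex.Re (Phi u)) (du := fun u => complex.Re (phi u))) => //.
    by move=> t /p[].
  by move=> t /HM; apply: le_trans; exact: Re_le_normc.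
- have -> : complex.Im (Phi b - Phi a) = complex.Im (Phi b) - complex.Im (Phi a).
    by rewrite ?ReD ?ReN ?ImD ?ImN.
  apply: (derivative_bound (u := fun u => complex.Im (Phi u)) (du := fun u => complex.Im (phi u))) => //.
    by move=> t /p[].
  by move=> t /HM; apply: le_trans; exact: Im_le_normc.
Qed.

(** Integral over [0, 1] of a complex-valued function, as the increment of any
    primitive. *)
Definition cint phi : C :=
  if pselect (exists Phi, is_primitive Phi phi) is left h
  then sval (cid h) 1 - sval (cid h) 0 else 0.

Lemma cintE Phi phi : is_primitive Phi phi -> cint phi = Phi 1 - Phi 0.
Proof.
move=> p; rewrite /cint; case: pselect => [h|[]]; last by exists Phi.
case: cid => /= Psi q.
apply/eqP; rewrite -subr_eq0 -normc_eq0 eq_le normc_ge0 andbT.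
have := primitive_bound (M := 0) (is_primitiveB q p) _ ler01 _ => /=.
rewrite mulr0 mul0r.
have -> : Psi 1 - Phi 1 - (Psi 0 - Phi 0) = Psi 1 - Psi 0 - (Phi 1 - Phi 0).
   by ring.
by apply; [lra|lra|move=> t _; rewrite subrr normc0].
Qed.

Lemma cintD phi psi : ccont phi -> ccont psi ->
  cint (fun t => phi t + psi t) = cint phi + cint psi.
Proof.
move=> /ccont_primitive[Phi p] /ccont_primitive[Psi q].
rewrite (cintE (is_primitiveD p q)) (cintE p) (cintE q); ring.
Qed.

Lemma cintZ (k : C) phi : ccont phi -> cint (fun t => k * phi t) = k * cint phi.
Proof.
move=> /ccont_primitive[Phi p]; rewrite (cintE (is_primitiveZ k p)) (cintE p); ring.
Qed.

Lemma cint_bound phi (M : R) : ccont phi ->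
  (forall t, 0 <= t <= 1 -> normc (phi t) <= M) -> normc (cint phi) <= 2 * M.
Proof.
move=> /ccont_primitive[Phi p] HM; rewrite (cintE p).
have := @primitive_bound _ _ 0 1 M p _ ler01 _ HM.
by rewrite subr0 mulr1; apply; lra.
Qed.

Lemma ccontP phi : ccont phi <-> forall (t e : R), 0 < e -> exists2 d : R, 0 < d &
  forall u, `|u - t| < d -> normc (phi u - phi t) <= e.
Proof.
split.
  move=> [c1 c2] t e e0.
  have e20 : 0 < e / 2 by rewrite divr_gt0.
  have /cvgrPdist_le/(_ _ e20)/nbhs_ballP[d1 /= d10 h1] := c1 t.
  have /cvgrPdist_le/(_ _ e20)/nbhs_ballP[d2 /= d20 h2] := c2 t.
  exists (Num.min d1 d2); first by rewrite lt_min d10.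
  move=> u; rewrite lt_min => /andP[u1 u2].
  rewrite (le_trans (normc_le_ReIm _))// [e]splitr lerD//.
    have := h1 u; rewrite /ball/= distrC => /(_ u1); rewrite distrC.
    by rewrite ?ReD ?ReN ?ImD ?ImN.
  have := h2 u; rewrite /ball/= distrC => /(_ u2); rewrite distrC.
  by rewrite ?ReD ?ReN ?ImD ?ImN.
move=> H; split=> t; apply/cvgrPdist_le => e e0; have [d d0 dP] := H t _ e0;
  apply/nbhs_ballP; exists d => //= u; rewrite /ball/= distrC => /dP.
  move=> h; rewrite distrC (le_trans _ h)// (le_trans _ (Re_le_normc _))//.
  by rewrite ?ReD ?ReN ?ImD ?ImN.
move=> h; rewrite distrC (le_trans _ h)// (le_trans _ (Im_le_normc _))//.
by rewrite ?ReD ?ReN ?ImD ?ImN.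
Qed.

Lemma ccont_bounded phi : ccont phi ->
  exists2 M : R, 0 < M & forall t, 0 <= t <= 1 -> normc (phi t) <= M.
Proof.
move=> [c1 c2].
have B (u : R -> R) : continuous u -> exists2 M : R, 0 <= M &
    forall t, 0 <= t <= 1 -> `|u t| <= M.
  move=> cu.
  have cau : {within `[0, 1], continuous (fun t => `|u t|)}.
    apply: continuous_subspaceT => t.
    by apply: (continuous_comp (cu t)); exact: norm_continuous.
  have [t0 _ t0P] := EVT_max ler01 cau.
  by exists `|u t0| => // t t01; apply: t0P; rewrite in_itv.
have [M1 M10 H1] := B _ c1; have [M2 M20 H2] := B _ c2.
exists (M1 + M2 + 1); first by rewrite ltr_wpDl// addr_ge0.
move=> t t01; rewrite (le_trans (normc_le_ReIm _))//.
by have := H1 t t01; have := H2 t t01; lra.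
Qed.

End Primitive.

(** * Subdivision of a rectangle *)

Section Subdivision.
Local Open Scope complex_scope.
Variable R : realType.

Lemma nested_intervals (a : nat -> R) (k : R) : 0 <= k ->
  (forall n, a n <= a n.+1) ->
  (forall n, a n.+1 + k / 2 ^+ n.+1 <= a n + k / 2 ^+ n) ->
  exists x, forall n, a n <= x <= a n + k / 2 ^+ n.
Proof.
move=> k0 a_nd b_ni.
have am m n : (m <= n)%N -> a m <= a n.
  by elim: n => [|n ih]; rewrite leq_eqVlt ?ltnS => /predU1P[-> //|//] /ih /le_trans ->.
have bm m n : (m <= n)%N -> a n + k / 2 ^+ n <= a m + k / 2 ^+ m.
  elim: n => [|n ih]; rewrite leq_eqVlt ?ltnS => /predU1P[-> //|//] /ih.
  exact: le_trans (b_ni n).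
have ab n : a n <= a n + k / 2 ^+ n by rewrite lerDl divr_ge0// exprn_ge0.
have amn m n : a m <= a n + k / 2 ^+ n.
  have [mn|nm] := leqP m n; first exact: le_trans (am _ _ mn) (ab n).
  exact: le_trans (ab m) (bm _ _ (ltnW nm)).
exists (sup (range a)) => n; apply/andP; split.
  apply: ub_le_sup; last by exists n.
  by exists (a 0 + k / 2 ^+ 0) => _ [m _ <-].
by apply: ge_sup => [|_ [m _ <-]]; first by exists (a 0); exists 0.
Qed.

(** Bisection principle: a property of rectangles of a fixed shape which passes
    from the four quarters to the whole, and which holds for all small
    rectangles containing a given point, holds for the whole rectangle; otherwise
    nested bad quarters would shrink to a point.  It serves both Goursat's lemma
    and the triviality of coverings of the square.  The rectangle of size [l] at
    [(a, c)] is [[a, a + kx l] x [c, c + ky l]]. *)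
Lemma square_subdivision (Pr : R -> R -> R -> Prop) (a0 c0 kx ky : R) :
  0 < kx -> 0 < ky ->
  (forall a c l, 0 < l ->
    Pr a c (l / 2) -> Pr (a + kx * (l / 2)) c (l / 2) ->
    Pr a (c + ky * (l / 2)) (l / 2) ->
    Pr (a + kx * (l / 2)) (c + ky * (l / 2)) (l / 2) -> Pr a c l) ->
  (forall x y, a0 <= x <= a0 + kx -> c0 <= y <= c0 + ky ->
    exists2 d, 0 < d & forall a c l, 0 < l < d ->
      a0 <= a -> a + kx * l <= a0 + kx -> c0 <= c -> c + ky * l <= c0 + ky ->
      a <= x <= a + kx * l -> c <= y <= c + ky * l -> Pr a c l) ->
  Pr a0 c0 1.
Proof.
move=> kx0 ky0 merge loc; apply: contrapT => bad.
have step (p : R * R * R) : exists q : R * R,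
    0 < p.2 -> ~ Pr p.1.1 p.1.2 p.2 -> [/\ ~ Pr q.1 q.2 (p.2 / 2),
      p.1.1 <= q.1, q.1 + kx * (p.2 / 2) <= p.1.1 + kx * p.2,
      p.1.2 <= q.2 & q.2 + ky * (p.2 / 2) <= p.1.2 + ky * p.2].
  case: p => [[a c] l] /=.
  have [l0|l0] := ltP 0 l; last by exists 0.
  have lx : 0 < kx * (l / 2) by rewrite mulr_gt0// divr_gt0.
  have ly : 0 < ky * (l / 2) by rewrite mulr_gt0// divr_gt0.
  have l2x : kx * l = kx * (l / 2) + kx * (l / 2) by rewrite -mulrDr -splitr.
  have l2y : ky * l = ky * (l / 2) + ky * (l / 2) by rewrite -mulrDr -splitr.
  have [h1|h1] := pselect (Pr a c (l / 2)); last first.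
    by exists (a, c) => /= _ _; rewrite l2x l2y; split => //; lra.
  have [h2|h2] := pselect (Pr (a + kx * (l / 2)) c (l / 2)); last first.
    by exists (a + kx * (l / 2), c) => /= _ _; rewrite l2x l2y; split => //; lra.
  have [h3|h3] := pselect (Pr a (c + ky * (l / 2)) (l / 2)); last first.
    by exists (a, c + ky * (l / 2)) => /= _ _; rewrite l2x l2y; split => //; lra.
  exists (a + kx * (l / 2), c + ky * (l / 2)) => /= _ h; rewrite l2x l2y; split; try lra.
  by move=> h4; apply: h; exact: merge.
have [g gP] := choice step.
pose s := fix s n : R * R := if n is m.+1 then g (s m, 2 ^- m) else (a0, c0).
have l0 n : 0 < 2 ^- n :> R by rewrite invr_gt0 exprn_gt0.
have lS n : 2 ^- n / 2 = 2 ^- n.+1 :> R by rewrite exprSr invfM.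
have sbad n : ~ Pr (s n).1 (s n).2 (2 ^- n).
  elim: n => [|n ih] /=; first by rewrite expr0 invr1.
  by have [] := gP (s n, 2 ^- n) (l0 n) ih; rewrite /= lS.
have sP n := gP (s n, 2 ^- n) (l0 n) (sbad n).
have [|||x xP] := @nested_intervals (fun n => (s n).1) kx; first exact: ltW.
- by move=> n; have [] := sP n.
- by move=> n; have [] := sP n; rewrite /= lS.
have [|||y yP] := @nested_intervals (fun n => (s n).2) ky; first exact: ltW.
- by move=> n; have [] := sP n.
- by move=> n; have [] := sP n; rewrite /= lS.
have x0 : a0 <= x <= a0 + kx by have := xP 0; rewrite /= expr0 divr1.
have y0 : c0 <= y <= c0 + ky by have := yP 0; rewrite /= expr0 divr1.
have [d d0 dP] := loc x y x0 y0.
have [N HN] : exists N, 2 ^- N < d.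
  exists (Num.bound d^-1); rewrite invf_plt ?posrE ?exprn_gt0//.
  apply: (lt_le_trans (archi_boundP _)); first by rewrite invr_ge0 ltW.
  by rewrite -natrX ler_nat ltnW// ltn_expl.
have in_x n : a0 <= (s n).1 /\ (s n).1 + kx * 2 ^- n <= a0 + kx.
  elim: n => [|n [i1 i2]]; first by rewrite /= expr0 invr1 mulr1.
  have [_ /= j1 j2 _ _] := sP n.
  by split; [exact: le_trans i1 j1|rewrite -lS; exact: le_trans j2 i2].
have in_y n : c0 <= (s n).2 /\ (s n).2 + ky * 2 ^- n <= c0 + ky.
  elim: n => [|n [i1 i2]]; first by rewrite /= expr0 invr1 mulr1.
  have [_ /= _ _ j1 j2] := sP n.
  by split; [exact: le_trans i1 j1|rewrite -lS; exact: le_trans j2 i2].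
have [ix1 ix2] := in_x N; have [iy1 iy2] := in_y N.
by apply: (sbad N); apply: dP; rewrite ?l0.
Qed.

End Subdivision.

(** * Goursat's lemma and Cauchy's formula *)

Section Continuity.
Local Open Scope complex_scope.
Variable R : realType.
Local Notation C := R[i].
Implicit Types (phi psi : R -> C).

Lemma ccont_cst (k : C) : ccont (fun=> k).
Proof.
by apply/ccontP => t e e0; exists 1 => // u _; rewrite subrr normc0 ltW.
Qed.

Lemma ccont_comp (F : C -> C) phi : ccont phi -> (forall t, cderivable F (phi t)) ->
  ccont (fun t => F (phi t)).
Proof.
move=> /ccontP cp dF; apply/ccontP => t e e0.
have [d d0 dP] := cderivable_continuous (dF t) e0.
have d20 : 0 < d / 2 by rewrite divr_gt0.
have [d' d'0 d'P] := cp t _ d20; exists d' => // u /d'P h.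
by apply: dP; rewrite (le_lt_trans h)// gtr_pMr// invf_lt1// ltr1n.
Qed.

Lemma ccontZ (k : C) phi : ccont phi -> ccont (fun t => k * phi t).
Proof.
move=> cp; apply: (@ccont_comp (fun w => k * w)) => // t.
by apply: cderivableM; [exact: cderivable_cst|exact: cderivable_id].
Qed.

Lemma ccontD phi psi : ccont phi -> ccont psi -> ccont (fun t => phi t + psi t).
Proof.
move=> /ccontP cp /ccontP cq; apply/ccontP => t e e0.
have e20 : 0 < e / 2 by rewrite divr_gt0.
have [d d0 dP] := cp t _ e20; have [d' d'0 d'P] := cq t _ e20.
exists (Num.min d d') => [|u]; first by rewrite lt_min d0.
rewrite lt_min => /andP[/dP h /d'P h'].
have -> : phi u + psi u - (phi t + psi t) = (phi u - phi t) + (psi u - psi t) by ring.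
by rewrite (le_trans (ler_normcD _ _))// [e]splitr lerD.
Qed.

Lemma ccontB phi psi : ccont phi -> ccont psi -> ccont (fun t => phi t - psi t).
Proof.
move=> cp cq; have -> : (fun t => phi t - psi t) = (fun t => phi t + (-1) * psi t).
  by apply/funext => t; rewrite mulN1r.
by apply: ccontD => //; exact: ccontZ.
Qed.

(** By polarisation, products reduce to the differentiable map z |-> z^2. *)
Lemma ccontM phi psi : ccont phi -> ccont psi -> ccont (fun t => phi t * psi t).
Proof.
move=> cp cq.
have sq (chi : R -> C) : ccont chi -> ccont (fun t => chi t ^+ 2).
  move=> cc; apply: (@ccont_comp (fun w : C => w ^+ 2) chi) => // t.
  by apply: (@cderivableX _ id); exact: cderivable_id.
have -> : (fun t => phi t * psi t) =
    (fun t => 4^-1 * ((phi t + psi t) ^+ 2 - (phi t - psi t) ^+ 2)).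
  by apply/funext => t; field.
apply: ccontZ; apply: ccontB; apply: sq; [exact: ccontD|exact: ccontB].
Qed.

Lemma ccontV phi : (forall t, phi t != 0) -> ccont phi -> ccont (fun t => (phi t)^-1).
Proof.
move=> p0 cp; apply: (@ccont_comp (fun w : C => w^-1) phi) => // t.
by apply: (@cderivableV _ id) => //; exact: cderivable_id.
Qed.

End Continuity.

Section Goursat.
Local Open Scope complex_scope.
Variable R : realType.
Local Notation C := R[i].
Variables (F : C -> C) (z : C) (c c' : R -> C) (Mc M' m : R).
Hypothesis cc : ccont c.
Hypothesis cc' : ccont c'.
Hypothesis c_prim : is_primitive c c'.
Hypothesis c_closed : c 0 = c 1.
Hypothesis m0 : 0 < m.
Hypothesis c_ge : forall t, m <= normc (c t).
Hypothesis c_le : forall t, normc (c t) <= Mc.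
Hypothesis c'_le : forall t, normc (c' t) <= M'.
Hypothesis dF : forall (s t : R), 0 <= s <= 1 -> cderivable F (z + s%:C * c t).

Let b t := c' t / c t.

Let c_neq0 t : c t != 0.
Proof. by rewrite -normc_gt0 (lt_le_trans m0). Qed.

Let cb : ccont b.
Proof. by apply: ccontM => //; exact: ccontV. Qed.

Let Mb := M' / m.

Let M'0 : 0 <= M'.
Proof. exact: le_trans (normc_ge0 _) (c'_le 0). Qed.

Let Mc0 : 0 < Mc.
Proof. exact: lt_le_trans m0 (le_trans (c_ge 0) (c_le 0)). Qed.

Let Mb0 : 0 <= Mb.
Proof. by rewrite divr_ge0// ltW. Qed.

Let b_le t : normc (b t) <= Mb.
Proof.
rewrite /b normcM normcV /Mb ler_pM ?normc_ge0 ?invr_ge0 ?normc_ge0//.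
by rewrite lef_pV2 ?posrE// normc_gt0.
Qed.

Let c_lip (t u : R) : 0 <= t <= 1 -> 0 <= u <= 1 -> normc (c t - c u) <= 2 * M' * `|t - u|.
Proof.
have H (v w : R) : 0 <= v -> v <= w -> w <= 1 -> normc (c w - c v) <= 2 * M' * (w - v).
  by move=> v0 vw w1; apply: (primitive_bound c_prim) => //; lra.
move=> /andP[t0 t1] /andP[u0 u1]; have [tu|ut] := leP t u.
  by rewrite normc_sub distrC ger0_norm ?subr_ge0// H.
by rewrite ger0_norm ?subr_ge0 ?(ltW ut)// H ?(ltW ut).
Qed.

(** The integral of F(w) dw / (w - z) over the closed curve t |-> z + s c(t),
    the homothetic image with centre z of the curve t |-> z + c(t). *)
Definition scaled_integral (s : R) := cint (fun t => F (z + s%:C * c t) * (c' t / c t)).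

(* The form F(w) ds / s lives on eps <= s <= 1; composing with the retraction
   onto this interval gives functions that are continuous on the whole line. *)
Let clamp (eps s : R) := Num.max eps (Num.min s 1).

Let clamp_in (eps s : R) : 0 < eps < 1 -> 0 < clamp eps s /\ clamp eps s <= 1.
Proof.
move=> /andP[e0 e1]; rewrite /clamp lt_max e0 ge_max (ltW e1); split => //=.
by rewrite ge_min lexx orbT.
Qed.

Let clamp_id (eps s : R) : eps <= s <= 1 -> clamp eps s = s.
Proof. by move=> /andP[es s1]; rewrite /clamp min_l// max_r. Qed.

Let clamp_cont (eps : R) : ccont (fun s => (clamp eps s)%:C).
Proof.
split; last exact: cst_continuous.
move=> s; apply: (@continuous_max _ R (cst eps) (fun s => Num.min s 1)).
  exact: cst_continuous.
by apply: (@continuous_min _ R id (cst 1)); [exact: cvg_id|exact: cst_continuous].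
Qed.

(** Goursat's lemma.  The boundary integral [mu] of F(w) (ds / s + b dt) over a
    rectangle is written with primitives in each variable, so its additivity is
    an algebraic identity.  Near a point, F differs from an affine function by a
    small multiple of the distance, and the boundary integral of an affine
    function vanishes exactly; so [mu] of a small square is at most [e] times its
    area, and bisection gives the same bound on the whole rectangle. *)
Lemma cint_scaled_const (eps : R) : 0 < eps < 1 -> 
  scaled_integral 1 = scaled_integral eps.
Proof.
move=> eps01; have /andP[eps0 eps1] := eps01.
pose sg := clamp eps.
have sg_in s := clamp_in s eps01.
have sg0 s : (sg s)%:C != 0 :> C.
  by rewrite eq_complex /= eqxx andbT gt_eqF//; exact: (sg_in s).1.
have dFsg s t : cderivable F (z + (sg s)%:C * c t).
  by apply: dF; have [/ltW -> ->] := sg_in s.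
have csg := clamp_cont eps.
have contP t : ccont (fun s => F (z + (sg s)%:C * c t) / (sg s)%:C).
  apply: ccontM; last exact: ccontV.
  apply: ccont_comp => //; apply: ccontD; first exact: ccont_cst.
  by apply: ccontM => //; exact: ccont_cst.
have contQ s : ccont (fun t => F (z + (sg s)%:C * c t) * b t).
  apply: ccontM => //; apply: ccont_comp => //.
  by apply: ccontD; [exact: ccont_cst|exact: ccontZ].
have [A AP] := choice (fun t => ccont_primitive (contP t)).
have [B BP] := choice (fun s => ccont_primitive (contQ s)).
have [Lam LamP] := ccont_primitive (ccontV sg0 csg).
have [Bb BbP] := ccont_primitive cb.
have idP : is_primitive (fun s => (s%:C : C)) (fun=> 1).
  by move=> t _; split; [exact: is_derive_id|exact: is_derive_cst].
pose kx := 1 - eps.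
have kx0 : 0 < kx by rewrite subr_gt0.
have kx1 : kx <= 1 by rewrite /kx; lra.
pose mu (a u l : R) : C :=
  (A u (a + kx * l) - A u a) + (B (a + kx * l) (u + l) - B (a + kx * l) u)
  - (A (u + l) (a + kx * l) - A (u + l) a) - (B a (u + l) - B a u).
suff H (e : R) : 0 < e -> normc (mu eps 0 1) <= e.
  have mu0 : mu eps 0 1 = 0.
    apply/eqP; rewrite -normc_eq0 eq_le normc_ge0 andbT.
    by apply/ler_addgt0Pr => e /H; rewrite add0r.
  have eA : A 1 1 - A 1 eps = A 0 1 - A 0 eps.
    apply/eqP; rewrite -subr_eq0 -normc_eq0 eq_le normc_ge0 andbT.
    have := primitive_bound (M := 0) (a := eps) (b := 1) (is_primitiveB (AP 1) (AP 0)).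
    have -> : A 1 1 - A 0 1 - (A 1 eps - A 0 eps) = A 1 1 - A 1 eps - (A 0 1 - A 0 eps).
      by ring.
    rewrite mulr0 mul0r; apply; [lra|lra|lra|].
    by move=> t _; rewrite c_closed subrr normc0.
  have sg1 : sg 1 = 1 by rewrite /sg clamp_id// (ltW eps1) lexx.
  have sge : sg eps = eps by rewrite /sg clamp_id// (ltW eps1) lexx.
  rewrite /scaled_integral.
  have := cintE (BP 1); rewrite sg1 => ->; have := cintE (BP eps); rewrite sge => ->.
  move: mu0; rewrite /mu mulr1 add0r.
  have -> : eps + kx = 1 by rewrite /kx addrC subrK.
  rewrite eA => h; apply/eqP; rewrite -subr_eq0 -h; apply/eqP; ring.
move=> e0.
pose Pr (a u l : R) := normc (mu a u l) <= e * l ^+ 2.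
suff : Pr eps 0 1 by rewrite /Pr expr1n mulr1.
apply: (@square_subdivision R Pr eps 0 kx 1) => //.
- move=> a u l l0; rewrite /Pr !mul1r => h1 h2 h3 h4.
  have -> : mu a u l = mu a u (l / 2) + mu (a + kx * (l / 2)) u (l / 2) +
      mu a (u + l / 2) (l / 2) + mu (a + kx * (l / 2)) (u + l / 2) (l / 2).
    rewrite /mu.
    have -> : a + kx * (l / 2) + kx * (l / 2) = a + kx * l by field.
    have -> : u + l / 2 + l / 2 = u + l by field.
    ring.
  have D4 (p q r t : C) : normc (p + q + r + t) <= normc p + normc q + normc r + normc t.
    rewrite (le_trans (ler_normcD _ _))// lerD2r (le_trans (ler_normcD _ _))//.
    by rewrite lerD2r ler_normcD.
  apply: le_trans (D4 _ _ _ _) _.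
  have -> : e * l ^+ 2 = e * (l / 2) ^+ 2 + e * (l / 2) ^+ 2 +
      e * (l / 2) ^+ 2 + e * (l / 2) ^+ 2 by field.
  by rewrite !lerD.
move=> x y; rewrite addrC subrK add0r => /andP[x0 x1] y01.
have x01 : 0 <= x <= 1 by apply/andP; split => //; lra.
pose ws := z + x%:C * c y.
have /cderivableP[L FL] := @dF x y x01.
rewrite -/ws in FL.
pose K := Mc + 2 * M'.
have K0 : 0 < K by rewrite ltr_wpDr// mulr_ge0.
pose T := 4 / eps + 4 * Mb.
have T0 : 0 < T by rewrite /T; have := divr_gt0 (ltr0Sn R 3) eps0; have := Mb0; lra.
have e'0 : 0 < e / (K * T) by rewrite divr_gt0// mulr_gt0.
have [d d0 dP] := FL _ e'0.
exists (d / K); first by rewrite divr_gt0.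
move=> a u l /andP[l0 ld] a0 a1; rewrite !mul1r => u0 u1 /andP[ax xa] /andP[uy yu].

have kl0 : 0 <= kx * l by rewrite mulr_ge0// ltW.
have kll : kx * l <= l by rewrite ler_piMl// ltW.
have q0 : 0 <= e / (K * T) * (K * l) by apply: mulr_ge0; [exact: ltW|apply: mulr_ge0; exact: ltW].
pose al := F ws - L * (ws - z).
(* The affine approximation of F at the point ws, in the coordinates (s, t). *)
pose lin (s t : R) := al + L * (s%:C * c t).
have Fclose s t : a <= s <= a + kx * l -> u <= t <= u + l ->
    normc (F (z + s%:C * c t) - lin s t) <= e / (K * T) * (K * l).
  move=> /andP[as_ sa] /andP[ut tu].
  have wd : normc (z + s%:C * c t - ws) <= K * l.
    have -> : z + s%:C * c t - ws = (s - x)%:C * c t + x%:C * (c t - c y).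
      by rewrite /ws rmorphB /=; ring.
    rewrite (le_trans (ler_normcD _ _))// !normcM !normc_real /K mulrDl lerD//.
      rewrite mulrC ler_pM ?normc_ge0// ler_norml; apply/andP; split; lra.
    rewrite (ger0_norm (_ : 0 <= x)); last by case/andP: x01.
    rewrite (@le_trans _ _ (1 * (2 * M' * `|t - y|)))//.
      case/andP: (x01) => x0' x1'; rewrite ler_pM ?normc_ge0//; apply: c_lip => //; apply/andP; split; lra.
    rewrite mul1r ler_wpM2l ?mulr_ge0// ler_norml; apply/andP; split; lra.
  have -> : lin s t = F ws + L * (z + s%:C * c t - ws) by rewrite /lin /al; ring.
  rewrite opprD addrA (le_trans (dP _ _))//.
    by rewrite (le_lt_trans wd)// mulrC -ltr_pdivlMr.
  by rewrite ler_wpM2l// ltW.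
have in01 s : a <= s <= a + kx * l -> eps <= s <= 1.
  by move=> /andP[? ?]; apply/andP; split; lra.
(* The primitives of the affine approximation are explicit: al times a primitive
   of ds / s, respectively of b dt, plus L s c(t). *)
have Abound t : u <= t <= u + l ->
   normc ((A t (a + kx * l) - A t a) - (al * (Lam (a + kx * l) - Lam a) +
      (L * c t) * ((a + kx * l)%:C - a%:C))) <= 2 * (e / (K * T) * (K * l) / eps) * l.
  move=> ut.
  have p := is_primitiveB (AP t) (is_primitiveD (is_primitiveZ al LamP) (is_primitiveZ (L * c t) idP)).
  have := primitive_bound (a := a) (b := a + kx * l) (M := e / (K * T) * (K * l) / eps) p.
  set X := normc _; set Y := normc _; have -> : X = Y by congr normc; ring.
  move=> H; apply: le_trans (H _ _ _ _) _; [lra|lra|lra| |].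
    move=> s sin; rewrite /sg clamp_id ?in01//.
    have s0 : 0 < s by have /andP[] := in01 _ sin; lra.
    have s0' : s%:C != 0 :> C by rewrite eq_complex/= eqxx andbT gt_eqF.
    have -> : F (z + s%:C * c t) / s%:C - (al * s%:C^-1 + L * c t * 1) =
       (F (z + s%:C * c t) - lin s t) / s%:C by rewrite /lin; field.
    rewrite normcM normcV normc_real gtr0_norm// ler_pM ?normc_ge0 ?invr_ge0 ?(ltW s0)//.
      exact: Fclose.
    by rewrite lef_pV2 ?posrE//; have /andP[] := in01 _ sin.
  by rewrite [X in X - a]addrC addrK ler_wpM2l// mulr_ge0// divr_ge0// ltW.
have Bbound s : a <= s <= a + kx * l ->
   normc ((B s (u + l) - B s u) - (al * (Bb (u + l) - Bb u) +
      (L * s%:C) * (c (u + l) - c u))) <= 2 * (e / (K * T) * (K * l) * Mb) * l.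
  move=> sin.
  have p := is_primitiveB (BP s) (is_primitiveD (is_primitiveZ al BbP) (is_primitiveZ (L * s%:C) c_prim)).
  have := primitive_bound (a := u) (b := u + l) (M := e / (K * T) * (K * l) * Mb) p.
  set X := normc _; set Y := normc _; have -> : X = Y by congr normc; ring.
  move=> H; apply: le_trans (H _ _ _ _) _; [lra|lra|lra| |].
    move=> t tin; rewrite /sg clamp_id ?in01//.
    have -> : F (z + s%:C * c t) * b t - (al * b t + L * s%:C * c' t) =
       (F (z + s%:C * c t) - lin s t) * b t.
      by rewrite /lin /b; have := c_neq0 t; move: (c t) => ct ct0; field.
    by rewrite normcM ler_pM ?normc_ge0//; exact: Fclose.
  by rewrite [X in X - u]addrC addrK.
have inu : u <= u <= u + l by lra.
have inu' : u <= u + l <= u + l by lra.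
have ina : a <= a <= a + kx * l by lra.
have ina' : a <= a + kx * l <= a + kx * l by lra.
rewrite /Pr.
move: (Abound _ inu) (Abound _ inu') (Bbound _ ina) (Bbound _ ina').
set X1 := (X in normc X); set X2 := (X in _ -> normc X <= _ -> _).
set X3 := (X in _ -> _ -> normc X <= _ -> _).
set X4 := (X in _ -> _ -> _ -> normc X <= _ -> _) => h1 h2 h3 h4.
have -> : mu a u l = X1 + X4 - X2 - X3 by rewrite /mu /X1 /X2 /X3 /X4; ring.
have H4 : normc (X1 + X4 - X2 - X3) <= normc X1 + normc X4 + normc X2 + normc X3.
  rewrite (le_trans (ler_normcB _ _))// lerD2r (le_trans (ler_normcB _ _))//.
  by rewrite lerD2r ler_normcD.
apply: (le_trans H4).
have -> : e * l ^+ 2 = 2 * (e / (K * T) * (K * l) / eps) * l +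
    2 * (e / (K * T) * (K * l) * Mb) * l + 2 * (e / (K * T) * (K * l) / eps) * l +
    2 * (e / (K * T) * (K * l) * Mb) * l.
  have -> : e = e / (K * T) * K * T by field; rewrite !gt_eqF.
  rewrite {2}/T; move: (e / (K * T)) => q.
  suff -> : q * K * T / (K * T) = q by field; rewrite gt_eqF.
  by field; rewrite !gt_eqF.
by rewrite !lerD.
Qed.

(** The scaled integral does not depend on the scale, and shrinking the curve
    to z makes F(w) tend to F z. *)
Lemma cauchy_star_formula :
  cint (fun t => F (z + c t) * (c' t / c t)) = F z * cint (fun t => c' t / c t).
Proof.
have dFz : cderivable F z.
  by have := @dF 0 0; rewrite mul0r addr0; apply; rewrite lexx ler01.
apply/eqP; rewrite -subr_eq0 -normc_eq0 eq_le normc_ge0 andbT.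
apply/ler_addgt0Pr => e e0; rewrite add0r.
have M10 : 0 < 2 * Mb + 1 by rewrite ltr_wpDl// mulr_ge0.
have [d d0 dP] := cderivable_continuous dFz (divr_gt0 e0 M10).
pose eps := Num.min (2^-1) (d / (2 * Mc)).
have eps0 : 0 < eps by rewrite lt_min invr_gt0 ltr0Sn divr_gt0// mulr_gt0.
have eps1 : eps < 1 by rewrite gt_min invf_lt1// ltr1n.
have epsd : eps * Mc < d.
  rewrite (@le_lt_trans _ _ (d / 2))//; last by rewrite ltr_pdivrMr// mulr_natr mulr2n ltrDl.
  rewrite -ler_pdivlMr// ge_min; apply/orP; right.
  by rewrite invfM mulrA.
have := @cint_scaled_const eps; rewrite eps0 eps1 => /(_ isT).
rewrite /scaled_integral.
have -> : (fun t => F (z + 1%:C * c t) * (c' t / c t)) =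
   (fun t => F (z + c t) * (c' t / c t)) by apply/funext => t; rewrite mul1r.
move=> ->.
have eps01 : 0 <= eps <= 1 by rewrite !ltW.
have cFe : ccont (fun t => F (z + eps%:C * c t)).
  apply: ccont_comp; last by move=> t; exact: dF.
  by apply: ccontD; [exact: ccont_cst|exact: ccontZ].
rewrite -(cintZ _ cb).
have -> : cint (fun t => F (z + eps%:C * c t) * (c' t / c t)) - cint (fun t => F z * b t) =
    cint (fun t => (F (z + eps%:C * c t) - F z) * b t).
  rewrite -mulN1r -cintZ; last exact: ccontZ.
  rewrite -cintD; first by congr cint; apply/funext => t; rewrite /b; ring.
    exact: ccontM.
  by apply: ccontZ; exact: ccontZ.
apply: le_trans (@cint_bound _ _ (e / (2 * Mb + 1) * Mb) _ _) _.
- by apply: ccontM => //; apply: ccontB => //; exact: ccont_cst.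
- move=> t _; rewrite normcM ler_pM ?normc_ge0//.
  apply: dP; rewrite addrAC subrr add0r normcM normc_real ger0_norm ?(ltW eps0)//.
  by apply: le_lt_trans epsd; rewrite ler_wpM2l// ltW.
- have -> : 2 * (e / (2 * Mb + 1) * Mb) = e * ((2 * Mb) / (2 * Mb + 1)).
    by field; rewrite gt_eqF.
  by rewrite ler_piMr// ?(ltW e0)// ler_pdivrMr// mul1r lerDl.
Qed.

End Goursat.

(** * Cauchy-type integrals over a circle *)

Section Circle.
Local Open Scope complex_scope.
Variable R : realType.
Local Notation C := R[i].
Variables (z0 : C) (r : R).
Hypothesis r0 : 0 < r.

Definition circ (t : R) : C := r%:C * (cos (2 * pi * t) +i* sin (2 * pi * t)).
(** The derivative of [circ], as the complex multiple 2 pi i of it. *)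
Definition circ' (t : R) : C := (0 +i* (2 * pi)) * circ t.

Lemma normc_circ t : normc (circ t) = r.
Proof. by rewrite /circ normcM normc_real gtr0_norm//= cos2Dsin2 sqrtr1 mulr1. Qed.

Lemma circ_neq0 t : circ t != 0.
Proof. by rewrite -normc_gt0 normc_circ. Qed.

Lemma circ_primitive : is_primitive circ circ'.
Proof.
move=> t _; split.
  rewrite (_ : (fun u => _) = r \*: (cos \o ( *%R (2 * pi)))); last first.
    by apply/funext => u; rewrite /circ ReM /= mul0r subr0.
  apply: is_derive_eq.
  by rewrite /circ' /circ !ReM ImM /= /GRing.scale /=; ring.
rewrite (_ : (fun u => _) = r \*: (sin \o ( *%R (2 * pi)))); last first.
  by apply/funext => u; rewrite /circ ImM /= mul0r addr0.
apply: is_derive_eq.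
by rewrite /circ' /circ ImM ReM !ImM /= /GRing.scale /=; ring.
Qed.

Lemma ccont_circ : ccont circ.
Proof.
apply: ccontM; first exact: ccont_cst.
split=> t.
  apply: (@continuous_comp _ _ _ ( *%R (2 * pi)) cos); last exact: continuous_cos.
  exact: mulrl_continuous.
apply: (@continuous_comp _ _ _ ( *%R (2 * pi)) sin); last exact: continuous_sin.
exact: mulrl_continuous.
Qed.

Lemma ccont_circ' : ccont circ'.
Proof. exact: ccontZ ccont_circ. Qed.

Lemma circ_closed : circ 0 = circ 1.
Proof.
by rewrite /circ mulr0 mulr1 cos0 sin0 [2 * pi]mulrC mulr_natr cos2pi sin2pi.
Qed.

Definition cauchy_type (phi : R -> C) (z : C) :=
  cint (fun t => phi t / (z0 + circ t - z)).

Lemma dist_circ z t : r - normc (z - z0) <= normc (z0 + circ t - z).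
Proof.
have -> : z0 + circ t - z = circ t - (z - z0) by ring.
by rewrite -{1}(normc_circ t) lerB_normc.
Qed.

Lemma circ_sub_neq0 z t : normc (z - z0) < r -> z0 + circ t - z != 0.
Proof. by move=> zr; rewrite -normc_gt0 (lt_le_trans _ (dist_circ _ _))// subr_gt0. Qed.

Lemma ccont_circ_sub z : ccont (fun t => z0 + circ t - z).
Proof.
apply: ccontB; last exact: ccont_cst.
by apply: ccontD; [exact: ccont_cst|exact: ccont_circ].
Qed.

Lemma ccont_cauchy phi z : normc (z - z0) < r -> ccont phi ->
  ccont (fun t => phi t / (z0 + circ t - z)).
Proof.
move=> zr cp; apply: ccontM => //; apply: ccontV; last exact: ccont_circ_sub.
by move=> t; exact: circ_sub_neq0.
Qed.

Lemma cauchy_type_bound phi z M : normc (z - z0) < r -> ccont phi ->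
  (forall t, 0 <= t <= 1 -> normc (phi t) <= M) ->
  normc (cauchy_type phi z) <= 2 * (M / (r - normc (z - z0))).
Proof.
move=> zr cp HM; apply: cint_bound; first exact: ccont_cauchy.
move=> t t01; rewrite normcM normcV ler_pM ?normc_ge0 ?invr_ge0 ?normc_ge0 ?HM//.
by rewrite lef_pV2 ?posrE ?dist_circ ?subr_gt0// normc_gt0 circ_sub_neq0.
Qed.

(** One step of the geometric expansion of 1 / (w - z) in powers of z - z_0. *)
Lemma cauchy_type_expand phi z : normc (z - z0) < r -> ccont phi ->
  cauchy_type phi z =
  cauchy_type phi z0 + (z - z0) * cauchy_type (fun t => phi t / circ t) z.
Proof.
move=> zr cp; have zr0 : normc (z0 - z0) < r by rewrite subrr normc0.
have cpc : ccont (fun t => phi t / circ t).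
  by apply: ccontM => //; apply: ccontV; [exact: circ_neq0|exact: ccont_circ].
rewrite /cauchy_type -cintZ; last exact: ccont_cauchy.
rewrite -cintD; [|exact: ccont_cauchy|by apply: ccontZ; exact: (ccont_cauchy zr cpc)].
congr cint; apply/funext => t.
have := circ_sub_neq0 t zr; have := circ_neq0 t.
rewrite [z0 + _]addrC addrK; move: (circ t) => ct ct0 h; field.
by rewrite h.
Qed.

(** The difference quotient of the kernel 1 / (w - z) differs from
    1 / (w - z)^2 by a multiple of z' - z that is bounded uniformly in w, so the
    derivative can be taken under the integral. *)
Lemma cderivable_cauchy_type phi z : normc (z - z0) < r -> ccont phi ->
  cderivable (cauchy_type phi) z.
Proof.
move=> zr cp; have [M M0 MP] := ccont_bounded cp.
have n0 := circ_sub_neq0 _ zr.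
have cpV : ccont (fun t => phi t / (z0 + circ t - z) ^+ 2).
  rewrite (_ : (fun t => _) = (fun t => phi t / (z0 + circ t - z) / (z0 + circ t - z))).
    by apply: ccont_cauchy => //; exact: ccont_cauchy.
  by apply/funext => t; rewrite expr2 invfM mulrA.
apply/cderivableP; exists (cint (fun t => phi t / (z0 + circ t - z) ^+ 2)) => e e0.
pose h := (r - normc (z - z0)) / 2.
have h0 : 0 < h by rewrite divr_gt0// subr_gt0.
have h2 : r - normc (z - z0) = 2 * h by rewrite /h mulrC divfK.
pose K := 2 * (M / (4 * h ^+ 3)).
have K0 : 0 < K by rewrite mulr_gt0// divr_gt0// mulr_gt0// exprn_gt0.
exists (Num.min h (e / K)); first by rewrite lt_min h0 divr_gt0.
move=> w; rewrite lt_min => /andP[wh we].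
have wr : h <= r - normc (w - z0).
  by have := ler_normc_dist w z z0; lra.
have wr' : normc (w - z0) < r by have := h0; lra.
have n0' := circ_sub_neq0 _ wr'.
have cw : ccont (fun t => phi t / (z0 + circ t - w)) by exact: ccont_cauchy.
have cz : ccont (fun t => phi t / (z0 + circ t - z)) by exact: ccont_cauchy.
have -> : cauchy_type phi w - cauchy_type phi z -
    cint (fun t => phi t / (z0 + circ t - z) ^+ 2) * (w - z) =
    (w - z) ^+ 2 * cint (fun t => phi t / (z0 + circ t - z) ^+ 2 / (z0 + circ t - w)).
  rewrite /cauchy_type -cintZ; last exact: ccont_cauchy.
  set c1 := cint _; set c2 := cint _; set c3 := cint _.
  have -> : c1 - c2 - c3 * (w - z) = c1 + ((-1) * c2 + (z - w) * c3) by ring.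
  rewrite /c1 /c2 /c3 -!cintZ//.
  rewrite -[X in _ + X]cintD; [|exact: ccontZ|exact: ccontZ].
  rewrite -cintD//; last by apply: ccontD; exact: ccontZ.
  congr cint; apply/funext => t.
  by have := n0 t; have := n0' t; move: (circ t) => ct ? ?; field; apply/andP; split.
rewrite normcM normcX.
have B : normc (cint (fun t => phi t / (z0 + circ t - z) ^+ 2 / (z0 + circ t - w))) <= K.
  apply: cint_bound; first exact: ccont_cauchy.
  move=> t t01; rewrite !normcM !normcV normcX -mulrA ler_pM ?normc_ge0 ?MP//.
    by rewrite mulr_ge0// invr_ge0 ?exprn_ge0 ?normc_ge0.
  rewrite -invfM lef_pV2 ?posrE; last 2 first.
  - by rewrite mulr_gt0 ?exprn_gt0 ?normc_gt0.
  - by rewrite mulr_gt0// exprn_gt0.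
  have -> : 4 * h ^+ 3 = (2 * h) ^+ 2 * h by ring.
  have h20 : 0 <= 2 * h by rewrite -h2 subr_ge0 ltW.
  apply: ler_pM; [exact: exprn_ge0|exact: ltW| |].
    by rewrite lerXn2r ?nnegrE ?normc_ge0// -h2 dist_circ.
  exact: le_trans wr (dist_circ _ _).
rewrite expr2 -mulrA mulrC ler_wpM2r ?normc_ge0//.
rewrite (le_trans (ler_wpM2l (normc_ge0 _) B))//.
by rewrite -ler_pdivlMr// ltW.
Qed.

End Circle.

(** * Local factorisation of holomorphic functions *)

Section LocalStructure.
Local Open Scope complex_scope.
Variable R : realType.
Local Notation C := R[i].
Variables (F : C -> C) (z0 : C) (rho : R).
Hypothesis rho0 : 0 < rho.
Hypothesis dF : forall w, normc (w - z0) < rho -> cderivable F w.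

Let r := rho / 2.
Let r0 : 0 < r. Proof. by rewrite divr_gt0. Qed.

Let winding z := cauchy_type z0 r (circ' r) z.

Let cauchy_formula z : normc (z - z0) < r ->
  cauchy_type z0 r (fun t => F (z0 + circ r t) * circ' r t) z = F z * winding z.
Proof.
move=> zr.
have m0 : 0 < r - normc (z - z0) by rewrite subr_gt0.
have pc : is_primitive (fun t => z0 + circ r t - z) (circ' r).
  have p0 (k : C) : is_primitive (fun=> k) (fun=> 0).
    by move=> t _; split; exact: is_derive_cst.
  have := is_primitiveB (is_primitiveD (p0 z0) (circ_primitive r)) (p0 z).
  by congr is_primitive; apply/funext => t; rewrite add0r subr0.
have cl : z0 + circ r 0 - z = z0 + circ r 1 - z by rewrite circ_closed.
have c_le t : normc (z0 + circ r t - z) <= r + normc (z - z0).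
  have -> : z0 + circ r t - z = circ r t - (z - z0) by ring.
  by rewrite (le_trans (ler_normcB _ _))// normc_circ.
have c'_le t : normc (circ' r t) <= normc (0 +i* (2 * pi) : C) * r.
  by rewrite /circ' normcM normc_circ.
have dFs (s t : R) : 0 <= s <= 1 -> cderivable F (z + s%:C * (z0 + circ r t - z)).
  move=> /andP[s0 s1]; apply: dF.
  have -> : z + s%:C * (z0 + circ r t - z) - z0 = (1 - s)%:C * (z - z0) + s%:C * circ r t.
    by rewrite rmorphB /=; ring.
  rewrite (le_lt_trans (ler_normcD _ _))// [normc (_ * (z - z0))]normcM
    [normc (_ * circ _ _)]normcM normc_circ// !normc_real !ger0_norm ?subr_ge0//.
  rewrite (@le_lt_trans _ _ r)//; last by rewrite /r; have := rho0; lra.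
  rewrite [leRHS](_ : r = (1 - s) * r + s * r); last by ring.
  by rewrite lerD// ler_wpM2l ?subr_ge0// ltW.
have := cauchy_star_formula (ccont_circ_sub z0 r z) (ccont_circ' r) pc cl m0
  (fun t => dist_circ z0 r0 z t) c_le c'_le dFs.
rewrite /winding /cauchy_type => <-; congr cint; apply/funext => t.
by rewrite [z + _]addrC subrK mulrA.
Qed.

(* At the centre the integrand is constant, equal to 2 pi i; the first-order
   term of the expansion is too small to compensate for it when
   |z - z0| < r / 3. *)
Let winding_neq0 z : normc (z - z0) < r / 3 -> winding z != 0.
Proof.
move=> z3.
have zr : normc (z - z0) < r by have := r0; lra.
have pi20 : 0 < 2 * pi :> R by rewrite mulr_gt0// pi_gt0.
rewrite /winding cauchy_type_expand//; last exact: ccont_circ'.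
have quot : (fun t => circ' r t / circ r t) = (fun=> 0 +i* (2 * pi)).
  by apply/funext => t; rewrite /circ' mulfK// circ_neq0.
have -> : cauchy_type z0 r (circ' r) z0 = 0 +i* (2 * pi).
  rewrite /cauchy_type -[RHS](_ : cint (fun t => circ' r t / circ r t) = _).
    by congr cint; apply/funext => t; rewrite [z0 + _]addrC addrK.
  rewrite quot.
  have p : is_primitive (fun t => (0 +i* (2 * pi)) * t%:C) (fun=> (0 +i* (2 * pi)) * (1 : C)).
    apply: (@is_primitiveZ _ _ (fun t : R => t%:C) (fun=> 1)).
    by move=> t _; split; [exact: is_derive_id|exact: is_derive_cst].
  rewrite mulr1 in p.
  by rewrite (cintE p) mulr1 mulr0 subr0.
rewrite quot.
apply/eqP => /eqP; rewrite addr_eq0 => /eqP /(congr1 (@normc R)).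
rewrite normcNE normcM.
have -> : normc (0 +i* (2 * pi) : C) = 2 * pi.
  by rewrite /normc expr0n add0r sqrtr_sqr ger0_norm// ltW.
have := @cauchy_type_bound R z0 r r0 (fun=> 0 +i* (2 * pi)) z (2 * pi) zr (ccont_cst _) _.
move=> B; have {B} := B _.
have H : forall t : R, 0 <= t <= 1 -> normc (0 +i* (2 * pi) : C) <= 2 * pi.
  by move=> t _; rewrite /normc expr0n add0r sqrtr_sqr ger0_norm// ltW.
move=> /(_ H) B eB.
have : 2 * pi < 2 * pi :> R; last by rewrite ltxx.
rewrite {1}eB (le_lt_trans (ler_wpM2l (normc_ge0 _) B))//.
set d := normc (z - z0).
have d0 : 0 <= d by exact: normc_ge0.
have rd0 : 0 < r - d by rewrite subr_gt0.
have -> : d * (2 * (2 * pi / (r - d))) = (2 * pi) * (2 * d / (r - d)).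
  by field; rewrite gt_eqF.
rewrite -[ltRHS]mulr1 ltr_pM2l// ltr_pdivrMr// mul1r.
by move: z3; rewrite -/d; lra.
Qed.

(** Expand the Cauchy integral of F repeatedly in powers of z - z_0.  If all
    coefficients vanish then F is O((|z - z_0| / r)^n) for every n, hence zero;
    otherwise the first nonzero coefficient gives the exponent k. *)
Lemma local_structure : exists2 e : R, 0 < e <= rho &
  (forall w, normc (w - z0) < e -> F w = 0) \/
  exists k G, G z0 != 0 /\ forall w, normc (w - z0) < e ->
    cderivable G w /\ F w = (w - z0) ^+ k * G w.
Proof.
pose e := r / 4; have e0 : 0 < e by rewrite divr_gt0.
have er : e < r by rewrite /e; have := r0; lra.
have e3 : e < r / 3 by rewrite /e; have := r0; lra.
have er2 : e <= rho by rewrite /e /r; have := rho0; lra.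
exists e; first by rewrite e0.
pose phi n (t : R) := F (z0 + circ r t) * circ' r t / circ r t ^+ n.
have phiS n : (fun t => phi n t / circ r t) = phi n.+1.
  apply/funext => t; rewrite /phi exprSr; move: (circ r t) (circ' r t) => x y.
  by rewrite invfM !mulrA.
have cphi n : ccont (phi n).
  elim: n => [|n ih].
    rewrite (_ : phi 0 = (fun t => F (z0 + circ r t) * circ' r t)); last first.
      by apply/funext => t; rewrite /phi expr0 divr1.
    apply: ccontM; last exact: ccont_circ'.
    apply: ccont_comp; first by apply: ccontD; [exact: ccont_cst|exact: ccont_circ].
    move=> t; apply: dF; rewrite addrC addKr normc_circ//.
    by rewrite /r; have := rho0; lra.
  rewrite -phiS; apply: ccontM => //; apply: ccontV; last exact: ccont_circ.
  by move=> t; exact: circ_neq0.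
(* The Taylor coefficients of the Cauchy integral of F at z0. *)
pose a n := cauchy_type z0 r (phi n) z0.
have Iphi0 z : normc (z - z0) < e -> F z * winding z = cauchy_type z0 r (phi 0) z.
  move=> ze; rewrite -cauchy_formula ?(lt_trans ze)//.
  by congr cauchy_type; apply/funext => t; rewrite /phi expr0 divr1.
have expand k : (forall n, (n < k)%N -> a n = 0) -> forall z, normc (z - z0) < e ->
    F z * winding z = (z - z0) ^+ k * cauchy_type z0 r (phi k) z.
  elim: k => [|k ih] ak z ze; first by rewrite expr0 mul1r Iphi0.
  rewrite ih//; last by move=> n nk; apply: ak; rewrite ltnS ltnW.
  rewrite [cauchy_type _ _ _ z]cauchy_type_expand ?(lt_trans ze)// phiS -/(a k) ak//.
  by rewrite add0r mulrA exprSr.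
have w0 z : normc (z - z0) < e -> winding z != 0.
  by move=> ze; apply: winding_neq0; exact: lt_trans ze e3.
have [all0|] := pselect (forall n, a n = 0).
  left => z ze.
  have zr : normc (z - z0) < r by exact: lt_trans ze er.
  have [M M0 MP] := ccont_bounded (cphi 0).
  have phiM n t : 0 <= t <= 1 -> normc (phi n t) <= M / r ^+ n.
    move=> t01; have := MP t t01; rewrite /phi expr0 divr1 => H.
    by rewrite normcM normcV normcX normc_circ// ler_wpM2r// invr_ge0 exprn_ge0// ltW.
  pose K := 2 * (M / (r - normc (z - z0))).
  have K0 : 0 < K by rewrite mulr_gt0// divr_gt0// subr_gt0.
  have B n : normc (F z * winding z) <= K / 2 ^+ n.
    rewrite (@expand n)// normcM normcX.
    rewrite (@le_trans _ _ ((r / 2) ^+ n * (K / r ^+ n)))//; last first.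
      have rn : r ^+ n != 0 by rewrite expf_neq0// gt_eqF.
      by rewrite expr_div_n; move: (r ^+ n) rn (2 ^+ n) => x x0 y; rewrite mulrC mulrA divfK.
    apply: ler_pM; [by rewrite exprn_ge0 ?normc_ge0|exact: normc_ge0| |].
      have r20 : 0 <= r / 2 by rewrite divr_ge0// ltW.
      rewrite lerXn2r ?nnegrE ?normc_ge0//.
      by apply: (le_trans (ltW ze)); rewrite /e; have := r0; lra.
    apply: le_trans (cauchy_type_bound r0 zr (cphi n) (phiM n)) _.
    by rewrite /K -!mulrA ler_pM2l// ler_pM2l// mulrC.
  apply/eqP; move: (w0 _ ze); apply: contraNT => Fz0.
  have x0 : 0 < normc (F z) * normc (winding z) / K.
    by rewrite divr_gt0// mulr_gt0 ?normc_gt0 ?w0.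
  have [N HN] : exists N, 2 ^- N < normc (F z) * normc (winding z) / K.
    move: x0; set x := _ / K => x0.
    exists (Num.bound x^-1); rewrite invf_plt ?posrE ?exprn_gt0//.
    apply: (lt_le_trans (archi_boundP _)); first by rewrite invr_ge0 ltW.
    by rewrite -natrX ler_nat ltnW// ltn_expl.
  have := B N; rewrite normcM leNgt; case/negP.
  by move: HN; rewrite ltr_pdivlMr// mulrC.
move=> /existsNP/cid[n0 an0].
have ex : exists n, a n != 0 by exists n0; apply/eqP.
have [k ak kmin] := ex_minnP ex.
right; exists k, (fun z => cauchy_type z0 r (phi k) z / winding z).
have z00 : normc (z0 - z0) < e by rewrite subrr normc0.
split; first by rewrite mulf_neq0// invr_eq0 w0.
move=> w we; split.
  apply: cderivableM; first by apply: cderivable_cauchy_type => //; exact: lt_trans we er.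
  apply: cderivableV; first exact: w0.
  by apply: cderivable_cauchy_type => //; [exact: lt_trans we er|exact: ccont_circ'].
rewrite mulrA -expand ?mulfK ?w0// => n nk.
by apply/eqP; apply: contraLR nk => an; rewrite -leqNgt kmin.
Qed.

End LocalStructure.

(** * Germs, square roots and orders of zeros *)

Section Germs.
Local Open Scope complex_scope.
Variable R : realType.
Local Notation C := R[i].
Implicit Types (F G S T : C -> C) (z w : C).

Lemma cderivable_comp F G z : cderivable F z -> cderivable G (F z) ->
  cderivable (fun w => G (F w)) z.
Proof.
move=> /derivable1_diffP dF /derivable1_diffP dG; apply/derivable1_diffP.
exact: (differentiable_comp dF dG).
Qed.

Lemma cderivable_conj (T : C -> C) z : cderivable T z^* ->
  cderivable (fun w => (T w^*)^*) z.
Proof.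
move=> /cderivableP[l Tl]; apply/cderivableP; exists l^* => e e0.
have [d d0 dP] := Tl e e0; exists d => // w wz.
have := dP w^*; rewrite -rmorphB /= normc_conj => /(_ wz).
have -> : (T w^*)^* - (T z^*)^* - l^* * (w - z) = (T w^* - T z^* - l * (w - z)^*)^*.
  by rewrite -[in LHS](conjcK (w - z)) -rmorphM -!rmorphB.
by rewrite normc_conj.
Qed.

(** Neighbourhoods phrased with the real modulus, so that radii obey real
    arithmetic rather than the partial order of R[i]. *)
Definition locally z (P : C -> Prop) :=
  exists2 e : R, 0 < e & forall w, normc (w - z) < e -> P w.

Lemma locallyS z (P Q : C -> Prop) : (forall w, P w -> Q w) -> locally z P -> locally z Q.
Proof. by move=> PQ [e e0 eP]; exists e => // w /eP /PQ. Qed.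

Lemma locallyI z (P Q : C -> Prop) : locally z P -> locally z Q ->
  locally z (fun w => P w /\ Q w).
Proof.
move=> [e e0 eP] [d d0 dP]; exists (Num.min e d) => [|w].
  by rewrite lt_min e0.
by rewrite lt_min => /andP[/eP ? /dP ?].
Qed.

Lemma locally_at z (P : C -> Prop) : locally z P -> P z.
Proof. by move=> [e e0]; apply; rewrite subrr normc0. Qed.

Lemma locally_locally z (P : C -> Prop) : locally z P -> locally z (fun w => locally w P).
Proof.
move=> [e e0 eP]; exists e => // w we.
exists (e - normc (w - z)); first by rewrite subr_gt0.
move=> u uw; apply: eP; rewrite (le_lt_trans (ler_normc_dist _ w _))//.
by rewrite -ltrBrDr.
Qed.

Lemma locally_neq0 F z : cderivable F z -> F z != 0 -> locally z (fun w => F w != 0).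
Proof.
move=> dF Fz; have n0 : 0 < normc (F z) by rewrite normc_gt0.
have [d d0 dP] := cderivable_continuous dF (divr_gt0 n0 (ltr0Sn _ 1)).
exists d => // w /dP H; rewrite -normc_gt0.
have := lerB_normc (F z) (F w - F z + F w); have := ler_normcD (F w) (F z - F w).
rewrite [F w + _]addrC subrK [normc (F z - F w)]normc_sub.
by move: H; set a := normc (_ - _); lra.
Qed.

Lemma local_order F z : locally z (cderivable F) ->
  locally z (fun w => F w = 0) \/
  exists k G, [/\ G z != 0, locally z (cderivable G) &
    locally z (fun w => F w = (w - z) ^+ k * G w)].
Proof.
move=> [e e0 dF]; have [d /andP[d0 de]] := local_structure e0 dF.
move=> [Fz|[k [G [Gz H]]]]; first by left; exists d.
by right; exists k, G; split=> //; exists d => // w /H[].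
Qed.

Lemma locally_zero_or F z : locally z (cderivable F) ->
  locally z (fun w => F w = 0) \/ locally z (fun w => w != z -> F w != 0).
Proof.
move=> /local_order[|[k [G [Gz dG FG]]]]; first by left.
right; apply: locallyS (locallyI FG (locally_neq0 (locally_at dG) Gz)) => w [-> Gw] wz.
by rewrite mulf_neq0// expf_neq0// subr_eq0.
Qed.

Lemma locally_punctured z (P : C -> Prop) : locally z P -> exists2 w, w != z & P w.
Proof.
move=> [e e0 eP]; exists (z + (e / 2)%:C).
  rewrite -subr_eq0 addrC addKr eq_complex /= eqxx andbT.
  by rewrite gt_eqF// divr_gt0.
apply: eP; rewrite addrC addKr normc_real ger0_norm ?divr_ge0 ?(ltW e0)//.
by have := e0; lra.
Qed.

Lemma germ_mul_eq0 F G z : locally z (cderivable F) -> locally z (cderivable G) ->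
  locally z (fun w => F w * G w = 0) ->
  locally z (fun w => F w = 0) \/ locally z (fun w => G w = 0).
Proof.
move=> /locally_zero_or[|nF]; first by left.
move=> /locally_zero_or[|nG FG]; first by right.
have [w wz [[/(_ wz) Fw /(_ wz) Gw] /eqP]] :=
  locally_punctured (locallyI (locallyI nF nG) FG).
by rewrite mulf_eq0 (negbTE Fw) (negbTE Gw).
Qed.

(** Germs of holomorphic functions form an integral domain, so a germ has at
    most two square roots. *)
Lemma sqr_germs F G z : locally z (cderivable F) -> locally z (cderivable G) ->
  locally z (fun w => F w ^+ 2 = G w ^+ 2) ->
  locally z (fun w => F w = G w) \/ locally z (fun w => F w = - G w).
Proof.
move=> dF dG FG.
have [|||H|H] := @germ_mul_eq0 (fun w => F w - G w) (fun w => F w + G w) z.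
- by apply: locallyS (locallyI dF dG) => w []; exact: cderivableB.
- by apply: locallyS (locallyI dF dG) => w []; exact: cderivableD.
- by apply: locallyS FG => w /eqP; rewrite -subr_eq0 subr_sqr => /eqP.
- by left; apply: locallyS H => w /eqP; rewrite subr_eq0 => /eqP.
- by right; apply: locallyS H => w /eqP; rewrite addr_eq0 => /eqP.
Qed.

Lemma Re_sqrtc_ge0 z : 0 <= complex.Re (sqrtc z).
Proof. by case: z => a b; rewrite /sqrtc /= sqrtr_ge0. Qed.

Lemma Re_sqrtc_gt0 z : 0 < complex.Re z -> 0 < complex.Re (sqrtc z).
Proof.
move=> z0; rewrite lt_def Re_sqrtc_ge0 andbT; apply/eqP => s0.
move: z0; rewrite -{1}(sqr_sqrtc z) expr2 ReM s0 mul0r sub0r oppr_gt0.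
by rewrite ltNge -expr2 sqr_ge0.
Qed.

(** On the right half plane the principal root t of w satisfies
    w - z = (t - s)(t + s) with s the root of z and |t + s| >= Re s > 0, which
    bounds t - s and then the second-order remainder. *)
Lemma cderivable_sqrtc z : 0 < complex.Re z -> cderivable (@sqrtc R) z.
Proof.
move=> z0; set s := sqrtc z.
have s0 : 0 < complex.Re s by exact: Re_sqrtc_gt0.
have sn0 : s != 0 by apply: contraTneq s0 => ->; rewrite /= ltxx.
set m := complex.Re s in s0.
have sm : m <= normc s by rewrite (le_trans _ (Re_le_normc s))// ler_norm.
apply/cderivableP; exists (2 * s)^-1 => e e0.
exists (e * (2 * m ^+ 3)); first by rewrite mulr_gt0// mulr_gt0// exprn_gt0.
move=> w wd; set t := sqrtc w.
have tsm : m <= normc (t + s).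
  rewrite (le_trans _ (Re_le_normc _))// (le_trans _ (ler_norm _))// ReD.
  by rewrite lerDr Re_sqrtc_ge0.
have ts0 : t + s != 0 by rewrite -normc_gt0 (lt_le_trans s0).
have E : w - z = (t - s) * (t + s) by rewrite -subr_sqr !sqr_sqrtc.
have -> : t - s - (2 * s)^-1 * (w - z) = - (w - z) ^+ 2 / (2 * s * (t + s) ^+ 2).
  by rewrite E; field; rewrite ?sn0 ?ts0.
have n2 : normc (2 : C) = 2 by rewrite -[2 : C](rmorph_nat (real_complex R) 2) normc_real normr_nat.
rewrite normcM normcNE normcX normcV normcM [normc (2 * s)]normcM normcX n2.
set N := normc (w - z); have N0 : 0 <= N by exact: normc_ge0.
have P0 : 0 < 2 * normc s * normc (t + s) ^+ 2.
  by rewrite mulr_gt0 ?mulr_gt0 ?exprn_gt0 ?normc_gt0.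
rewrite ler_pdivrMr// expr2 [leRHS]mulrAC ler_wpM2r//.
rewrite (le_trans (ltW wd))// ler_wpM2l ?(ltW e0)// -mulrA ler_pM2l//.
by rewrite exprS ler_pM ?exprn_ge0 ?(ltW s0)// lerXn2r ?nnegrE ?normc_ge0 ?(ltW s0).
Qed.

(** After dividing by an even power of w - z the function is nonzero at z, and
    near a nonzero value the principal root, rescaled, is differentiable. *)
Lemma local_sqrt S z : locally z (cderivable S) ->
  (forall k G, G z != 0 -> locally z (cderivable G) ->
     locally z (fun w => S w = (w - z) ^+ k * G w) -> ~~ odd k) ->
  exists T, locally z (fun w => cderivable T w /\ T w ^+ 2 = S w).
Proof.
move=> dS even; have [S0|[k [G [Gz dG SG]]]] := local_order dS.
  exists (fun=> 0); apply: locallyS S0 => w ->; split; first exact: cderivable_cst.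
  by rewrite expr0n.
have /even_halfK kE := even _ _ Gz dG SG.
exists (fun w => (w - z) ^+ k./2 * (sqrtc (G z) * sqrtc (G w / G z))).
have dGz : locally z (cderivable (fun w => G w / G z)).
  apply: locallyS dG => w dw.
  by apply: (@cderivableM R G (fun=> (G z)^-1) w dw); exact: cderivable_cst.
have Re0 : locally z (fun w => 0 < complex.Re (G w / G z)).
  have [d d0 dP] := cderivable_continuous (locally_at dGz) (divr_gt0 ltr01 (ltr0Sn _ 1)).
  exists d => // w /dP; rewrite divff// => H.
  have := le_trans (Re_le_normc _) H; rewrite ReD ReN ler_norml => /andP[+ _].
  by rewrite [complex.Re 1]/=; lra.
apply: locallyS (locallyI (locallyI dGz Re0) SG) => w [[dw rw] ->]; split.
  apply: (@cderivableM R (fun w => (w - z) ^+ k./2)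
      (fun w => sqrtc (G z) * sqrtc (G w / G z)) w).
    apply: (@cderivableX R (fun w => w - z)).
    by apply: (@cderivableB R id (fun=> z)); [exact: cderivable_id|exact: cderivable_cst].
  apply: (@cderivableM R (fun=> sqrtc (G z)) (fun w => sqrtc (G w / G z)) w).
    exact: cderivable_cst.
  exact: (@cderivable_comp (fun w => G w / G z) (@sqrtc R) w dw (cderivable_sqrtc rw)).
rewrite !exprMn !sqr_sqrtc -exprM muln2 kE; congr (_ * _).
by rewrite mulrCA divff// mulr1.
Qed.

End Germs.

Section Order.
Local Open Scope complex_scope.
Variable R : realType.
Local Notation C := R[i].
Implicit Types (F G : C -> C) (z w : C).

(** The zeros of the difference accumulate at z, so its germ there is zero. *)
Lemma punctured_eq F G z : locally z (cderivable F) -> locally z (cderivable G) ->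
  locally z (fun w => w != z -> F w = G w) -> F z = G z.
Proof.
move=> dF dG FG.
have [] := @locally_zero_or R (fun w => F w - G w) z.
- by apply: locallyS (locallyI dF dG) => w []; exact: cderivableB.
- by move=> /locally_at /eqP; rewrite subr_eq0 => /eqP.
move=> h; have [w wz [/(_ wz) + /(_ wz) e]] := locally_punctured (locallyI h FG).
by rewrite e subrr eqxx.
Qed.

Definition has_order F z n := exists G, [/\ G z != 0, locally z (cderivable G) &
  locally z (fun w => F w = (w - z) ^+ n * G w)].

Lemma cderivable_pow z n w : cderivable (fun w => (w - z) ^+ n) w.
Proof.
apply: (@cderivableX R (fun w => w - z)).
by apply: (@cderivableB R id (fun=> z)); [exact: cderivable_id|exact: cderivable_cst].
Qed.

Let order_le F z m n : has_order F z m -> has_order F z n -> (n <= m)%N.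
Proof.
move=> [G [Gz dG FG]] [G' [Gz' dG' FG']]; rewrite leqNgt; apply/negP => mn.
have dm : (0 < n - m)%N by rewrite subn_gt0.
suff : G z = (z - z) ^+ (n - m) * G' z.
  by rewrite subrr expr0n gtn_eqF// mul0r => e; rewrite e eqxx in Gz.
apply: (@punctured_eq G (fun w => (w - z) ^+ (n - m) * G' w) z dG).
  apply: locallyS dG' => w dw.
  have dp := @cderivable_pow z (n - m)%N w.
  exact: (@cderivableM R (fun w => (w - z) ^+ (n - m)) G' w dp dw).
apply: locallyS (locallyI FG FG') => w [-> e] wz.
have w0 : (w - z) ^+ m != 0 by rewrite expf_neq0// subr_eq0.
by apply: (mulfI w0); rewrite e mulrA -exprD subnKC// ltnW.
Qed.

Lemma order_uniq F z m n : has_order F z m -> has_order F z n -> m = n.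
Proof. by move=> h1 h2; apply/eqP; rewrite eqn_leq !(order_le h1 h2, order_le h2 h1). Qed.

Lemma orderM F G z m n : has_order F z m -> has_order G z n ->
  has_order (fun w => F w * G w) z (m + n).
Proof.
move=> [F' [Fz dF FF]] [G' [Gz dG GG]]; exists (fun w => F' w * G' w); split.
- by rewrite mulf_neq0.
- by apply: locallyS (locallyI dF dG) => w []; exact: cderivableM.
- by apply: locallyS (locallyI FF GG) => w [-> ->]; rewrite exprD mulrACA.
Qed.

Lemma order_not_zero F z n : has_order F z n -> ~ locally z (fun w => F w = 0).
Proof.
move=> [G [Gz dG FG]] F0.
have nG := locally_neq0 (locally_at dG) Gz.
have [w wz [[Gw e] F0w]] := locally_punctured (locallyI (locallyI nG FG) F0).
by move/eqP: e; rewrite F0w eq_sym mulf_eq0 (negbTE Gw) orbF expf_eq0 subr_eq0 (negbTE wz) andbF.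
Qed.

Lemma order_factor F G z m n : locally z (cderivable G) -> has_order F z m ->
  has_order (fun w => F w * G w) z n -> exists2 k, has_order G z k & n = (m + k)%N.
Proof.
move=> dG Fm FGn; have [G0|[k Gk]] := local_order dG.
  case: (order_not_zero FGn); apply: locallyS G0 => w ->; exact: mulr0.
exists k => //; apply: order_uniq FGn _; exact: orderM.
Qed.

Lemma order_ext F G z n : locally z (fun w => F w = G w) -> has_order F z n -> has_order G z n.
Proof.
move=> FG [F' [Fz dF FF]]; exists F'; split => //.
by apply: locallyS (locallyI FG FF) => w [->].
Qed.

(** An odd power of w - x changes sign at x along the real line, so the cofactor
    G would have to be both nonnegative and nonpositive in the limit. *)
Lemma nonneg_order_even F (x : R) n : locally x%:C (fun w => complex.Im w = 0 -> 0 <= F w) ->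
  has_order F x%:C n -> ~~ odd n.
Proof.
move=> F0 [G [Gx dG FG]]; apply/negP => no.
have sub (u : R) : (x + u)%:C - x%:C = u%:C.
  by rewrite rmorphD /= addrAC subrr add0r.
have sgnG (s : bool) : exists2 d : R, 0 < d & forall t : R, 0 < t < d ->
    0 <= (-1) ^+ s * G (x + (-1) ^+ s * t)%:C.
  have [d d0 dP] := locallyI F0 FG; exists d => // t /andP[t0 td].
  have [] := dP (x + (-1) ^+ s * t)%:C.
    rewrite sub normc_real normrM normrX normrN1 expr1n mul1r.
    by rewrite gtr0_norm.
  move=> /(_ erefl) + e; rewrite e sub.
  have tn : 0 < (t ^+ n)%:C :> C by rewrite ltcR exprn_gt0.
  suff -> : ((-1) ^+ s * t)%:C ^+ n = (t ^+ n)%:C * (-1) ^+ s :> C by rewrite -mulrA pmulr_rge0.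
  have -> : ((-1) ^+ s * t)%:C = (-1) ^+ s * t%:C :> C.
    by case: (s); rewrite ?expr1 ?expr0 ?mul1r ?mulN1r ?rmorphN.
  rewrite exprMn mulrC -rmorphXn -exprM; congr (_ * _).
  by case: (s) => /=; rewrite ?mul0n ?expr0 ?mul1n -?(signr_odd _ n) ?no.
have limG (s : bool) : complex.Im (G x%:C) = 0 /\ 0 <= (-1) ^+ s * complex.Re (G x%:C).
  have near_ (e : R) : 0 < e -> exists w, [/\ normc (G w - G x%:C) <= e & 0 <= (-1) ^+ s * G w].
    move=> e0; have [d d0 dP] := cderivable_continuous (locally_at dG) e0.
    have [d' d'0 d'P] := sgnG s.
    pose t := Num.min d d' / 2.
    have m0 : 0 < Num.min d d' by rewrite lt_min d0.
    have t0 : 0 < t by rewrite divr_gt0.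
    have [td td'] : t < d /\ t < d'.
      have tm : t < Num.min d d' by rewrite /t; lra.
      by move: tm; rewrite lt_min => /andP[].
    exists (x + (-1) ^+ s * t)%:C; split; last by apply: d'P; rewrite t0.
    apply: dP; rewrite sub normc_real normrM normrX normrN1 expr1n mul1r.
    by rewrite gtr0_norm.
  have imre (w : C) : 0 <= (-1) ^+ s * w -> complex.Im w = 0 /\ 0 <= (-1) ^+ s * complex.Re w.
    case: w => a b; rewrite lecE; case: s {near_}; rewrite ?expr1 ?expr0 ?mul1r ?mulN1r /=.
      by rewrite oppr_eq0 => /andP[/eqP].
    by move=> /andP[/eqP].
  split.
    apply/eqP; rewrite -normr_eq0 eq_le normr_ge0 andbT.
    apply/ler_addgt0Pr => e e0; rewrite add0r.
    have [w [we /imre[w0 _]]] := near_ e e0.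
    have := le_trans (Im_le_normc _) we.
    by rewrite ImD ImN w0 sub0r normrN.
  rewrite leNgt; apply/negP => h.
  have e0 : 0 < - ((-1) ^+ s * complex.Re (G x%:C)) / 2 by rewrite divr_gt0// oppr_gt0.
  have [w [we /imre[_ w0]]] := near_ _ e0.
  have := le_trans (Re_le_normc _) we; rewrite ReD ReN.
  move: w0 h {e0 we}; case: s {near_ imre}; rewrite ?expr1 ?expr0 ?mul1r ?mulN1r ler_norml.
    by move=> ? ? /andP[]; lra.
  by move=> ? ? /andP[]; lra.
have [i0 r1] := limG true; have [_ r2] := limG false.
case/eqP: Gx; move: i0 r1 r2; case: (G _) => a b /= -> ; rewrite expr1 expr0 mul1r mulN1r.
by move=> r1 r2; congr (_ +i* _); lra.
Qed.

(** Removable singularities: the quotient F / (w - z) extends over a zero z of F,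
    because the local factorisation of F at z contains at least one factor
    w - z. *)
Lemma holo_divide (D : set C) F z : (forall w, D w -> locally w D) ->
  (forall w, D w -> cderivable F w) -> D z -> F z = 0 ->
  exists2 G, (forall w, D w -> cderivable G w) & forall w, D w -> F w = (w - z) * G w.
Proof.
move=> Dopen dF Dz Fz.
have [g dg gP] : exists2 g, locally z (cderivable g) & locally z (fun w => F w = (w - z) * g w).
  have [F0|[k [G [Gz dG FG]]]] := local_order (locallyS dF (Dopen z Dz)).
    exists (fun=> 0); last by apply: locallyS F0 => w ->; rewrite mulr0.
    by exists 1 => // w _; exact: cderivable_cst.
  have k0 : (0 < k)%N.
    rewrite lt0n; apply/negP => /eqP k0; move: (locally_at FG).
    by rewrite k0 expr0 mul1r Fz => /eqP; rewrite eq_sym (negbTE Gz).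
  exists (fun w => (w - z) ^+ k.-1 * G w).
    apply: locallyS dG => w dw.
    have dp := @cderivable_pow z k.-1 w.
    exact: (@cderivableM R (fun w => (w - z) ^+ k.-1) G w dp dw).
  by apply: locallyS FG => w ->; rewrite mulrA -exprS prednK.
exists (fun w => if w == z then g z else F w / (w - z)); last first.
  move=> w Dw; case: eqP => [->|/eqP wz]; first by rewrite Fz subrr mul0r.
  by rewrite mulrC divfK// subr_eq0.
move=> w Dw; have [->|wz] := eqVneq w z.
  have [e e0 eP] := locallyI dg gP.
  apply: (@cderivable_near R g _ z e e0); last by have [] := eP z; rewrite ?subrr ?normc0.
  move=> u ue; case: eqP => [->//|/eqP uz]; have [_ ->] := eP u ue.
  by rewrite mulrC mulKf// subr_eq0.
have d0 : 0 < normc (w - z) by rewrite normc_gt0 subr_eq0.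
apply: (@cderivable_near R (fun u => F u / (u - z)) _ w _ d0).
  move=> u uw; rewrite ifF//; apply/negbTE; apply: contraTneq uw => ->.
  by rewrite normc_sub ltxx.
apply: (@cderivableM R F (fun u => (u - z)^-1)); first exact: dF.
apply: (@cderivableV R (fun u => u - z)); first by rewrite subr_eq0.
by apply: (@cderivableB R id (fun=> z)); [exact: cderivable_id|exact: cderivable_cst].
Qed.

End Order.

(** * Monodromy of a double covering *)

Section Torsor.
Local Open Scope complex_scope.
Variable R : realType.

(** Connectedness of a segment, obtained by bisection. *)
Lemma locally_constant_segment (u : R -> bool) (a b : R) : a <= b ->
  (forall x, a <= x <= b -> exists2 d, 0 < d & forall y, a <= y <= b ->
     `|y - x| < d -> u y = u x) ->
  forall x, a <= x <= b -> u x = u a.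
Proof.
rewrite le_eqVlt => /predU1P[<- _ x|ab loc].
  by rewrite -eq_le => /eqP ->.
have k0 : 0 < b - a by rewrite subr_gt0.
pose Pr (c _ l : R) := forall x, c <= x <= c + (b - a) * l -> u x = u c.
suff : Pr a 0 1 by rewrite /Pr mulr1 addrC subrK.
apply: (@square_subdivision R Pr a 0 (b - a) 1) => //.
  move=> c c2 l l0; rewrite /Pr => h1 h2 _ _ x /andP[cx xc].
  have kl : 0 < (b - a) * (l / 2) by rewrite mulr_gt0// divr_gt0.
  have E : (b - a) * l = (b - a) * (l / 2) + (b - a) * (l / 2) by rewrite -mulrDr -splitr.
  have [xm|mx] := leP x (c + (b - a) * (l / 2)).
    by apply: h1; rewrite cx.
  rewrite h2; last by rewrite (ltW mx)/= -addrA -E.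
  by apply: h1; apply/andP; split; lra.
move=> x y1; rewrite addrC subrK => xab _.
have [d d0 dP] := loc x xab; exists (d / (b - a)); first by rewrite divr_gt0.
move=> c c2 l /andP[l0 ld] ac cb _ _ /andP[cx xc] _ y /andP[cy yc].
move: ld; rewrite ltr_pdivlMr// mulrC => ld.
rewrite !dP//; rewrite ?ltr_norml ?(le_trans ac)//=; try (apply/andP; split; lra).
  lra.
by lra.
Qed.

Variables (T : Type) (E : T -> T -> bool).
Implicit Types (h : R -> R -> T) (tau : R -> R -> bool).

(** [E p q] is the sign that compares the reference points of a double covering
    over two nearby points [p] and [q].  A good [tau] describes a continuous
    section of the pulled back covering over a rectangle: along [h], its sign
    changes exactly as the reference points do. *)
Definition rect_good h tau (a b c d : R) := forall x y, a <= x <= b -> c <= y <= d ->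
  exists2 e, 0 < e & forall x' y', a <= x' <= b -> c <= y' <= d ->
    `|x' - x| < e -> `|y' - y| < e -> tau x' y' = tau x y (+) E (h x y) (h x' y').

(** On the common edge two sections differ by a constant sign, so one of them can
    be flipped to agree with the other. *)
Lemma rect_glue h t1 t2 a m b c d : a <= m -> m <= b -> c <= d ->
  rect_good h t1 a m c d -> rect_good h t2 m b c d -> exists t, rect_good h t a b c d.
Proof.
move=> am mb cd g1 g2.
have m1 : a <= m <= m by rewrite am lexx.
have m2 : m <= m <= b by rewrite mb lexx.
pose k := t1 m c (+) t2 m c.
have kE y : c <= y <= d -> t1 m y (+) t2 m y = k.
  apply: (@locally_constant_segment (fun y => t1 m y (+) t2 m y)) => // {}y yP.
  have [e1 e10 e1P] := g1 m y m1 yP; have [e2 e20 e2P] := g2 m y m2 yP.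
  exists (Num.min e1 e2) => [|y' y'P]; first by rewrite lt_min e10.
  rewrite lt_min => /andP[ye1 ye2].
  have m00 e : 0 < e -> `|m - m| < e by rewrite subrr normr0.
  rewrite (e1P m y' m1 y'P (m00 _ e10) ye1) (e2P m y' m2 y'P (m00 _ e20) ye2).
  by move: (E _ _) (t1 m y) (t2 m y) => [] [] [].
exists (fun x y => if x <= m then t1 x y else t2 x y (+) k) => x y /andP[ax xb] yP.
have [xm|mx|xm] := ltgtP x m.
- have [e e0 eP] := g1 x y (introT andP (conj ax (ltW xm))) yP.
  exists (Num.min e (m - x)) => [|x' y' /andP[ax' xb'] y'P].
    by rewrite lt_min e0 subr_gt0.
  rewrite !lt_min => /andP[x'e x'm] /andP[y'e _].
  have x'm' : x' <= m by move: x'm; rewrite ltr_norml => /andP[_]; lra.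
  by rewrite x'm' eP// ax'.
- have [e e0 eP] := g2 x y (introT andP (conj (ltW mx) xb)) yP.
  exists (Num.min e (x - m)) => [|x' y' /andP[ax' xb'] y'P].
    by rewrite lt_min e0 subr_gt0.
  rewrite !lt_min => /andP[x'e x'm] /andP[y'e _].
  have x'm' : m < x' by move: x'm; rewrite ltr_norml => /andP[]; lra.
  by rewrite leNgt x'm'/= eP ?xb' ?(ltW x'm')// addbAC.
- have [e1 e10 e1P] := g1 m y m1 yP; have [e2 e20 e2P] := g2 m y m2 yP.
  exists (Num.min e1 e2) => [|x' y' /andP[ax' xb'] y'P]; first by rewrite lt_min e10.
  rewrite !lt_min xm => /andP[x1 x2] /andP[y1 y2].
  have [x'm|mx'] := leP x' m; first by rewrite e1P// ax'.
  rewrite e2P ?xb' ?(ltW mx')// -(kE y yP).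
  by move: (E _ _) (t1 m y) (t2 m y) => [] [] [].
Qed.

Lemma rect_swap h t a b c d :
  rect_good h t a b c d -> rect_good (fun x y => h y x) (fun x y => t y x) c d a b.
Proof.
move=> g x y xP yP; have [e e0 eP] := g y x yP xP; exists e => // x' y' *.
exact: eP.
Qed.

(** Over a small square around (x, y) the comparison with the reference point at
    (x, y) is a section; bisection and gluing extend this to the unit square. *)
Lemma square_good h :
  (forall x y, 0 <= x <= 1 -> 0 <= y <= 1 -> exists2 d, 0 < d &
     forall x' y', 0 <= x' <= 1 -> 0 <= y' <= 1 -> `|x' - x| < d -> `|y' - y| < d ->
     exists2 e, 0 < e & forall x'' y'', 0 <= x'' <= 1 -> 0 <= y'' <= 1 ->
       `|x'' - x'| < e -> `|y'' - y'| < e ->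
       E (h x y) (h x'' y'') = E (h x y) (h x' y') (+) E (h x' y') (h x'' y'')) ->
  exists t, rect_good h t 0 1 0 1.
Proof.
move=> loc.
pose Pr (a c l : R) := exists t, rect_good h t a (a + l) c (c + l).
suff : Pr 0 0 1 by rewrite /Pr add0r.
apply: (@square_subdivision R Pr 0 0 1 1) => //.
  move=> a c l l0; rewrite /Pr !mul1r.
  have ll : l = l / 2 + l / 2 by rewrite -splitr.
  have l20 : 0 < l / 2 by rewrite divr_gt0.
  move=> [t1 g1] [t2 g2] [t3 g3] [t4 g4].
  have lla v : v + l / 2 + l / 2 = v + l by rewrite -addrA -ll.
  rewrite !lla in g2 g3 g4.
  have [|||s1 G1] := rect_glue _ _ _ g1 g2; try lra.
  have [|||s2 G2] := rect_glue _ _ _ g3 g4; try lra.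
  have [|||s G] := rect_glue _ _ _ (rect_swap G1) (rect_swap G2); try lra.
  by exists (fun x y => s y x); exact: rect_swap G.
move=> x y; rewrite add0r => xP yP; have [d d0 dP] := loc x y xP yP.
exists d => // a c l /andP[l0 ld]; rewrite !mul1r => a0 a1 c0 c1 ax cy.
have in01 (u v : R) : 0 <= u -> u + l <= 1 -> u <= v <= u + l -> 0 <= v <= 1.
  by move=> u0 u1 /andP[uv vu]; rewrite (le_trans u0 uv) (le_trans vu u1).
have near_ (u v w : R) : u <= v <= u + l -> u <= w <= u + l -> `|w - v| < d.
  by clear -ld => vP wP; rewrite ltr_norml; apply/andP; split; lra.
exists (fun x' y' => E (h x y) (h x' y')) => x' y' x'P y'P.
have [e e0 eP] := dP x' y' (in01 _ _ a0 a1 x'P) (in01 _ _ c0 c1 y'P)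
  (near_ _ _ _ ax x'P) (near_ _ _ _ cy y'P).
exists e => // x'' y'' x''P y''P xe ye.
exact: (eP x'' y'' (in01 _ _ a0 a1 x''P) (in01 _ _ c0 c1 y''P) xe ye).
Qed.

End Torsor.

Section PathContinuity.
Local Open Scope complex_scope.
Variables (R : realType) (T : topologicalType).
Implicit Types (gamma : R -> T) (A : set T).

Lemma segment_continuousP gamma : {within `[0, 1]%classic, continuous gamma} <->
  forall t, 0 <= t <= 1 -> forall U, nbhs (gamma t) U -> exists2 d : R, 0 < d &
    forall t', 0 <= t' <= 1 -> `|t' - t| < d -> U (gamma t').
Proof.
split.
  move=> /subspace_continuousP c t t01 U Ut.
  have /nbhs_ballP[d /= d0 dP] : nbhs t (fun t' => `[0, 1]%classic t' -> U (gamma t')).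
    by apply: (c t _ U Ut); rewrite /= in_itv.
  exists d => // t' t'01 t'd; apply: dP; last by rewrite /= in_itv.
  by rewrite /ball/= distrC.
move=> H; apply/subspace_continuousP => t; rewrite /= in_itv/= => t01 U Ut.
have [d d0 dP] := H t t01 U Ut; rewrite /nbhs/= /within/=.
apply/nbhs_ballP; exists d => //= t' t'd; rewrite in_itv/= => t'01.
by apply: dP => //; rewrite distrC.
Qed.

Lemma square_continuousP (h : R * R -> T) : {within @unit_square R, continuous h} ->
  forall x y, 0 <= x <= 1 -> 0 <= y <= 1 -> forall U, nbhs (h (x, y)) U ->
  exists2 d : R, 0 < d & forall x' y', 0 <= x' <= 1 -> 0 <= y' <= 1 ->
    `|x' - x| < d -> `|y' - y| < d -> U (h (x', y')).
Proof.
move=> /subspace_continuousP c x y x01 y01 U Ut.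
have sq (u v : R) : 0 <= u <= 1 -> 0 <= v <= 1 -> (@unit_square R) (u, v).
  by move=> u01 v01; split; rewrite /= in_itv.
have /nbhs_ballP[d /= d0 dP] : nbhs (x, y) (fun p => (@unit_square R) p -> U (h p)).
  by apply: (c (x, y) _ U Ut); exact: sq.
exists d => // x' y' x'01 y'01 x'd y'd; apply: dP; last exact: sq.
by split; rewrite /ball/= distrC.
Qed.

Definition path_concat gamma1 gamma2 (t : R) : T :=
  if t <= 2^-1 then gamma1 (2 * t) else gamma2 (2 * t - 1).

Lemma path_in_concat A gamma1 gamma2 : path_in A gamma1 -> path_in A gamma2 ->
  gamma1 1 = gamma2 0 -> path_in A (path_concat gamma1 gamma2).
Proof.
move=> [c1 A1] [c2 A2] g12; split; last first.
  move=> t; rewrite in_itv/= => /andP[t0 t1]; rewrite /path_concat.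
  by case: leP => th; [apply: A1|apply: A2]; rewrite in_itv/=; apply/andP; split; lra.
move/segment_continuousP: c1 => c1; move/segment_continuousP: c2 => c2.
apply/segment_continuousP => t /andP[t0 t1] U.
have [th|th|th] := ltgtP t (2^-1).
- rewrite /path_concat (ltW th) => Ut.
  have [|d d0 dP] := c1 (2 * t) _ U Ut; first by apply/andP; split; lra.
  exists (Num.min (d / 2) (2^-1 - t)) => [|t' /andP[t'0 t'1]].
    by rewrite lt_min divr_gt0//= subr_gt0.
  rewrite lt_min !ltr_norml => /andP[/andP[h1 h2] /andP[h3 h4]].
  rewrite ifT; last lra.
  by apply: dP; rewrite ?ltr_norml; apply/andP; split; lra.
- rewrite /path_concat leNgt th/= => Ut.
  have [|d d0 dP] := c2 (2 * t - 1) _ U Ut; first by apply/andP; split; lra.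
  exists (Num.min (d / 2) (t - 2^-1)) => [|t' /andP[t'0 t'1]].
    by rewrite lt_min divr_gt0//= subr_gt0.
  rewrite lt_min !ltr_norml => /andP[/andP[h1 h2] /andP[h3 h4]].
  rewrite ifF; last by apply/negbTE; rewrite -ltNge; lra.
  by apply: dP; rewrite ?ltr_norml; apply/andP; split; lra.
- rewrite /path_concat th lexx => Ut.
  have Ut1 : nbhs (gamma1 1) U by move: Ut; rewrite mulfV ?pnatr_eq0.
  have Ut2 : nbhs (gamma2 0) U by rewrite -g12.
  have [|d d0 dP] := c1 1 _ U Ut1; first by rewrite ler01 lexx.
  have [|e e0 eP] := c2 0 _ U Ut2; first by rewrite ler01 lexx.
  exists (Num.min (d / 2) (e / 2)) => [|t' /andP[t'0 t'1]].
    by rewrite lt_min !divr_gt0.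
  rewrite lt_min !ltr_norml => /andP[/andP[h1 h2] /andP[h3 h4]].
  case: leP => h.
    by apply: dP; rewrite ?ltr_norml; apply/andP; split; lra.
  by apply: eP; rewrite ?ltr_norml; apply/andP; split; lra.
Qed.

Lemma path_in_rev A gamma : path_in A gamma -> path_in A (fun t => gamma (1 - t)).
Proof.
move=> [c g]; split; last first.
  by move=> t; rewrite in_itv/= => ?; apply: g; rewrite in_itv/=; apply/andP; split; lra.
move/segment_continuousP: c => c; apply/segment_continuousP => t t01 U Ut.
have [|d d0 dP] := c (1 - t) _ U Ut; first by apply/andP; split; lra.
exists d => // t' t'01; rewrite ltr_norml => t'd; apply: dP; first by apply/andP; split; lra.
by rewrite ltr_norml; apply/andP; split; lra.
Qed.

End PathContinuity.

Section Monodromy.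
Local Open Scope complex_scope.
Variables (R : realType) (T : topologicalType) (A : set T) (E : T -> T -> bool).
Implicit Types (gamma : R -> T) (tau : R -> bool).
Hypothesis cocycle : forall p, A p -> \forall x \near p, A x ->
  \forall y \near x, A y -> E p y = E p x (+) E x y.

Let E_refl p : A p -> E p p = false.
Proof.
move=> Ap; have /(_ Ap) := nbhs_singleton (cocycle Ap).
by move=> /nbhs_singleton /(_ Ap); case: (E p p).
Qed.

Definition path_good gamma tau := forall t, 0 <= t <= 1 -> exists2 e : R, 0 < e &
  forall t', 0 <= t' <= 1 -> `|t' - t| < e -> tau t' = tau t (+) E (gamma t) (gamma t').

Lemma path_good_uniq gamma tau1 tau2 : path_good gamma tau1 -> path_good gamma tau2 ->
  tau1 0 (+) tau1 1 = tau2 0 (+) tau2 1.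
Proof.
move=> g1 g2.
have := @locally_constant_segment R (fun t => tau1 t (+) tau2 t) 0 1 ler01 _ 1.
rewrite ler01 lexx => H; have {H} := H _ isT.
move=> H; suff : tau1 1 (+) tau2 1 = tau1 0 (+) tau2 0.
  by move: (tau1 0) (tau1 1) (tau2 0) (tau2 1) => [] [] [] [].
apply: H => t t01; have [e1 e10 e1P] := g1 t t01; have [e2 e20 e2P] := g2 t t01.
exists (Num.min e1 e2) => [|t' t'01]; first by rewrite lt_min e10.
rewrite lt_min => /andP[h1 h2]; rewrite (e1P _ t'01 h1) (e2P _ t'01 h2).
by move: (E _ _) (tau1 t) (tau2 t) => [] [] [].
Qed.

Lemma square_lift (h : R * R -> T) : {within @unit_square R, continuous h} ->
  (forall u, unit_square u -> A (h u)) ->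
  exists t, rect_good E (fun x y => h (x, y)) t 0 1 0 1.
Proof.
move=> /square_continuousP ch hA.
have Ah (x y : R) : 0 <= x <= 1 -> 0 <= y <= 1 -> A (h (x, y)).
  by move=> x01 y01; apply: hA; split; rewrite /= in_itv.
apply: square_good => x y x01 y01.
have [d d0 dP] := ch x y x01 y01 _ (cocycle (Ah x y x01 y01)).
exists d => // x' y' x'01 y'01 x'd y'd.
have := dP x' y' x'01 y'01 x'd y'd (Ah _ _ x'01 y'01).
move=> /(ch x' y' x'01 y'01)[e e0 eP]; exists e => // x'' y'' x''01 y''01 x'e y'e.
exact: eP x''01 y''01 x'e y'e (Ah _ _ x''01 y''01).
Qed.

Lemma path_lift gamma : path_in A gamma -> exists tau, path_good gamma tau.
Proof.
move=> [/segment_continuousP c gA].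
have [||t g] := @square_lift (fun p => gamma p.1).
- apply/subspace_continuousP => -[x y] [/= xP yP] U Ux.
  rewrite in_itv/= in xP; have [d d0 dP] := c x xP U Ux.
  suff : nbhs ((x, y) : R * R) (fun p => (@unit_square R) p -> U (gamma p.1)) by [].
  apply/nbhs_ballP; exists d => //= -[x' y'] [/= x'd _] [/=]; rewrite in_itv/= => x'01 _.
  by apply: dP => //; rewrite distrC.
- by move=> [x y] [/= xP yP]; apply: gA.
have z01 : 0 <= (0 : R) <= 1 by rewrite lexx ler01.
exists (fun x => t x 0) => x x01; have [e e0 eP] := g x 0 x01 z01.
by exists e => // x' x'01 xx'; apply: eP => //; rewrite subrr normr0.
Qed.

(** Whether transport of a point of the covering along [gamma] changes its sign
    relative to the reference points at the two ends. *)
Definition holonomy gamma : bool :=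
  if pselect (exists tau, path_good gamma tau) is left h
  then sval (cid h) 0 (+) sval (cid h) 1 else false.

Lemma holonomyE gamma tau : path_good gamma tau -> holonomy gamma = tau 0 (+) tau 1.
Proof.
move=> g; rewrite /holonomy; case: pselect => [h|[]]; last by exists tau.
by case: cid => /= tau' g'; exact: path_good_uniq g' g.
Qed.

Lemma holonomy_concat gamma1 gamma2 : path_in A gamma1 -> path_in A gamma2 ->
  gamma1 1 = gamma2 0 ->
  holonomy (path_concat gamma1 gamma2) = holonomy gamma1 (+) holonomy gamma2.
Proof.
move=> p1 p2 g12; have [tau g] := path_lift (path_in_concat p1 p2 g12).
rewrite (holonomyE g).
rewrite (@holonomyE gamma1 (fun t => tau (t / 2))); last first.
  move=> t t01; have [|e e0 eP] := g (t / 2); first by apply/andP; split; lra.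
  exists e => // t' t'01; rewrite ltr_norml => te.
  rewrite eP; last 2 first.
  - by apply/andP; split; lra.
  - by rewrite ltr_norml; apply/andP; split; lra.
  have half (v : R) : 0 <= v <= 1 -> v / 2 <= 2^-1 by move=> ?; lra.
  rewrite /path_concat !half//.
  by congr (_ (+) E (gamma1 _) (gamma1 _)); field.
rewrite (@holonomyE gamma2 (fun t => tau ((1 + t) / 2))); last first.
  have conc2 t : 0 <= t -> path_concat gamma1 gamma2 ((1 + t) / 2) = gamma2 t.
    rewrite le_eqVlt => /predU1P[<-|t0].
      rewrite /path_concat ifT ?addr0 ?mul1r//.
      by rewrite -g12 mulfV ?pnatr_eq0.
    rewrite /path_concat ifF; last by apply/negbTE; rewrite -ltNge; lra.
    by congr gamma2; field.
  move=> t t01; have [|e e0 eP] := g ((1 + t) / 2); first by apply/andP; split; lra.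
  exists e => // t' t'01; rewrite ltr_norml => te.
  rewrite eP; last 2 first.
  - by apply/andP; split; lra.
  - by rewrite ltr_norml; apply/andP; split; lra.
  by rewrite !conc2//; [case/andP: t'01|case/andP: t01].
have -> : (1 + 1) / 2 = 1 :> R by field.
rewrite mul0r mul1r addr0 mul1r.
by move: (tau 0) (tau 1) (tau (2^-1)) => [] [] [].
Qed.

Lemma holonomy_rev gamma : path_in A gamma ->
  holonomy (fun t => gamma (1 - t)) = holonomy gamma.
Proof.
move=> p; have [tau g] := path_lift p.
rewrite (holonomyE g) (@holonomyE _ (fun t => tau (1 - t))) ?subr0 ?subrr 1?addbC//.
move=> t t01; have [|e e0 eP] := g (1 - t); first by apply/andP; split; lra.
exists e => // t' t'01; rewrite ltr_norml => te; apply: eP.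
  by apply/andP; split; lra.
by rewrite ltr_norml; apply/andP; split; lra.
Qed.

(** Lift the null homotopy to the square.  On the three sides mapped to the base
    point the lift is constant, so its values at the two ends of the side
    carrying [gamma] agree. *)
Lemma holonomy_null gamma : path_in A gamma -> null_homotopic A gamma ->
  holonomy gamma = false.
Proof.
move=> p [h [ch hA h0 h1 hs]].
have [t g] := square_lift ch hA.
have i0 : 0 <= (0 : R) <= 1 by rewrite lexx ler01.
have i1 : 0 <= (1 : R) <= 1 by rewrite lexx ler01.
have Ag : A (gamma 0) by case: p => _; apply; rewrite in_itv.
have inE01 (s : R) : 0 <= s <= 1 -> s \in `[0, 1] by rewrite in_itv.
have const (u : R -> bool) : (forall x, 0 <= x <= 1 -> exists2 d, 0 < d &
    forall y, 0 <= y <= 1 -> `|y - x| < d -> u y = u x) -> u 1 = u 0.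
  by move=> H; apply: (locally_constant_segment ler01 H).
rewrite (@holonomyE gamma (fun y => t 0 y)); last first.
  move=> y y01; have [e e0 eP] := g 0 y i0 y01; exists e => // y' y'01 yy'.
  by rewrite eP ?subrr ?normr0// !h0// inE01.
have t1 : t 1 1 = t 1 0.
  apply: (const (fun y => t 1 y)) => y y01.
  have [e e0 eP] := g 1 y i1 y01; exists e => // y' y'01 yy'.
  by rewrite eP ?subrr ?normr0// !h1 ?inE01// E_refl// addbF.
have t0 : t 1 0 = t 0 0.
  apply: (const (fun x => t x 0)) => x x01.
  have [e e0 eP] := g x 0 x01 i0; exists e => // x' x'01 xx'.
  by rewrite eP ?subrr ?normr0// (hs _ (inE01 _ x01)).1 (hs _ (inE01 _ x'01)).1 E_refl// addbF.
have t2 : t 1 1 = t 0 1.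
  apply: (const (fun x => t x 1)) => x x01.
  have [e e0 eP] := g x 1 x01 i1; exists e => // x' x'01 xx'.
  by rewrite eP ?subrr ?normr0// (hs _ (inE01 _ x01)).2 (hs _ (inE01 _ x'01)).2 E_refl// addbF.
by rewrite -t2 t1 t0 addbb.
Qed.

Hypothesis A_simply_connected : simply_connected R A.
Hypothesis locally_path_connected : forall p, A p -> forall U, nbhs p U -> \forall x \near p, A x ->
  exists gamma : R -> T, [/\ path_in (A `&` U) gamma, gamma 0 = p & gamma 1 = x].

(** Transport from a base point: by [holonomy_null] and concatenation, paths
    with the same ends have the same holonomy, so the sign transported to a point
    does not depend on the path.  Near [p] the transported sign varies like
    [E p], as one sees by prolonging a path to [p] inside a neighbourhood where
    the cocycle relation holds. *)
Theorem monodromy : exists sigma : T -> bool, forall p, A p ->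
  \forall x \near p, A x -> sigma x = sigma p (+) E p x.
Proof.
have [ [a0 Aa] |A0] := pselect (exists a, A a); last first.
  by exists (fun=> false) => p Ap; case: A0; exists p.
have [pathc nullh] := A_simply_connected.
have /choice[G GP] : forall x, exists gamma : R -> T, A x ->
    [/\ path_in A gamma, gamma 0 = a0 & gamma 1 = x].
  move=> x; have [Ax|nAx] := pselect (A x); last by exists (fun=> a0).
  by have [g gP] := pathc a0 x Aa Ax; exists g.
have same g1 g2 : path_in A g1 -> path_in A g2 -> g1 0 = g2 0 -> g1 1 = g2 1 ->
    holonomy g1 = holonomy g2.
  move=> p1 p2 e0 e1; have p2' := path_in_rev p2.
  have e1' : g1 1 = g2 (1 - 0) by rewrite subr0.
  have pc := path_in_concat p1 p2' e1'.
  have loop : path_concat g1 (fun t => g2 (1 - t)) 0 = path_concat g1 (fun t => g2 (1 - t)) 1.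
    rewrite /path_concat ifT ?invr_ge0// ifF; last first.
      by apply/negbTE; rewrite -ltNge invf_lt1// ltr1n.
    by rewrite mulr0 e0; congr g2; ring.
  have := holonomy_null pc (nullh _ pc loop).
  rewrite holonomy_concat// holonomy_rev//.
  by case: (holonomy g1) (holonomy g2) => [] [].
exists (fun x => holonomy (G x)) => p Ap.
have [pG G0 G1] := GP p Ap.
have cp := cocycle Ap; have lp := locally_path_connected Ap cp.
apply: filterS lp => x lx Ax; have [g [ [gc gA] g0 g1] ] := lx Ax.
have pg : path_in A g by split => // t /gA[].
have good : path_good g (fun t => E p (g t)).
  move=> t t01; have [Ag /(_ Ag) H] : (A `&` (fun x => A x ->
      \forall y \near x, A y -> E p y = E p x (+) E x y)) (g t).
    by apply: gA; rewrite in_itv.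
  move/segment_continuousP: gc => /(_ t t01 _ H)[d d0 dP].
  exists d => // t' t'01 tt'; apply: dP => //.
  by have [] := gA t'; rewrite ?in_itv.
have [qG Q0 Q1] := GP x Ax.
rewrite (same (G x) (path_concat (G p) g)).
- by rewrite holonomy_concat ?G1// (holonomyE good) g0 g1 E_refl.
- exact: qG.
- by apply: path_in_concat; rewrite ?G1.
- by rewrite Q0 /path_concat ifT ?invr_ge0// mulr0 G0.
- rewrite Q1 /path_concat ifF; last by apply/negbTE; rewrite -ltNge invf_lt1// ltr1n.
  by rewrite -g1; congr g; ring.
Qed.

End Monodromy.

(** * Circular domains and their planar sections *)

Section QuatTopology.
Local Open Scope complex_scope.
Variable R : realType.
Local Notation C := R[i].
Local Notation H := (quat R).
Implicit Types (p q I : H) (z w : C).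

Lemma nbhs_quatP p (P : set H) :
  nbhs p P <-> exists2 d : R, 0 < d & forall q, ql1norm (q - p) < d -> P q.
Proof.
split.
  move=> /nbhs_normP[d /= d0 dP]; exists d => // q qp; apply: dP.
  by rewrite /= distrC.
move=> [d d0 dP]; apply/nbhs_normP; exists d => // q qp; apply: dP.
by rewrite -[ql1norm _]/`|q - p| distrC; exact: qp.
Qed.

Lemma ql1norm_coord q : [/\ `|q0 q| <= ql1norm q, `|q1 q| <= ql1norm q,
  `|q2 q| <= ql1norm q & `|q3 q| <= ql1norm q].
Proof.
rewrite /ql1norm; have := normr_ge0 (q0 q); have := normr_ge0 (q1 q).
by have := normr_ge0 (q2 q); have := normr_ge0 (q3 q); split; lra.
Qed.

Lemma coord_continuous (g : H -> R) : (forall p q, g (p - q) = g p - g q) ->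
  (forall q, `|g q| <= ql1norm q) -> continuous g.
Proof.
move=> gB gle p; apply/(@cvgrPdist_le _ _ _ (nbhs p) (nbhs_filter p)) => e e0.
suff : nbhs p (fun q => `|g p - g q| <= e) by [].
apply/nbhs_quatP; exists e => // q qe.
by rewrite distrC -gB (le_trans (gle _))// ltW.
Qed.

Lemma q0_continuous : continuous (@q0 R).
Proof. by apply: coord_continuous => // q; case: (ql1norm_coord q). Qed.
Lemma q1_continuous : continuous (@q1 R).
Proof. by apply: coord_continuous => // q; case: (ql1norm_coord q). Qed.
Lemma q2_continuous : continuous (@q2 R).
Proof. by apply: coord_continuous => // q; case: (ql1norm_coord q). Qed.
Lemma q3_continuous : continuous (@q3 R).
Proof. by apply: coord_continuous => // q; case: (ql1norm_coord q). Qed.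

Lemma qimnorm_continuous : continuous (@qimnorm R).
Proof.
move=> q; apply: (@continuous_comp _ _ _ (fun q => qnorm2 (qim q)) Num.sqrt); last first.
  exact: sqrt_continuous.
have -> : (fun q : H => qnorm2 (qim q)) = (fun q => q1 q ^+ 2 + q2 q ^+ 2 + q3 q ^+ 2).
  by apply/funext => p; rewrite /qnorm2 /= expr0n add0r.
have sq (g : H -> R) : continuous g -> {for q, continuous (fun x => g x ^+ 2)}.
  by move=> cg; apply: (@continuous_comp _ _ _ g (fun x => x ^+ 2)); [exact: cg|exact: exprn_continuous].
have add (g h : H -> R) : {for q, continuous g} -> {for q, continuous h} ->
    {for q, continuous (fun x => g x + h x)}.
  by move=> cg ch; exact: (@cvgD _ _ _ _ (nbhs_filter q) _ _ _ _ cg ch).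
apply: (add (fun x => q1 x ^+ 2 + q2 x ^+ 2)); last exact: sq q3_continuous.
by apply: (add (fun x => q1 x ^+ 2)); [exact: sq q1_continuous|exact: sq q2_continuous].
Qed.

(** The point of the closed upper half plane that represents the sphere of q. *)
Definition upper q : C := q0 q +i* qimnorm q.

Lemma upper_continuous : continuous (upper : H -> (C : numFieldType)).
Proof.
move=> q A /nbhs_normcP[d d0 dA].
have d20 : 0 < d / 2 by rewrite divr_gt0.
have /cvgrPdist_lt/(_ _ d20) H0 := @q0_continuous q.
have /cvgrPdist_lt/(_ _ d20) H1 := @qimnorm_continuous q.
rewrite /= /nbhs /=; apply: filterS (filterI H0 H1) => p [h0 h1].
apply: dA; rewrite (le_lt_trans (normc_le_ReIm _))//.
by rewrite /upper /= [d]splitr ltrD// distrC.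
Qed.

Definition slice_point I z : H := (complex.Re z)%:A + complex.Im z *: I.

(** The inverse of [slice_point I] on the slice of I; the second coordinate is
    the scalar product of q with the imaginary unit I. *)
Definition slice_coord I q : C := q0 q +i* (q1 q * q1 I + q2 q * q2 I + q3 q * q3 I).

Lemma slice_pointK I : imS I -> cancel (slice_point I) (slice_coord I).
Proof.
move=> /imSE[I0 I1] [a b]; rewrite /slice_coord /slice_point !quatE /= I0.
congr (_ +i* _); first by ring.
rewrite -[RHS]mulr1 -I1 /qnorm2 I0; ring.
Qed.

Lemma upper_slice_point I z : imS I -> upper (slice_point I z) = complex.Re z +i* `|complex.Im z|.
Proof.
case: z => a b II; have [I0 I1] := imSE II.
rewrite /upper /slice_point /=; congr (_ +i* _).
rewrite -[RHS]mulr1 -I1 /qnorm2 /qim /= I0; ring.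
rewrite /qimnorm -sqrtr_sqr; congr Num.sqrt.
rewrite -[RHS]mulr1 -I1 /qnorm2 !quatE /= I0; ring.
Qed.

Lemma slice_pointD I z w : slice_point I (z + w) = slice_point I z + slice_point I w.
Proof. by rewrite /slice_point ReD ImD !scalerDl addrACA. Qed.

Lemma slice_pointZ I (t : R) z : slice_point I (t%:C * z) = t *: slice_point I z.
Proof. by rewrite /slice_point ReM ImM /= !mul0r subr0 addr0 scalerDr !scalerA. Qed.

Lemma slice_pointB I z w : slice_point I (z - w) = slice_point I z - slice_point I w.
Proof. by rewrite /slice_point ReD ImD ReN ImN !scalerDl !scaleNr opprD addrACA. Qed.

Lemma slice_point_bound I z :
  ql1norm (slice_point I z) <= (1 + ql1norm I) * normc z.
Proof.
rewrite /slice_point (le_trans (ql1normD _ _))// !ql1normZ mulrDl mul1r lerD//.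
  rewrite -[ql1norm 1]/(`|1 : R| + `|0| + `|0| + `|0|) normr1 !normr0 !addr0 mulr1.
  exact: Re_le_normc.
by rewrite mulrC ler_wpM2l ?Im_le_normc// /ql1norm !addr_ge0.
Qed.

Lemma slice_coordB I p q : slice_coord I (p - q) = slice_coord I p - slice_coord I q.
Proof. by apply/eqP; rewrite eq_complex /= ?quatE; apply/andP; split; apply/eqP; ring. Qed.

Lemma ql1norm_ge0 q : 0 <= ql1norm q.
Proof. by rewrite /ql1norm !addr_ge0. Qed.

Lemma slice_coord_bound I q :
  normc (slice_coord I q) <= (1 + ql1norm I) * ql1norm q.
Proof.
rewrite (le_trans (normc_le_ReIm _))//= mulrDl mul1r lerD//.
  by case: (ql1norm_coord q).
have [i0 i1 i2 i3] := ql1norm_coord I.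
rewrite (le_trans (ler_normD _ _))// (le_trans (lerD (ler_normD _ _) (lexx _)))// !normrM.
rewrite (@le_trans _ _ (`|q1 q| * ql1norm I + `|q2 q| * ql1norm I + `|q3 q| * ql1norm I))//.
  by rewrite !lerD// ler_wpM2l.
by rewrite -!mulrDl mulrC ler_wpM2l ?ql1norm_ge0// /ql1norm !lerD2r ?lerDr ?lerDl.
Qed.

Lemma bounded_additive_continuous (g : C -> H) (K : R) :
  (forall z w, g (z - w) = g z - g w) -> 0 <= K ->
  (forall z, ql1norm (g z) <= K * normc z) ->
  continuous (g : (C : numFieldType) -> H).
Proof.
move=> gB K0 gK z A /nbhs_quatP[d d0 dP].
have K1 : 0 < 1 + K by rewrite ltr_pwDl.
apply/nbhs_normcP; exists (d / (1 + K)); first by rewrite divr_gt0.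
move=> w wz; apply: dP; rewrite -gB (le_lt_trans (gK _))//.
rewrite (@le_lt_trans _ _ ((1 + K) * normc (w - z)))//.
  by rewrite ler_wpM2r ?normc_ge0// lerDr.
by rewrite mulrC -ltr_pdivlMr.
Qed.

Lemma slice_point_continuous I : continuous (slice_point I : (C : numFieldType) -> H).
Proof.
apply: (@bounded_additive_continuous _ (1 + ql1norm I)).
- exact: slice_pointB.
- by rewrite addr_ge0// ql1norm_ge0.
- exact: slice_point_bound.
Qed.

End QuatTopology.

Section CircularDomain.
Local Open Scope complex_scope.
Variable R : realType.
Local Notation C := R[i].
Local Notation H := (quat R).
Variables (D : set C) (Omega : set H) (I : H).
Hypothesis D_conj : conj_invariant D.
Hypothesis OmegaE : Omega = circularization D.
Hypothesis I_unit : imS I.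
Hypothesis Omega_open : open Omega.

Lemma upper_D q : Omega q -> D (upper q).
Proof.
rewrite OmegaE => -[a [b [J [Dab JJ ->]]]].
rewrite (upper_slice_point (a +i* b) JJ)/=.
have [b0|b0] := leP 0 b; first by rewrite ger0_norm.
by rewrite ltr0_norm//; exact: (D_conj Dab).
Qed.

(** The planar set D is determined by Omega: D is conjugation invariant, so the
    sign ambiguity of the imaginary part is harmless. *)
Lemma D_slice_point z : D z <-> Omega (slice_point I z).
Proof.
split; first by case: z => a b Dab; rewrite OmegaE; exists a, b, I.
move=> /upper_D; rewrite upper_slice_point//; case: z => a b /=.
have [b0|b0] := leP 0 b; first by rewrite ger0_norm.
by rewrite ltr0_norm// => /D_conj; rewrite /= opprK.
Qed.

Lemma D_slice_coord q : slice_plane I q -> slice_point I (slice_coord I q) = q.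
Proof.
move=> [a [b ->]]; have := slice_pointK I_unit (a +i* b).
by rewrite {1}/slice_point /= => ->.
Qed.

Lemma D_open z : D z -> locally z D.
Proof.
move=> /D_slice_point Oz; have := Omega_open; rewrite openE => /(_ _ Oz).
move=> /nbhs_quatP[d d0 dP].
have K0 : 0 < 1 + ql1norm I by rewrite ltr_pwDl// ql1norm_ge0.
exists (d / (1 + ql1norm I)) => [|w wz]; first by rewrite divr_gt0.
apply/D_slice_point; apply: dP; rewrite -slice_pointB.
by rewrite (le_lt_trans (slice_point_bound _ _))// mulrC -ltr_pdivlMr.
Qed.

End CircularDomain.

(** * Global holomorphic square roots *)

Section GlobalSqrt.
Local Open Scope complex_scope.
Variable R : realType.
Local Notation C := R[i].
Local Notation H := (quat R).
Variables (D : set C) (Omega : set H) (I : H) (S : C -> C).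
Hypothesis D_conj : conj_invariant D.
Hypothesis OmegaE : Omega = circularization D.
Hypothesis I_unit : imS I.
Hypothesis Omega_open : open Omega.
Hypothesis Omega_connected : connected Omega.
Hypothesis S_holo : forall z, D z -> cderivable S z.
Hypothesis S_conj : forall z, D z -> S z^* = (S z)^*.
Hypothesis S_neq0 : exists2 z, D z & S z != 0.

Let Dopen := D_open D_conj OmegaE I_unit Omega_open.
Let D_upper := upper_D D_conj OmegaE.
Let D_slice := D_slice_point D_conj OmegaE I_unit.

(* The closed upper half of D.  Unlike D it is always connected, being a
   continuous image of Omega. *)
Let Dup : set C := [set upper q | q in Omega].

Let conj_locally z (P : C -> Prop) : locally z P -> locally z^* (fun w => P w^*).
Proof.
move=> [e e0 eP]; exists e => // w we; apply: eP.
by rewrite -normc_conj rmorphB /= conjcK.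
Qed.

Let Dup_mem z : D z -> 0 <= complex.Im z -> Dup z.
Proof.
move=> /D_slice Oz z0; exists (slice_point I z) => //.
by rewrite upper_slice_point// ger0_norm//; case: z {Oz z0}.
Qed.

(** Identity theorem: the points of [Dup] around which S is zero form a clopen
    subset, and reflection transfers the conclusion to the lower half. *)
Lemma not_locally_zero z : D z -> ~ locally z (fun w => S w = 0).
Proof.
have Dup_connected : connected (Dup : set (C : numFieldType)).
  apply: connected_continuous_connected => //.
  by apply: continuous_subspaceT; exact: upper_continuous.
pose N : set C := [set w | D w /\ ~ locally w (fun u => S u = 0)].
pose Z : set C := [set w | locally w (fun u => S u = 0)].
have N_open : open (N : set (C : numFieldType)).
  apply/open_normcP => w [Dw nz].
  suff : locally w N by [].
  have dS : locally w (cderivable S) by apply: locallyS (Dopen Dw) => u; exact: S_holo.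
  have [//|nz'] := locally_zero_or dS.
  apply: locallyS (locallyI (Dopen Dw) nz') => u [Du uw]; split => //.
  have [->//|/uw Su] := eqVneq u w.
  by move=> /locally_at; exact/eqP.
have Z_open : open (Z : set (C : numFieldType)).
  by apply/open_normcP => w /locally_locally.
have E : [set w | Dup w /\ ~ Z w] = Dup.
  apply: Dup_connected.
  - have [w Dw Sw] := S_neq0.
    have [w0|w0] := leP 0 (complex.Im w).
      by exists w; split; [exact: Dup_mem|move=> /locally_at; exact/eqP].
    exists w^*; split.
      apply: Dup_mem; first exact: D_conj.
      by case: (w) w0 => a b /= b0; rewrite oppr_ge0 ltW.
    by move=> /locally_at; apply/eqP; rewrite S_conj// conjc_eq0.
  - exists N => //; apply/seteqP; split=> w [Uw nz]; split => //; last by case: nz.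
    by split => //; case: Uw => q /D_upper + <-.
  - exists (~` (Z : set (C : numFieldType))) => //.
    exact: open_closedC.
have up w : D w -> 0 <= complex.Im w -> ~ locally w (fun u => S u = 0).
  by move=> Dw w0; have : Dup w := Dup_mem Dw w0; rewrite -E => -[].
move=> Dz; have [z0|z0] := leP 0 (complex.Im z); first exact: up.
move=> /conj_locally zz; apply: (up z^*).
- exact: D_conj.
- by case: (z) z0 => a b /= b0; rewrite oppr_ge0 ltW.
apply: locallyS (locallyI zz (Dopen (D_conj Dz))) => w [Sw Dw].
have := S_conj (D_conj Dw); rewrite conjcK => ->.
by rewrite Sw conjc0.
Qed.

Hypothesis S_real : forall x : R, D x%:C -> 0 <= S x%:C.
Hypothesis S_even : forall z k G, D z -> G z != 0 -> locally z (cderivable G) ->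
  locally z (fun w => S w = (w - z) ^+ k * G w) -> ~~ odd k.

Let sqrt_germ z : exists T : C -> C, D z ->
  locally z (fun w => cderivable T w /\ T w ^+ 2 = S w).
Proof.
have [Dz|nDz] := pselect (D z); last by exists (fun=> 0).
have dS : locally z (cderivable S) by apply: locallyS (Dopen Dz) => u; exact: S_holo.
by have [T TP] := local_sqrt dS (fun k G => @S_even z k G Dz); exists T.
Qed.

Let root z : C -> C := sval (cid (sqrt_germ z)).

Let rootP z : D z -> locally z (fun w => cderivable (root z) w /\ root z w ^+ 2 = S w).
Proof. exact: svalP (cid (sqrt_germ z)). Qed.

(* The sign relating the chosen root near z to the chosen root near w. *)
Let sgn z w : bool := `[< ~ locally w (fun u => root z u = root w u) >].

Let sgnP z : D z -> locally z (fun w => D w /\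
  locally w (fun u => root z u = (-1) ^+ sgn z w * root w u)).
Proof.
move=> Dz; apply: locallyS (locallyI (locally_locally (rootP Dz)) (Dopen Dz)).
move=> w [rz Dw]; split => //; have rw := rootP Dw.
have [|||e|e] := @sqr_germs R (root z) (root w) w.
- by apply: locallyS rz => u [].
- by apply: locallyS rw => u [].
- by apply: locallyS (locallyI rz rw) => u [[_ ->] [_ ->]].
- have -> : sgn z w = false by apply/asboolP => H; exact: H e.
  by apply: locallyS e => u ->; rewrite expr0 mul1r.
have [e'|ne] := pselect (locally w (fun u => root z u = root w u)).
  have -> : sgn z w = false by apply/asboolP => H; exact: H e'.
  by apply: locallyS e' => u ->; rewrite expr0 mul1r.
have -> : sgn z w = true by apply/asboolP.
by apply: locallyS e => u ->; rewrite expr1 mulN1r.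
Qed.

(* Both sides compare the same roots, and a root near u is not its own opposite
   because S is not zero around u. *)
Let sgn_cocycle z : D z -> locally z (fun w => locally w (fun u =>
  sgn z u = sgn z w (+) sgn w u)).
Proof.
move=> Dz; have h0 := sgnP Dz.
apply: locallyS (locallyI h0 (locally_locally h0)) => w [[Dw zw] h1].
apply: locallyS (locallyI (locallyI h1 (sgnP Dw)) (locally_locally zw)) => u.
move=> [[[Du zu] [_ wu]] zw'].
have eq := locallyI (locallyI zu wu) zw'.
apply: contrapT => ns; apply: (not_locally_zero Du).
apply: locallyS (locallyI eq (rootP Du)) => v [[[e1 e2] e3] [_ <-]].
suff -> : root u v = 0 by rewrite expr0n.
move: e3; rewrite e1 e2 mulrA -signr_addb => /eqP; rewrite -subr_eq0 -mulrBl.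
rewrite mulf_eq0 => /orP[|/eqP//]; rewrite subr_eq0 => /eqP.
move=> /(@signr_inj _) h; by case: ns.
Qed.

Let plane_set : set H := Omega `&` slice_plane I.

Hypothesis Omega_I_simply_connected : forall q, plane_set q ->
  simply_connected R (connected_component plane_set q).

Let slice_point_plane z : slice_plane I (slice_point I z).
Proof. by exists (complex.Re z), (complex.Im z). Qed.

Let coord_near p (P : C -> Prop) : locally (slice_coord I p) P ->
  \forall q \near p, P (slice_coord I q).
Proof.
move=> [e e0 eP].
have K0 : 0 < 1 + ql1norm I by rewrite ltr_pwDl// ql1norm_ge0.
suff : nbhs p (fun q => P (slice_coord I q)) by [].
apply/nbhs_quatP; exists (e / (1 + ql1norm I)); first by rewrite divr_gt0.
move=> q qp; apply: eP; rewrite -slice_coordB.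
by rewrite (le_lt_trans (slice_coord_bound _ _))// mulrC -ltr_pdivlMr.
Qed.

Let segment p q (t : R) : H := p + t *: (q - p).

Let segment_continuous p q : continuous (segment p q).
Proof.
move=> t A /nbhs_quatP[d d0 dP].
have K0 : 0 < 1 + ql1norm (q - p) by rewrite ltr_pwDl// ql1norm_ge0.
apply/nbhs_ballP; exists (d / (1 + ql1norm (q - p))) => /=; first by rewrite divr_gt0.
move=> u; rewrite /ball/= distrC => ut; apply: dP.
have -> : segment p q u - segment p q t = (u - t) *: (q - p).
  by rewrite /segment opprD addrACA subrr add0r scalerBl.
rewrite ql1normZ (@le_lt_trans _ _ (`|u - t| * (1 + ql1norm (q - p))))//.
  by rewrite ler_wpM2l// lerDr.
by rewrite -ltr_pdivlMr.
Qed.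

Let segment_plane p q t : slice_plane I p -> slice_plane I q -> slice_plane I (segment p q t).
Proof.
move=> /(D_slice_coord I_unit) <- /(D_slice_coord I_unit) <-.
rewrite /segment -slice_pointB -slice_pointZ -slice_pointD.
exact: slice_point_plane.
Qed.

Let segment_ball p q t d : 0 <= t <= 1 -> ql1norm (q - p) < d ->
  ql1norm (segment p q t - p) < d.
Proof.
move=> /andP[t0 t1] qp; rewrite /segment addrAC subrr add0r ql1normZ ger0_norm//.
by rewrite (le_lt_trans _ qp)// ler_piMl// ql1norm_ge0.
Qed.

Let zbase : C := upper (xget (slice_point I 0) Omega).
(* The component of the slice that contains the closed upper half of D; it may
   be all of the slice or only one half. *)
Let X : set H := connected_component plane_set (slice_point I zbase).

Let Dup_zbase : Dup zbase.
Proof.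
have [z Dz _] := S_neq0; exists (xget (slice_point I 0) Omega) => //.
case: xgetP => [q _ //|/(_ (slice_point I z))]; case; exact/D_slice.
Qed.

Let Dup_D z : Dup z -> D z.
Proof. by move=> [q /D_upper + <-]. Qed.

Let X_sub p : X p -> plane_set p.
Proof. exact: connected_component_sub. Qed.

Let X_upper z : Dup z -> X (slice_point I z).
Proof.
have Dc : connected (slice_point I @` (Dup : set (C : numFieldType))).
  apply: connected_continuous_connected.
    apply: connected_continuous_connected => //.
    by apply: continuous_subspaceT; exact: upper_continuous.
  by apply: continuous_subspaceT; exact: slice_point_continuous.
have img w : Dup w -> (slice_point I @` Dup) (slice_point I w) by move=> Uw; exists w.
have sub : slice_point I @` Dup `<=` plane_set.
  move=> _ [w Uw <-]; split; last exact: slice_point_plane.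
  exact/D_slice/Dup_D.
by move=> Uz; exact: (connected_component_max (img _ Dup_zbase) sub Dc (img _ Uz)).
Qed.

Let X_ball p d : X p -> (forall q, ql1norm (q - p) < d -> Omega q) ->
  forall q, slice_plane I q -> ql1norm (q - p) < d -> X q.
Proof.
move=> Xp dP q Iq qp; have [_ Ip] := X_sub Xp.
apply: (connected_component_trans Xp).
pose B : set H := segment p q @` `[(0 : R), 1]%classic.
have B0 : B p by exists 0; rewrite /= ?in_itv/= ?lexx ?ler01// /segment scale0r addr0.
have B1 : B q.
  by exists 1; rewrite /= ?in_itv/= ?lexx ?ler01// /segment scale1r addrC subrK.
have sub : B `<=` plane_set.
  move=> _ [t + <-]; rewrite /= in_itv/= => t01; split; last exact: segment_plane.
  exact/dP/segment_ball.
have Bc : connected B.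
  apply: connected_continuous_connected; first exact: segment_connected.
  by apply: continuous_subspaceT; exact: segment_continuous.
exact: (connected_component_max B0 sub Bc B1).
Qed.

Let Omega_ball p : Omega p -> exists2 d : R, 0 < d & forall q, ql1norm (q - p) < d -> Omega q.
Proof.
by have := Omega_open; rewrite openE => O Op; have /nbhs_quatP := O _ Op.
Qed.

Let X_local z : X (slice_point I z) -> locally z (fun w => X (slice_point I w)).
Proof.
move=> Xz; have [Oz _] := X_sub Xz; have [d d0 dP] := Omega_ball Oz.
have [e e0 eP] : locally z (fun w => ql1norm (slice_point I w - slice_point I z) < d).
  apply/(@nbhs_normcP R z).
  apply: (@slice_point_continuous R I z (fun q => ql1norm (q - slice_point I z) < d)).
  by apply/nbhs_quatP; exists d.
by exists e => // w /eP; apply: X_ball dP _ _ => //; exact: slice_point_plane.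
Qed.

Let sheet : exists sigma : H -> bool, forall p, X p ->
  \forall q \near p, X q -> sigma q = sigma p (+) sgn (slice_coord I p) (slice_coord I q).
Proof.
apply: (@monodromy R H X (fun p q => sgn (slice_coord I p) (slice_coord I q))).
- move=> p /X_sub[Op /(D_slice_coord I_unit) pE].
  have Dp : D (slice_coord I p) by apply/D_slice; rewrite pE.
  have := coord_near (sgn_cocycle Dp); apply: filterS => q H1 _.
  by have := coord_near H1; apply: filterS.
- by apply: Omega_I_simply_connected; split; [exact/D_slice/Dup_D|exact: slice_point_plane].
move=> p Xp U /nbhs_quatP[e e0 eU].
have [Op Ip] := X_sub Xp; have [d d0 dP] := Omega_ball Op.
suff : nbhs p (fun x => X x -> exists gamma : R -> H,
    [/\ path_in (X `&` U) gamma, gamma 0 = p & gamma 1 = x]) by [].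
apply/nbhs_quatP; exists (Num.min d e) => [|q]; first by rewrite lt_min d0.
rewrite lt_min => /andP[qd qe] Xq; have [_ Iq] := X_sub Xq.
exists (segment p q); split.
- split; first by apply: continuous_subspaceT; exact: segment_continuous.
  move=> t; rewrite in_itv/= => t01; split; last exact/eU/segment_ball.
  by apply: (X_ball Xp dP); [exact: segment_plane|exact: segment_ball].
- by rewrite /segment scale0r addr0.
- by rewrite /segment scale1r addrC subrK.
Qed.

Let upper_root : exists T0 : C -> C, forall z, X (slice_point I z) ->
  cderivable T0 z /\ T0 z ^+ 2 = S z.
Proof.
have [sigma sigmaP] := sheet.
exists (fun z => (-1) ^+ sigma (slice_point I z) * root z z) => z Xz.
have [/D_slice Dz _] := X_sub Xz.
split; last first.
  rewrite exprMn sqrr_sign mul1r.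
  by have [] := locally_at (rootP Dz).
have [e e0 eP] : locally z (fun w => (-1) ^+ sigma (slice_point I z) * root z w =
    (-1) ^+ sigma (slice_point I w) * root w w).
  have [d d0 dP] : locally z (fun w => X (slice_point I w) ->
      sigma (slice_point I w) = sigma (slice_point I z) (+) sgn z w).
    have /(@nbhs_normcP R z)[d d0 dP] := @slice_point_continuous R I z _ (sigmaP _ Xz).
    by exists d => // w /dP /=; rewrite !(slice_pointK I_unit); exact.
  have near_ : locally z (fun w => X (slice_point I w) ->
      sigma (slice_point I w) = sigma (slice_point I z) (+) sgn z w) by exists d.
  apply: locallyS (locallyI (locallyI near_ (X_local Xz)) (sgnP Dz)) => w.
  move=> [[sw Xw] [_ /locally_at ->]].
  by rewrite sw// signr_addb mulrA.
apply: (@cderivable_near R (fun w => (-1) ^+ sigma (slice_point I z) * root z w) _ z e e0 eP).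
apply: (@cderivableM R (fun=> (-1) ^+ sigma (slice_point I z)) (root z)).
  exact: cderivable_cst.
by have [] := locally_at (rootP Dz).
Qed.

(** The root T_0 found on the component of the upper half is reflected to the
    lower half.  At a real point, T_0 and its reflection are two roots of S, hence
    equal or opposite; as S is nonnegative on the real axis T_0 is real there, so
    if they were opposite T_0 would vanish on a real interval and S would be zero
    near the point. *)
Theorem holomorphic_sqrt : exists T : C -> C, forall z, D z ->
  [/\ cderivable T z, T z ^+ 2 = S z & T z^* = (T z)^*].
Proof.
have [T0 T0P] := upper_root.
have im_conj (z : C) : complex.Im z^* = - complex.Im z by case: z.
have upP z : D z -> 0 <= complex.Im z -> X (slice_point I z).
  by move=> Dz z0; apply: X_upper; exact: Dup_mem.
have loP z : D z -> complex.Im z < 0 -> X (slice_point I z^*).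
  by move=> Dz z0; apply: upP; [exact: D_conj|rewrite im_conj oppr_ge0 ltW].
have real_conj z : D z -> complex.Im z = 0 -> (T0 z)^* = T0 z.
  case: z => a b /= + b0; rewrite {}b0 => Da.
  have [_] := T0P _ (upP (a +i* 0) Da (lexx _)).
  have := S_real Da; rewrite -[a%:C]/(a +i* 0) => + e; rewrite -{}e.
  case: (T0 _) => u v; rewrite expr2 lecE /= => /andP[/eqP].
  move=> uv pos; have : u * v = 0 by move: uv; rewrite [v * u]mulrC; lra.
  move/eqP; rewrite mulf_eq0 => /orP[]/eqP h; last by rewrite h oppr0.
  suff -> : v = 0 by rewrite oppr0.
  move: pos; rewrite h mul0r sub0r oppr_ge0 -expr2 => v0.
  by apply/eqP; rewrite -sqrf_eq0 eq_le v0 sqr_ge0.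
pose T z := if 0 <= complex.Im z then T0 z else (T0 z^*)^*.
have Tsq z : D z -> T z ^+ 2 = S z.
  move=> Dz; rewrite /T; case: leP => z0; first by have [] := T0P _ (upP _ Dz z0).
  have [_ e] := T0P _ (loP _ Dz z0).
  by rewrite -rmorphXn /= e S_conj// conjcK.
exists T => z Dz; split; [|exact: Tsq|]; last first.
  rewrite /T im_conj; have [z0|z0|z0] := ltgtP 0 (complex.Im z).
  - by rewrite leNgt oppr_lt0 z0/= conjcK.
  - by rewrite oppr_ge0 (ltW z0) conjcK.
  - rewrite -z0 oppr0 lexx real_conj//.
    by congr T0; case: (z) z0 => a b /= <-; rewrite oppr0.
have [z0|z0|z0] := ltgtP 0 (complex.Im z).
- have [d _] := T0P _ (upP _ Dz (ltW z0)).
  apply: (@cderivable_near R T0 T z (complex.Im z) z0) => // w wz.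
  rewrite /T ifT//; have := le_lt_trans (Im_le_normc _) wz.
  by rewrite ImD ImN ltr_norml => /andP[]; lra.
- have [d _] := T0P _ (loP _ Dz z0).
  have z0' : 0 < - complex.Im z by rewrite oppr_gt0.
  apply: (@cderivable_near R (fun w => (T0 w^*)^*) T z (- complex.Im z) z0') => [w wz|].
    rewrite /T ifF//; apply/negbTE; rewrite -ltNge.
    have := le_lt_trans (Im_le_normc _) wz.
    by rewrite ImD ImN ltr_norml => /andP[]; lra.
  exact: cderivable_conj.
have Xz : X (slice_point I z) by apply: upP; rewrite // -z0.
have zE : z = (complex.Re z)%:C by case: (z) z0 => a b /= <-.
have zC : z^* = z by rewrite zE conjc_real.
have dT0 : locally z (fun w => cderivable T0 w /\ T0 w ^+ 2 = S w).
  by apply: locallyS (X_local Xz) => w; exact: T0P.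
have dT0c : locally z (fun w => cderivable (fun v => (T0 v^*)^*) w /\
    (T0 w^*)^*%C ^+ 2 = S w).
  have := conj_locally dT0; rewrite zC => h.
  apply: locallyS (locallyI h (Dopen Dz)) => w [[d e] Dw]; split.
    exact: cderivable_conj.
  by rewrite -rmorphXn /= e S_conj// conjcK.
have [e e0 eP] : locally z (fun w => T0 w = (T0 w^*)^*).
  have [|||//|opp] := @sqr_germs R T0 (fun w => (T0 w^*)^*) z.
  - by apply: locallyS dT0 => w [].
  - by apply: locallyS dT0c => w [].
  - by apply: locallyS (locallyI dT0 dT0c) => w [[_ ->] [_ ->]].
  exfalso; have dS : locally z (cderivable S).
    by apply: locallyS (Dopen Dz) => u; exact: S_holo.
  have [|nS] := locally_zero_or dS; first exact: not_locally_zero.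
  have [e e0 eP] := locallyI (locallyI (locallyI nS opp) (Dopen Dz)) dT0.
  pose w := z + (e / 2)%:C.
  have we : normc (w - z) < e.
    rewrite /w addrC addKr normc_real ger0_norm ?divr_ge0 ?(ltW e0)//.
    by have := e0; lra.
  have [[[Sw oppw] Dw] [_ sqw]] := eP w we.
  have wim : complex.Im w = 0 by rewrite /w ImD -z0 add0r.
  have wC : w^* = w by case: (w) wim => a b /= ->; rewrite oppr0.
  move: oppw; rewrite wC real_conj// => /eqP; rewrite -addr_eq0 -mulr2n.
  rewrite mulrn_eq0 /= => /eqP T0w.
  have wz : w != z.
    by rewrite -subr_eq0 /w addrC addKr eq_complex /= eqxx andbT gt_eqF// divr_gt0.
  by have := Sw wz; rewrite -sqw T0w expr0n eqxx.
apply: (@cderivable_near R T0 T z e e0) => [w we|]; last by have [] := T0P _ Xz.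
by rewrite /T; case: leP => // _; exact: eP.
Qed.

End GlobalSqrt.

(** * Slice functions through their stem functions *)

Section SliceToolkit.
Local Open Scope complex_scope.
Variable R : realType.
Local Notation C := R[i].
Local Notation H := (quat R).
Local Notation HC := (quat R[i]).
Implicit Types (D : set C) (Omega : set H) (F G : C -> HC) (f g s : H -> H) (I J : H).

Lemma part1D (u v : HC) : part1 (u + v) = part1 u + part1 v.
Proof. by apply: quat_eq => /=; rewrite ReD. Qed.
Lemma part2D (u v : HC) : part2 (u + v) = part2 u + part2 v.
Proof. by apply: quat_eq => /=; rewrite ImD. Qed.

Lemma part1M (u v : HC) : part1 (u * v) = part1 u * part1 v - part2 u * part2 v.
Proof. by rewrite -{1}(tensorK u) -{1}(tensorK v) tensorM part1_tensor. Qed.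
Lemma part2M (u v : HC) : part2 (u * v) = part1 u * part2 v + part2 u * part1 v.
Proof. by rewrite -{1}(tensorK u) -{1}(tensorK v) tensorM part2_tensor. Qed.

Lemma part_inj (u v : HC) : part1 u = part1 v -> part2 u = part2 v -> u = v.
Proof. by move=> e1 e2; rewrite -(tensorK u) e1 e2 tensorK. Qed.

Lemma part1_scalar (c : C) : part1 (c%:A) = (complex.Re c)%:A.
Proof. by apply: quat_eq; rewrite /= ?ReM ?mulr1 ?mulr0 ?subr0 //= ?mulr0 ?subrr. Qed.
Lemma part2_scalar (c : C) : part2 (c%:A) = (complex.Im c)%:A.
Proof. by apply: quat_eq; rewrite /= ?ImM ?mulr1 ?mulr0 ?add0r ?addr0 //= ?mulr0 ?addr0. Qed.

Lemma part1_bar (u : HC) : part1 (bar u) = part1 u.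
Proof. by rewrite /bar part1_tensor. Qed.
Lemma part2_bar (u : HC) : part2 (bar u) = - part2 u.
Proof. by rewrite /bar part2_tensor. Qed.

Lemma barM (u v : HC) : bar (u * v) = bar u * bar v.
Proof.
by apply: part_inj; rewrite ?part1M ?part2M ?part1_bar ?part2_bar ?part1M ?part2M
  ?mulrN ?mulNr ?opprK// opprD.
Qed.

Lemma barE (u : HC) : bar u = Quat (q0 u)^* (q1 u)^* (q2 u)^* (q3 u)^*.
Proof. by case: u => [[? ?] [? ?] [? ?] [? ?]]. Qed.

(** The value on the slice of J of the slice function whose stem value is w. *)
Definition slice_eval J (w : HC) : H := part1 w + J * part2 w.

Lemma slice_evalD J u v : slice_eval J (u + v) = slice_eval J u + slice_eval J v.
Proof. by rewrite /slice_eval part1D part2D mulrDr addrACA. Qed.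

Lemma slice_eval_scalar J (c : C) : slice_eval J (c%:A) = slice_point J c.
Proof. by rewrite /slice_eval part1_scalar part2_scalar /slice_point -scalerAr mulr1. Qed.

(** Evaluation on a slice is multiplicative when the left factor is a complex
    scalar, that is for slice-preserving left factors; it is not multiplicative
    in general. *)
Lemma slice_evalZ J (c : C) w : imS J -> slice_eval J (c *: w) = slice_point J c * slice_eval J w.
Proof.
move=> JJ; have {}JJ : J * J = -1 := JJ.
have p1 : part1 (c *: w) = complex.Re c *: part1 w - complex.Im c *: part2 w.
  by apply: quat_eq; rewrite /= ReM.
have p2 : part2 (c *: w) = complex.Re c *: part2 w + complex.Im c *: part1 w.
  by apply: quat_eq; rewrite /= ImM.
rewrite /slice_eval p1 p2 /slice_point [RHS]mulrDl -!scalerAl mul1r [J * (part1 w + _)]mulrDr mulrA JJ mulN1r.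
by rewrite mulrDr -!scalerAr !scalerDr scalerN addrACA; congr (_ + _); rewrite addrC.
Qed.

Lemma slice_pointM J (a b : C) : imS J -> slice_point J (a * b) = slice_point J a * slice_point J b.
Proof.
move=> JJ; rewrite -(slice_eval_scalar J (a * b)) -(slice_eval_scalar J b).
by rewrite -slice_evalZ// scalerA.
Qed.

Lemma slice_point1 J : slice_point J 1 = 1.
Proof. by rewrite /slice_point /= scale0r addr0 scale1r. Qed.

Lemma slice_point0 J : slice_point J 0 = 0.
Proof. by rewrite /slice_point /= !scale0r addr0. Qed.

Lemma slice_pointV J (c : C) : imS J -> c != 0 -> slice_point J c^-1 = (slice_point J c)^-1.
Proof.
move=> JJ c0; have e1 : slice_point J c^-1 * slice_point J c = 1.
  by rewrite -slice_pointM// mulVf// slice_point1.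
have e2 : slice_point J c * slice_point J c^-1 = 1.
  by rewrite -slice_pointM// mulfV// slice_point1.
have U : slice_point J c \is a GRing.unit by apply/unitrP; exists (slice_point J c^-1).
by apply: (mulrI U); rewrite e2 mulrV.
Qed.

Definition represents D F f := stem D F /\ induces D F f.

Variables (D : set C) (Omega : set H).
Hypothesis D_conj : conj_invariant D.
Hypothesis OmegaE : Omega = circularization D.

Lemma represents_stem_of F f z : represents D F f -> D z -> stem_of f z = F z.
Proof. by move=> [sF fF]; exact: stem_ofE. Qed.

Lemma represents_slice_fun F G : stem D F -> (forall z, D z -> G z = F z) ->
  represents D F (slice_fun G).
Proof.
move=> sF GF; have sG : stem D G by move=> z Dz; rewrite !GF ?sF//; exact: D_conj.
by split=> // a b J Dz JJ; rewrite (slice_funE D_conj sG Dz JJ) GF.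
Qed.

Lemma represents_eval F f J z : represents D F f -> imS J -> D z ->
  f (slice_point J z) = slice_eval J (F z).
Proof. by move=> [_ fF] JJ; case: z => a b Dz; exact: fF. Qed.

Lemma Omega_ex q : Omega q -> exists z J, [/\ D z, imS J & q = slice_point J z].
Proof.
by rewrite OmegaE => -[a [b [J [Dz JJ ->]]]]; exists (a +i* b), J.
Qed.

Lemma represents_star F G f g : represents D F f -> represents D G g ->
  represents D (fun z => F z * G z) (star f g).
Proof.
move=> rf rg; apply: represents_slice_fun.
  by move=> z Dz; rewrite rf.1// rg.1// barM.
by move=> z Dz; rewrite (represents_stem_of rf)// (represents_stem_of rg).
Qed.

Lemma qconj_bar (w : HC) : qconj (bar w) = bar (qconj w).
Proof. by rewrite !barE /qconj /= !rmorphN. Qed.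

Lemma represents_conj F f : represents D F f ->
  represents D (fun z => qconj (F z)) (conj_slice f).
Proof.
move=> rf; apply: represents_slice_fun.
  by move=> z Dz; rewrite rf.1// qconj_bar.
by move=> z Dz; rewrite (represents_stem_of rf).
Qed.

Definition scal (w : HC) : HC := (q0 w)%:A.
Definition vect (w : HC) : HC := Quat 0 (q1 w) (q2 w) (q3 w).

Let halfP (w : HC) : (2^-1 : R)%:C *: (w + qconj w) = scal w.
Proof.
have h : (2^-1 : R)%:C = 2^-1 :> C by rewrite fmorphV rmorph_nat.
by rewrite h; apply: quat_eq => /=; field.
Qed.

Let halfM (w : HC) : (2^-1 : R)%:C *: (w - qconj w) = vect w.
Proof.
have h : (2^-1 : R)%:C = 2^-1 :> C by rewrite fmorphV rmorph_nat.
by rewrite h; apply: quat_eq => /=; field.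
Qed.

Lemma slice_evalR J (x : R) w : slice_eval J (x%:C *: w) = x *: slice_eval J w.
Proof.
rewrite /slice_eval scalerDr; congr (_ + _); last rewrite scalerAr.
  by apply: quat_eq; rewrite /= ReM /= mul0r subr0.
by congr (_ * _); apply: quat_eq; rewrite /= ImM /= mul0r addr0.
Qed.

Lemma slice_evalN J w : slice_eval J (- w) = - slice_eval J w.
Proof. by rewrite -scaleN1r -[-1 in LHS](rmorphN1 (real_complex R)) slice_evalR scaleN1r. Qed.

Lemma represents_real_part F f : represents D F f ->
  represents D (fun z => scal (F z)) (real_part f).
Proof.
move=> rf; have rc := represents_conj rf; split.
  by move=> z Dz; rewrite rf.1// !barE /scal; apply: quat_eq;
    rewrite /= ?rmorphM ?rmorph1 ?rmorph0 ?mulr1 ?mulr0 ?conjc0.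
move=> a b J Dz JJ; rewrite -/(slice_point J (a +i* b)) -/(slice_eval J _) /real_part.
by rewrite (represents_eval rf)// (represents_eval rc)// -slice_evalD -slice_evalR halfP.
Qed.

Lemma represents_vector_part F f : represents D F f ->
  represents D (fun z => vect (F z)) (vector_part f).
Proof.
move=> rf; have rc := represents_conj rf; split.
  by move=> z Dz; rewrite rf.1// !barE; apply: quat_eq; rewrite //= oppr0.
move=> a b J Dz JJ; rewrite -/(slice_point J (a +i* b)) -/(slice_eval J _) /vector_part.
by rewrite (represents_eval rf)// (represents_eval rc)// -slice_evalN -slice_evalD -slice_evalR halfM.
Qed.

Lemma represents_symmetrization F f : represents D F f ->
  represents D (fun z => (qnorm2 (F z))%:A) (symmetrization f).
Proof.
move=> rf; have := represents_star rf (represents_conj rf).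
by rewrite (_ : (fun z => _) = (fun z => (qnorm2 (F z))%:A))//; apply/funext => z; rewrite qmul_conj.
Qed.

Lemma represents_starpow F f n : represents D F f ->
  represents D (fun z => F z ^+ n) (starpow f n).
Proof.
move=> rf; elim: n => [|n ih].
  split; first by move=> z Dz; rewrite !expr0 barE; apply: quat_eq; rewrite //= oppr0.
  by move=> a b J Dz JJ; rewrite expr0 -/(slice_eval J _);
    have := slice_eval_scalar J 1; rewrite scale1r slice_point1 => ->.
have := represents_star rf ih.
by rewrite (_ : (fun z => _) = (fun z => F z ^+ n.+1))//; apply/funext => z; rewrite exprS.
Qed.

(** The values at a + bi and a - bi already determine the stem function. *)
Lemma represents_uniq F G f g : represents D F f -> represents D G g ->
  (forall q, Omega q -> f q = g q) -> forall z, D z -> F z = G z.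
Proof.
move=> rf rg fg z Dz; rewrite -(represents_stem_of rf Dz) -(represents_stem_of rg Dz).
have fgp J (w : C) : D w -> imS J -> f (slice_point J w) = g (slice_point J w).
  by move=> Dw JJ; apply: fg; rewrite OmegaE; case: w Dw => a b Dw; exists a, b, J.
rewrite /stem_of -scaleNr; set J : H := Quat 0 1 0 0.
have JJ : imS J := imS_i R.
have := fgp J z Dz JJ; rewrite {1 2}/slice_point => ->.
have := fgp J z^* (D_conj Dz) JJ; rewrite {1 2}/slice_point.
by case: z {Dz} => a b /= ->.
Qed.

End SliceToolkit.

(** * Holomorphic stem functions and multiplicities *)

Section Coordinates.
Local Open Scope complex_scope.
Variable R : realType.
Local Notation C := R[i].
Local Notation H := (quat R).
Local Notation HC := (quat R[i]).
Implicit Types (D : set C) (F G : C -> HC) (z w : C) (c : C -> C).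

(** Indexing the coordinates allows coordinatewise arguments to be stated
    once. *)
Definition qcoord (K : Type) (k : nat) (w : quat K) : K :=
  match k with 0 => q0 w | 1 => q1 w | 2 => q2 w | _ => q3 w end.

Lemma qcoord_inj (K : Type) (u v : quat K) : (forall k, qcoord k u = qcoord k v) -> u = v.
Proof. by move=> h; apply: quat_eq; [exact: (h 0)|exact: (h 1)|exact: (h 2)|exact: (h 3)]. Qed.

Lemma qcoordZ k (a : C) (w : HC) : qcoord k (a *: w) = a * qcoord k w.
Proof. by case: k => [|[|[|k]]]. Qed.

Lemma qcoord_bar k (w : HC) : qcoord k (bar w) = (qcoord k w)^*.
Proof. by rewrite barE; case: k => [|[|[|k]]]. Qed.

Lemma qcoord0 k : qcoord k (0 : HC) = 0.
Proof. by case: k => [|[|[|k]]]. Qed.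

Let quat_normE (w : HC) : `|w| = `|q0 w| + `|q1 w| + `|q2 w| + `|q3 w|.
Proof. by []. Qed.

Let qcoord_norm k (w : HC) : `|qcoord k w| <= `|w|.
Proof.
rewrite quat_normE.
case: k => [|[|[|k]]] /=.
- by rewrite -!addrA lerDl !addr_ge0.
- by rewrite [`|q0 w| + _]addrC -!addrA lerDl !addr_ge0.
- by rewrite -addrA addrCA lerDl !addr_ge0.
- by rewrite lerDr !addr_ge0.
Qed.

Let qcoord_quot k F z (h : C) :
  qcoord k (h^-1 *: (F (h *: 1 + z) - F z)) =
  h^-1 *: ((qcoord k (F (h *: 1 + z)) - qcoord k (F z)) : (C : numFieldType)).
Proof. by case: k => [|[|[|k]]]. Qed.

Lemma derivable_qcoord k F z :
  derivable (F : (C : numFieldType) -> HC) z 1 -> cderivable (fun w => qcoord k (F w)) z.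
Proof.
move=> /cvg_ex[/= l Hl].
apply: (cvgP (qcoord k l : (C : numFieldType))).
apply/(@cvgrPdist_le (C : numFieldType) (C : numFieldType) _ _ (dnbhs_filter _)) => e e0.
have Fl := (@cvgrPdist_le (C : numFieldType) HC _ _ (dnbhs_filter _) _ _).1 Hl e e0.
apply: filterS Fl => h /= Fh.
rewrite -qcoord_quot (le_trans _ Fh)//.
by apply: le_trans (qcoord_norm k _); case: (k) => [|[|[|k']]].
Qed.

Lemma qcoord_derivable F z : (forall k, cderivable (fun w => qcoord k (F w)) z) ->
  derivable (F : (C : numFieldType) -> HC) z 1.
Proof.
move=> dF.
have /cvg_ex[/= l0 H0] := dF 0; have /cvg_ex[/= l1 H1] := dF 1.
have /cvg_ex[/= l2 H2] := dF 2; have /cvg_ex[/= l3 H3] := dF 3.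
apply: (cvgP (Quat l0 l1 l2 l3)).
apply/(@cvgrPdist_le (C : numFieldType) HC _ _ (dnbhs_filter _)) => e e0.
have e40 : 0 < e / 4 by rewrite divr_gt0.
have G0 := (@cvgrPdist_le (C : numFieldType) (C : numFieldType) _ _ (dnbhs_filter _) _ _).1 H0 _ e40.
have G1 := (@cvgrPdist_le (C : numFieldType) (C : numFieldType) _ _ (dnbhs_filter _) _ _).1 H1 _ e40.
have G2 := (@cvgrPdist_le (C : numFieldType) (C : numFieldType) _ _ (dnbhs_filter _) _ _).1 H2 _ e40.
have G3 := (@cvgrPdist_le (C : numFieldType) (C : numFieldType) _ _ (dnbhs_filter _) _ _).1 H3 _ e40.
apply: filterS (filterI (filterI G0 G1) (filterI G2 G3)) => h [[h0 h1] [h2 h3]].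
rewrite quat_normE.
have -> : e = e / 4 + e / 4 + e / 4 + e / 4 by field.
by rewrite !lerD.
Qed.

Definition holo_coords D F := forall k z, D z -> cderivable (fun w => qcoord k (F w)) z.

Lemma holomorphicE D F : holomorphic D F <-> holo_coords D F.
Proof.
split=> h.
  by move=> k z Dz; apply: derivable_qcoord; exact: h.
by move=> z Dz; apply: qcoord_derivable => k; exact: h.
Qed.

Lemma holo_coordsM D F G : holo_coords D F -> holo_coords D G ->
  holo_coords D (fun z => F z * G z).
Proof.
move=> hF hG k z Dz.
have P a b : cderivable (fun w => qcoord a (F w) * qcoord b (G w)) z.
  exact: (@cderivableM R (fun w => qcoord a (F w)) (fun w => qcoord b (G w)) z (hF a z Dz) (hG b z Dz)).
have add f g := @cderivableD R f g z; have sub f g := @cderivableB R f g z.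
case: k => [|[|[|k]]].
- exact: (sub _ _ (sub _ _ (sub _ _ (P 0 0) (P 1 1)) (P 2 2)) (P 3 3)).
- exact: (sub _ _ (add _ _ (add _ _ (P 0 1) (P 1 0)) (P 2 3)) (P 3 2)).
- exact: (add _ _ (add _ _ (sub _ _ (P 0 2) (P 1 3)) (P 2 0)) (P 3 1)).
- exact: (add _ _ (sub _ _ (add _ _ (P 0 3) (P 1 2)) (P 2 1)) (P 3 0)).
Qed.

Lemma holo_qnorm2 D F z : holo_coords D F -> D z -> cderivable (fun w => qnorm2 (F w)) z.
Proof.
move=> hF Dz.
have P a : cderivable (fun w => qcoord a (F w) ^+ 2) z.
  exact: (@cderivableX R (fun w => qcoord a (F w)) 2 z (hF a z Dz)).
have add f g := @cderivableD R f g z.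
exact: (add _ _ (add _ _ (add _ _ (P 0) (P 1)) (P 2)) (P 3)).
Qed.

Lemma holo_vect D F : holo_coords D F -> holo_coords D (fun z => vect (F z)).
Proof.
move=> hF [|[|[|k]]] z Dz /=; first exact: cderivable_cst.
- exact: (hF 1).
- exact: (hF 2).
- exact: (hF 3).
Qed.

Lemma qnorm2Z (a : C) (w : HC) : qnorm2 (a *: w) = a ^+ 2 * qnorm2 w.
Proof. by rewrite /qnorm2 !quatE; ring. Qed.

(** If A + J B = 0 then A + iB = (i - J) B, and i - J has norm i^2 + 1 = 0. *)
Lemma slice_eval_eq0_qnorm2 (J : H) (w : HC) : imS J -> slice_eval J w = 0 -> qnorm2 w = 0.
Proof.
move=> /imSE[J0 J1] e.
have -> : w = tensor (- J) 1 * tensor (part2 w) 0.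
  rewrite tensorM !mulr0 subr0 add0r mul1r mulNr.
  apply: part_inj; rewrite ?part1_tensor ?part2_tensor//.
  by apply/eqP; rewrite -addr_eq0 -[_ + _]/(slice_eval J w) e.
rewrite qnorm2M; suff -> : qnorm2 (tensor (- J) 1) = 0 by rewrite mul0r.
have J1' : q1 J * q1 J + q2 J * q2 J + q3 J * q3 J = 1 by rewrite -J1 /qnorm2 J0; ring.
rewrite /qnorm2 /= J0 ?expr2; apply/eqP; rewrite eq_complex /=.
by apply/andP; split; apply/eqP; [move: J1'; lra|ring].
Qed.

(** The complexified quaternions have zero divisors: the norm of A + iB is
    |A|^2 - |B|^2 + 2i <A, B>, so when it vanishes A and B are orthogonal of equal
    length, and J = - A B^-1 is an imaginary unit with A + J B = 0. *)
Lemma qnorm2_eq0_slice_eval (w : HC) : qnorm2 w = 0 -> w != 0 -> exists2 J : H, imS J & slice_eval J w = 0.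
Proof.
move=> N0 w0; set A := part1 w; set B := part2 w.
have Nre : qnorm2 A = qnorm2 B.
  move: N0 => /(congr1 (@complex.Re R)); rewrite /qnorm2 !ReD ?expr2 !ReM /= => h.
  by apply/eqP; rewrite -subr_eq0; apply/eqP; rewrite /A /B /qnorm2 /= ?expr2; move: h; lra.
have Nim : q0 A * q0 B + q1 A * q1 B + q2 A * q2 B + q3 A * q3 B = 0.
  move: N0 => /(congr1 (@complex.Im R)); rewrite /qnorm2 !ImD ?expr2 !ImM /= => h.
  by rewrite /A /B /=; move: h; lra.
have qn0 (u : H) : qnorm2 u = 0 -> u = 0.
  move=> /eqP; rewrite /qnorm2 !paddr_eq0 ?addr_ge0 ?sqr_ge0// !sqrf_eq0.
  by move=> /andP[/andP[/andP[/eqP ? /eqP ?] /eqP ?] /eqP ?]; exact: quat_eq.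
have B0 : qnorm2 B != 0.
  apply/eqP => e; move/eqP: w0; apply; apply: part_inj.
    by rewrite -/A (qn0 A) ?Nre//; apply: quat_eq.
  by rewrite -/B (qn0 B)//; apply: quat_eq.
pose J := - ((qnorm2 B)^-1 *: (A * qconj B)).
have J0 : q0 J = 0.
  rewrite /J !quatE /= (_ : _ - _ = 0) ?mulr0 ?oppr0//; move: Nim; lra.
have J1 : qnorm2 J = 1.
  have JN (k : R) : qnorm2 (- (k *: (A * qconj B))) = k ^+ 2 * (qnorm2 A * qnorm2 B).
    by rewrite -qnorm2M /qnorm2; move: {+}A {+}B => u v; rewrite !quatE /=; ring.
  by rewrite /J JN Nre expr2 mulrA divfK// mulVf.
exists J.
  have sq (u : H) : q0 u = 0 -> u * u = - (qnorm2 u)%:A.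
    by move=> u0; apply: quat_eq; rewrite !quatE /qnorm2 u0; ring.
  by rewrite /imS /= sq// J1 scale1r.
rewrite /slice_eval -/A -/B /J mulNr -scalerAl -mulrA qconj_mul -scalerAr mulr1 scalerA mulVf//.
by rewrite scale1r subrr.
Qed.

End Coordinates.

Section Multiplicity.
Local Open Scope complex_scope.
Variable R : realType.
Local Notation C := R[i].
Local Notation H := (quat R).
Local Notation HC := (quat R[i]).
Variables (D : set C) (Omega : set H) (x y : R).
Hypothesis D_conj : conj_invariant D.
Hypothesis OmegaE : Omega = circularization D.
Hypothesis D_open : forall z, D z -> locally z D.
Hypothesis y0 : y != 0.

Let z0 : C := x +i* y.
Hypothesis Dz0 : D z0.

Definition regular_stem (F : C -> HC) := stem D F /\ holo_coords D F.

(** The polynomial (z - x)^2 + y^2, see [sphere_polyE]. *)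
Definition sphere_poly (z : C) : C := (z - z0) * (z - z0^*%C).
Local Notation P := sphere_poly.

Lemma sphere_polyE z : P z = (z - x%:C) ^+ 2 + (y ^+ 2)%:C.
Proof.
have e1 : z0 = x%:C + 'i%C * y%:C.
  by apply/eqP; rewrite eq_complex /=; apply/andP; split; apply/eqP; ring.
have e2 : z0^*%C = x%:C - 'i%C * y%:C.
  by apply/eqP; rewrite eq_complex /=; apply/andP; split; apply/eqP; ring.
have i2 : 'i%C * 'i%C = -1 :> C by rewrite -expr2 sqr_i.
rewrite /P e2 e1 rmorphXn /=.
have -> : (z - (x%:C + 'i%C * y%:C)) * (z - (x%:C - 'i%C * y%:C)) =
  (z - x%:C) ^+ 2 - ('i%C * 'i%C) * y%:C ^+ 2 by move: ('i%C : C) => j; ring.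
by rewrite i2 mulN1r opprK.
Qed.

Let z0c_neq : z0^*%C != z0.
Proof.
apply/eqP => -[] /eqP; rewrite eq_sym -addr_eq0 -mulr2n mulrn_eq0 /=.
by rewrite (negbTE y0).
Qed.

Lemma sphere_poly_conj z : P z^* = (P z)^*.
Proof.
rewrite /P; move: z0 => a.
by rewrite rmorphM !rmorphB /= conjcK mulrC.
Qed.

Lemma sphere_poly_eq0 z : (P z == 0) = (z == z0) || (z == z0^*%C).
Proof. by rewrite /P mulf_eq0 !subr_eq0. Qed.

Lemma cderivable_subr (a z : C) : cderivable (fun w => w - a) z.
Proof. by apply: (@cderivableB R id (fun=> a)); [exact: cderivable_id|exact: cderivable_cst]. Qed.

Lemma sphere_poly_order : has_order P z0 1.
Proof.
exists (fun w => w - z0^*%C); split.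
- by rewrite subr_eq0 eq_sym.
- by exists 1 => // w _; exact: cderivable_subr.
- by exists 1 => // w _; rewrite expr1.
Qed.

Let locally_avoid (z a : C) : locally z (fun w => w != z -> w != a).
Proof.
have [->|za] := eqVneq z a; first by exists 1.
have d0 : 0 < normc (a - z) by rewrite normc_gt0 subr_eq0 eq_sym.
exists (normc (a - z)) => // w wz _; apply: contraTneq wz => ->.
by rewrite ltxx.
Qed.

Let locally_Pneq0 z : locally z (fun w => w != z -> P w != 0).
Proof.
apply: locallyS (locallyI (locally_avoid z z0) (locally_avoid z z0^*%C)) => w [h1 h2] wz.
by rewrite sphere_poly_eq0 negb_or h1// h2.
Qed.

(** The polynomial has isolated zeros, so continuity gives equality there. *)
Lemma sphere_poly_cancel (A B : C -> HC) : holo_coords D A -> holo_coords D B ->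
  (forall z, D z -> P z *: A z = P z *: B z) -> forall z, D z -> A z = B z.
Proof.
move=> hA hB AB z Dz; apply: qcoord_inj => k.
apply: (@punctured_eq R (fun w => qcoord k (A w)) (fun w => qcoord k (B w)) z).
- by apply: locallyS (D_open Dz) => w Dw; exact: hA.
- by apply: locallyS (D_open Dz) => w Dw; exact: hB.
apply: locallyS (locallyI (locally_Pneq0 z) (D_open Dz)) => w [Pw Dw] /Pw Pw0.
have := AB w Dw => /(congr1 (qcoord k)); rewrite !qcoordZ.
exact: mulfI.
Qed.

(** Each coordinate vanishes at z_0 and, by the symmetry of stem functions, at
    its conjugate, so both linear factors of the polynomial can be divided out. *)
Lemma regular_stem_divide W : regular_stem W -> W z0 = 0 ->
  exists2 W', regular_stem W' & forall z, D z -> W z = P z *: W' z.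
Proof.
move=> [sW hW] Wz0.
have Wz0c : W z0^*%C = 0.
  by rewrite sW// Wz0 barE /= oppr0.
have coord k : exists h : C -> C, (forall z, D z -> cderivable h z) /\
    forall z, D z -> qcoord k (W z) = P z * h z.
  have [|g dg gP] := @holo_divide R D (fun w => qcoord k (W w)) z0 D_open (hW k) Dz0.
    by rewrite Wz0 qcoord0.
  have gc : g z0^*%C = 0.
    have := gP z0^*%C (D_conj Dz0); rewrite Wz0c qcoord0 => /esym/eqP.
    by rewrite mulf_eq0 subr_eq0 (negbTE z0c_neq) => /eqP.
  have [h dh hP] := holo_divide D_open dg (D_conj Dz0) gc.
  by exists h; split => // z Dz; rewrite gP// hP// mulrA.
have [h0 [d0 e0]] := coord 0; have [h1 [d1 e1]] := coord 1.
have [h2 [d2 e2]] := coord 2; have [h3 [d3 e3]] := coord 3.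
pose W' z : HC := Quat (h0 z) (h1 z) (h2 z) (h3 z).
have hW' : holo_coords D W'.
  by case=> [|[|[|k]]] z Dz; [exact: d0|exact: d1|exact: d2|exact: d3].
have WW' z : D z -> W z = P z *: W' z.
  by move=> Dz; apply: quat_eq; [exact: e0|exact: e1|exact: e2|exact: e3].
exists W' => //; split => // z Dz.
have hbar : holo_coords D (fun z => bar (W' z^*)).
  move=> k u Du; rewrite (_ : (fun w => _) = (fun w => (qcoord k (W' w^*))^*)).
    apply: (@cderivable_conj R (fun w => qcoord k (W' w))).
    by apply: hW'; exact: D_conj.
  by apply/funext => w; rewrite qcoord_bar.
have := @sphere_poly_cancel (fun z => bar (W' z^*)) W' hbar hW'.
move=> /(_ _ _ (D_conj Dz)) <-; first by rewrite conjcK.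
move=> u Du; rewrite -WW'//.
have := sW u Du; rewrite (WW' _ (D_conj Du)) => /(congr1 (@bar R)).
have barK (w : HC) : bar (bar w) = w.
  by apply: part_inj; rewrite !(part1_bar, part2_bar) ?opprK.
rewrite barK => <-.
apply: qcoord_inj => k; rewrite qcoordZ !qcoord_bar qcoordZ rmorphM.
by rewrite /= sphere_poly_conj conjcK.
Qed.

Lemma order_at_zero (W : C -> HC) n : regular_stem W -> has_order (fun z => qnorm2 (W z)) z0 n ->
  (qnorm2 (W z0) == 0) = (n != 0%N).
Proof.
move=> rW [G [Gz dG /locally_at ->]]; rewrite subrr expr0n mulf_eq0 (negbTE Gz) orbF.
by case: n => [|n]; rewrite /= ?oner_eq0 ?eqxx.
Qed.

Lemma local_qnorm2 (W : C -> HC) : regular_stem W -> locally z0 (cderivable (fun w => qnorm2 (W w))).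
Proof. by move=> [_ hW]; apply: locallyS (D_open Dz0) => w Dw; exact: holo_qnorm2 Dw. Qed.

(** Each factor [P] lowers the order of the norm by 2, so finitely many factors
    can be extracted. *)
Lemma extract_spherical n W : regular_stem W ->
  has_order (fun z => qnorm2 (W z)) z0 n ->
  exists m W' k, [/\ regular_stem W', W' z0 != 0,
    forall z, D z -> W z = P z ^+ m *: W' z,
    has_order (fun z => qnorm2 (W' z)) z0 k & n = (2 * m + k)%N].
Proof.
elim/ltn_ind: n W => n ih W rW Wn.
have [Wz0|Wz0] := eqVneq (W z0) 0; last first.
  by exists 0, W, n; split => // z Dz; rewrite expr0 scale1r.
have [W1 rW1 WW1] := regular_stem_divide rW Wz0.
have P2 : has_order (fun w => P w * P w) z0 2 := orderM sphere_poly_order sphere_poly_order.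
have [|k Wk nk] := order_factor (local_qnorm2 rW1) P2 (n := n).
  apply: order_ext Wn; apply: locallyS (D_open Dz0) => w Dw.
  by rewrite WW1// qnorm2Z expr2.
have [|m [W' [k' [rW' W'z0 WW' Wk' kk']]]] := ih k _ W1 rW1 Wk.
  by rewrite nk -[X in (X < _)%N]add0n ltn_add2r.
exists m.+1, W', k'; split => //; last by rewrite nk kk' mulnS addnA.
by move=> z Dz; rewrite WW1// WW'// scalerA exprS.
Qed.

Definition complexify (p : H) : HC := tensor p 0.
(** The stem function of q |-> q - p. *)
Definition linear_stem (p : H) (z : C) : HC := z%:A - complexify p.

Lemma slice_eval_linear_stem J p z : slice_eval J (linear_stem p z) = slice_point J z - p.
Proof.
rewrite /linear_stem slice_evalD slice_evalN slice_eval_scalar; congr (_ - _).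
by rewrite /slice_eval part1_tensor part2_tensor mulr0 addr0.
Qed.

Lemma regular_linear_stem p : regular_stem (linear_stem p).
Proof.
split.
  move=> z _; apply: part_inj; rewrite ?part1_bar ?part2_bar /linear_stem.
    by rewrite !part1D !part1_scalar; case: z.
  rewrite !part2D !part2_scalar opprD -[part2 (- complexify p)](_ : 0 = _).
    by rewrite oppr0 !addr0 -scaleNr; case: z.
  by apply: quat_eq; rewrite /= oppr0.
have lin (a b z : C) : cderivable (fun w => w * a - b) z.
  apply: (@cderivableB R (fun w => w * a) (fun=> b)); last exact: cderivable_cst.
  by apply: (@cderivableM R id (fun=> a)); [exact: cderivable_id|exact: cderivable_cst].
by case=> [|[|[|k]]] z _; exact: lin.
Qed.

Lemma represents_linear p : represents D (linear_stem p) (fun q => q - p).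
Proof.
split; first by case: (regular_linear_stem p).
by move=> a b J Dz JJ; rewrite -/(slice_eval J _) slice_eval_linear_stem.
Qed.

Lemma qconj_linear_stem p z : qconj (linear_stem p z) = linear_stem (qconj p) z.
Proof.
apply: quat_eq; rewrite /= ?mulr0 ?mulr1 ?sub0r ?opprK//.
all: by apply/eqP; rewrite eq_complex /=; apply/andP; split; apply/eqP; rewrite ?oppr0; ring.
Qed.

Lemma qnorm2_linear_stem p z : sphere x y p -> qnorm2 (linear_stem p z) = P z.
Proof.
move=> [J /imSE[J0 J1] ->]; rewrite sphere_polyE.
have e : y ^+ 2 = (y * q1 J) ^+ 2 + (y * q2 J) ^+ 2 + (y * q3 J) ^+ 2.
  by rewrite -[LHS]mulr1 -J1 /qnorm2 J0; ring.
have eC : (y ^+ 2)%:C = (y * q1 J)%:C ^+ 2 + (y * q2 J)%:C ^+ 2 + (y * q3 J)%:C ^+ 2 :> C.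
  by rewrite e !rmorphD !rmorphXn.
have c u : [/\ q0 (linear_stem u z) = z - (q0 u)%:C, q1 (linear_stem u z) = - (q1 u)%:C,
    q2 (linear_stem u z) = - (q2 u)%:C & q3 (linear_stem u z) = - (q3 u)%:C].
  by rewrite /linear_stem !quatE mulr1 mulr0 !add0r.
have [c0 c1 c2 c3] := c (x%:A + y *: J).
rewrite eC /qnorm2 c0 c1 c2 c3 !quatE J0 !mulr0 mulr1 !add0r addr0 !sqrrN.
by rewrite !addrA.
Qed.

Lemma linear_stem_sphere p z : sphere x y p ->
  linear_stem p z * linear_stem (qconj p) z = (P z)%:A.
Proof. by move=> sp; rewrite -qconj_linear_stem qmul_conj qnorm2_linear_stem. Qed.

Lemma regular_stemM U W : regular_stem U -> regular_stem W -> regular_stem (fun z => U z * W z).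
Proof.
move=> [sU hU] [sW hW]; split; last exact: holo_coordsM.
by move=> z Dz; rewrite sU// sW// barM.
Qed.

Lemma qconjK (p : H) : qconj (qconj p) = p.
Proof. by apply: quat_eq; rewrite /= ?opprK. Qed.

Let antipodal : rel H := fun p1 p2 => p1 != qconj p2.

(** If the norm of W vanishes at z_0 but W does not, then W vanishes at some
    point p of the sphere.  The product of the linear factor of the conjugate of p
    with W vanishes at z_0, so it is divisible by P, and P is the product of the
    linear factors of p and its conjugate: W is divisible by the linear factor of
    p, and the order of the norm drops by one.  Two consecutive points of the list
    are not conjugate, for otherwise P would divide W, which does not vanish at
    z_0. *)
Lemma extract_isolated n W : regular_stem W -> W z0 != 0 ->
  has_order (fun z => qnorm2 (W z)) z0 n ->
  exists (ps : seq H) G, [/\ regular_stem G, qnorm2 (G z0) != 0, size ps = n,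
    (forall p, p \in ps -> sphere x y p) /\ sorted antipodal ps &
    forall z, D z -> W z = foldr (fun p r => linear_stem p z * r) (G z) ps].
Proof.
elim: n W => [|n ih] W rW Wz0 Wn.
  by exists [::], W; split => //; rewrite (order_at_zero rW Wn).
have N0 : qnorm2 (W z0) = 0 by apply/eqP; rewrite (order_at_zero rW Wn).
have [J JJ evW] := qnorm2_eq0_slice_eval N0 Wz0.
pose p : H := slice_point J z0.
have sp : sphere x y p by exists J.
have rU : regular_stem (fun z => linear_stem (qconj p) z * W z).
  exact: (@regular_stemM (linear_stem (qconj p)) W (regular_linear_stem _) rW).
have U0 : linear_stem (qconj p) z0 * W z0 = 0.
  have pc : qconj p = x%:A - y *: J.
    have [J0 _] := imSE JJ.
    by apply: quat_eq; rewrite /= ?J0; ring.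
  have -> : linear_stem (qconj p) z0 = tensor (y *: J) y%:A.
    rewrite /linear_stem /complexify pc; apply: part_inj.
      rewrite part1D part1_scalar part1_tensor /=.
      by apply: quat_eq; rewrite /=; ring.
    rewrite part2D part2_scalar part2_tensor /=.
    by apply: quat_eq; rewrite /= ?oppr0 ?addr0.
  have AE : part1 (W z0) = - (J * part2 (W z0)).
    by apply/eqP; rewrite -addr_eq0 -[_ + _]/(slice_eval J _) evW.
  have JJ1 : J * J = -1 := JJ.
  apply: part_inj; rewrite ?part1M ?part2M ?part1_tensor ?part2_tensor.
    rewrite AE mulrN -!scalerAl mulrA JJ1 !mul1r mulN1r scalerN opprK subrr.
    by apply: quat_eq.
  rewrite AE -!scalerAl mul1r scalerN subrr.
  by apply: quat_eq.
have [W1 rW1 UW1] := regular_stem_divide rU U0.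
have WW1 z : D z -> W z = linear_stem p z * W1 z.
  apply: (@sphere_poly_cancel W (fun z => linear_stem p z * W1 z)) => [||{}z Dz].
  - by case: rW.
  - by case: (@regular_stemM (linear_stem p) W1 (regular_linear_stem p) rW1).
  by rewrite scalerAr -UW1// mulrA linear_stem_sphere// -scalerAl mul1r.
have [|k W1k nk] := @order_factor R P (fun z => qnorm2 (W1 z)) z0 1 n.+1 (local_qnorm2 rW1) sphere_poly_order.
  apply: order_ext Wn; apply: locallyS (D_open Dz0) => w Dw.
  by rewrite WW1// qnorm2M qnorm2_linear_stem.
have kn : k = n by move: nk; rewrite add1n => -[].
rewrite kn in W1k.
have W1z0 : W1 z0 != 0 by apply: contra_neq Wz0 => e; rewrite WW1// e mulr0.
have [ps [G [rG Gz sz [sps srt] W1E]]] := ih W1 rW1 W1z0 W1k.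
exists (p :: ps), G; split => //; first by rewrite /= sz.
  split; first by move=> p'; rewrite inE => /predU1P[->|/sps].
  case: ps srt sps W1E {sz} => //= p2 ps srt sps W1E; rewrite srt andbT.
  apply/eqP => pp2; move/eqP: Wz0; apply.
  rewrite WW1// W1E// mulrA; have -> : p2 = qconj p by rewrite pp2 qconjK.
  by rewrite linear_stem_sphere// /P subrr mul0r scale0r mul0r.
by move=> z Dz; rewrite WW1// W1E.
Qed.

Lemma slice_eval_mul_eq0 J (u w : HC) : imS J -> slice_eval J u = 0 -> slice_eval J (u * w) = 0.
Proof.
move=> JJ e; have JJ1 : J * J = -1 := JJ.
have uE : part1 u = - (J * part2 u) by apply/eqP; rewrite -addr_eq0 -[_ + _]/(slice_eval J _) e.
rewrite /slice_eval part1M part2M uE !mulNr mulrDr mulrN !mulrA JJ1 !mulN1r !mulNr opprK.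
by rewrite [X in _ + X]addrC addrACA addNr add0r addNr.
Qed.

Lemma represents_linear_product (ps : seq H) (G : C -> HC) (h : H -> H) :
  represents D G h ->
  represents D (fun z => foldr (fun p r => linear_stem p z * r) (G z) ps)
    (foldr (fun p' r => star (fun q' => q' - p') r) h ps).
Proof.
by move=> rh; elim: ps => [//|p ps ih] /=; apply: represents_star => //; exact: represents_linear.
Qed.

(** The order of S at z_0 is 2m + k with k the isolated multiplicity of the first
    point of the list, so an odd order yields a zero that is excluded. *)
Lemma odd_order_zero (V : C -> HC) (g : H -> H) n : represents D V g -> regular_stem V ->
  has_order (fun z => qnorm2 (V z)) z0 n -> odd n ->
  exists p k, [/\ Omega p, g p = 0, ~ qreal p, isolated_multiplicity Omega g p k & odd k].
Proof.
move=> gV rV Vn no.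
have [m [W [k [rW Wz0 VW Wk nk]]]] := extract_spherical rV Vn.
have ko : odd k by move: no; rewrite nk oddD oddM.
have [ps [G [rG Gz sz [sps srt] WE]]] := extract_isolated rW Wz0 Wk.
have sphere_Omega : sphere x y `<=` Omega.
  by move=> _ [J JJ ->]; rewrite OmegaE; exists x, y, J.
case: ps sz sps srt WE => [/= k0|p ps sz sps srt WE]; first by rewrite -k0 in ko.
have sp : sphere x y p by apply: sps; rewrite inE eqxx.
have hG : represents D G (slice_fun G).
  by apply: represents_slice_fun => //; case: rG.
exists p, k; split => //.
- exact: sphere_Omega.
- have [J JJ pE] := sp; have pE' : p = slice_point J z0 by [].
  rewrite {1}pE' (represents_eval gV JJ Dz0) VW// slice_evalZ// WE//= (slice_eval_mul_eq0 _ JJ) ?mulr0//.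
  by rewrite slice_eval_linear_stem pE' subrr.
- have [J /imSE[J0 J1] pE] := sp; move=> [a pa].
  have c1 : y * q1 J = 0 by have /(congr1 (@q1 R)) := pa; rewrite pE /= !mulr0 add0r.
  have c2 : y * q2 J = 0 by have /(congr1 (@q2 R)) := pa; rewrite pE /= !mulr0 add0r.
  have c3 : y * q3 J = 0 by have /(congr1 (@q3 R)) := pa; rewrite pE /= !mulr0 add0r.
  have z' (t : R) : y * t = 0 -> t = 0.
    by move=> /eqP; rewrite mulf_eq0 (negbTE y0) => /eqP.
  move: J1; rewrite /qnorm2 J0 (z' _ c1) (z' _ c2) (z' _ c3) expr0n /= !addr0 => /eqP.
  by rewrite eq_sym oner_eq0.
exists x, y, m, ps, (slice_fun G); split; last split => //.
- split => //.
  + exists D, G; split => //; [by case: rG|by apply/holomorphicE; case: rG|by case: hG].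
  + move=> q [J JJ ->]; apply: contra_neq Gz => e; apply: (slice_eval_eq0_qnorm2 JJ).
    by rewrite -(represents_eval hG JJ Dz0).
move=> q; rewrite {1}OmegaE => -[a [b [J [Dab JJ ->]]]].
have qE : a%:A + b *: J = slice_point J (a +i* b) by [].
have rfold := represents_linear_product (p :: ps) hG.
rewrite qE (represents_eval gV JJ Dab) VW// slice_evalZ// WE//.
rewrite (represents_eval rfold JJ Dab); congr (_ * _).
have -> : (slice_point J (a +i* b) - x%:A) ^+ 2 + (y ^+ 2)%:A = slice_point J (P (a +i* b)).
  have spR (t : R) : slice_point J t%:C = t%:A by rewrite /slice_point /= scale0r addr0.
  by rewrite sphere_polyE slice_pointD spR expr2 slice_pointM// slice_pointB spR -expr2.
elim: m {VW nk} => [|m ih]; first by rewrite !expr0 slice_point1.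
by rewrite !exprS slice_pointM// ih.
Qed.

End Multiplicity.

(** * The complex exponential series *)

Section ExpSeries.
Local Open Scope complex_scope.

Definition exp_sum (K : numFieldType) (z : K) (N : nat) : K :=
  \sum_(i < N) z ^+ i / i`!%:R.

Lemma triangle_sum (V : zmodType) (g : nat -> nat -> V) N :
  \sum_(n < N) \sum_(i < n.+1) g i (n - i)%N = \sum_(i < N) \sum_(j < N - i) g i j.
Proof.
elim: N => [|N ih]; first by rewrite !big_ord0.
rewrite big_ord_recr /= ih big_ord_recr [RHS]big_ord_recr /= subnn subSnn big_ord1 addrA.
congr (_ + _); rewrite -big_split /=; apply: eq_bigr => i _.
by rewrite subSn ?(ltnW (ltn_ord i))// big_ord_recr.
Qed.

(** The binomial formula, with the terms arranged as a triangle. *)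
Lemma exp_sum_add (K : numFieldType) (z w : K) N :
  exp_sum (z + w) N =
  \sum_(i < N) \sum_(j < N - i) z ^+ i / i`!%:R * (w ^+ j / j`!%:R).
Proof.
rewrite -(triangle_sum (fun i j => z ^+ i / i`!%:R * (w ^+ j / j`!%:R))).
apply: eq_bigr => n _; rewrite addrC exprDn mulr_suml; apply: eq_bigr => i _.
have fact0 m : m`!%:R != 0 :> K by rewrite pnatr_eq0 -lt0n fact_gt0.
have := bin_fact (leq_ord i) => /(congr1 (fun m => m%:R : K)).
rewrite !natrM => <-; rewrite -mulr_natr.
have := fact0 i; have := fact0 (n - i)%N.
have : ('C(n, i))%:R != 0 :> K by rewrite pnatr_eq0 -lt0n bin_gt0 leq_ord.
move: (_%:R) (_%:R) (_%:R) (w ^+ _) (z ^+ _) => a b c x y a0 b0 c0; field.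
by rewrite a0 b0 c0.
Qed.

Lemma exp_sum_defect (K : numFieldType) (z w : K) N :
  exp_sum z N * exp_sum w N - exp_sum (z + w) N =
  \sum_(i < N) \sum_(N - i <= j < N) z ^+ i / i`!%:R * (w ^+ j / j`!%:R).
Proof.
rewrite exp_sum_add /exp_sum mulr_suml -sumrB; apply: eq_bigr => i _.
rewrite mulr_sumr -(big_mkord xpredT (fun j => z ^+ i / i`!%:R * (w ^+ j / j`!%:R))).
rewrite (big_cat_nat (n := (N - i)%N)) ?leq_subr//=.
by rewrite big_mkord addrAC subrr add0r.
Qed.

End ExpSeries.

Section ComplexExp.
Local Open Scope complex_scope.
Variable R : realType.
Local Notation C := R[i].
Implicit Types z w : C.

Lemma ler_normc_sum I (r : seq I) (P : pred I) (F : I -> C) :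
  normc (\sum_(i <- r | P i) F i) <= \sum_(i <- r | P i) normc (F i).
Proof.
elim/big_ind2 : _ => //; first by rewrite normc0.
by move=> x a y b xa yb; rewrite (le_trans (ler_normcD _ _))// lerD.
Qed.

Lemma normc_nat n : normc (n%:R : C) = n%:R.
Proof. by rewrite -(rmorph_nat (real_complex R) n) normc_real normr_nat. Qed.

Lemma normc_exp_term z n : normc (z ^+ n / n`!%:R) = normc z ^+ n / n`!%:R.
Proof. by rewrite normcM normcV normcX normc_nat. Qed.

(** The defect of the addition theorem at level N is a sum of monomials with
    positive coefficients, so it is dominated by the defect at the moduli, which
    tends to zero by the addition theorem of the real exponential. *)
Lemma exp_sum_defect_bound z w N :
  normc (exp_sum z N * exp_sum w N - exp_sum (z + w) N) <=
  exp_sum (normc z) N * exp_sum (normc w) N - exp_sum (normc z + normc w) N.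
Proof.
rewrite !exp_sum_defect (le_trans (ler_normc_sum _ _ _))//; apply: ler_sum => i _.
rewrite (le_trans (ler_normc_sum _ _ _))//; apply: ler_sum => j _.
by rewrite normcM !normc_exp_term.
Qed.

Lemma cvg_exp_sum_real (x : R) : exp_sum x n @[n --> \oo] --> expR x.
Proof.
have := is_cvg_series_exp_coeff x; rewrite /expR.
suff -> : exp_sum x = series (exp_coeff x) by [].
by apply/funext => n; rewrite /exp_sum /series /= big_mkord.
Qed.

Lemma cvg_ReIm (u : nat -> C) (l : C) :
  complex.Re (u n) @[n --> \oo] --> complex.Re l ->
  complex.Im (u n) @[n --> \oo] --> complex.Im l ->
  (u : nat -> (C : numFieldType)) @ \oo --> (l : (C : numFieldType)).
Proof.
move=> h1 h2 A /nbhs_normcP[d d0 dA].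
have d20 : 0 < d / 2 by rewrite divr_gt0.
have /cvgrPdist_lt/(_ _ d20) H1 := h1; have /cvgrPdist_lt/(_ _ d20) H2 := h2.
rewrite /nbhs /=; apply: filterS (filterI H1 H2) => n [g1 g2].
apply: dA; rewrite (le_lt_trans (normc_le_ReIm _))// ReD ImD ReN ImN [d]splitr.
by rewrite ltrD// distrC.
Qed.

Lemma cvg_exp_sum z : cvgn (exp_sum z : nat -> (C : numFieldType)).
Proof.
have H (g : C -> R) : (forall x y, g (x + y) = g x + g y) -> g 0 = 0 ->
    (forall x, `|g x| <= normc x) -> cvgn (fun n => g (exp_sum z n)).
  move=> gD g0 gle.
  have gE n : g (exp_sum z n) = series (fun k => g (z ^+ k / k`!%:R)) n.
    rewrite /exp_sum /series /= big_mkord.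
    by elim: n => [|n ih]; rewrite ?big_ord0// !big_ord_recr/= gD ih.
  rewrite (_ : (fun n => _) = series (fun k => g (z ^+ k / k`!%:R))); last exact/funext.
  apply: normed_cvg; apply: (@series_le_cvg _ _ (exp_coeff (normc z))).
  - by move=> n; exact: normr_ge0.
  - by move=> n; apply: exp_coeff_ge0; exact: normc_ge0.
  - by move=> n /=; rewrite (le_trans (gle _))// normc_exp_term.
  - exact: is_cvg_series_exp_coeff.
have /cvg_ex[/= a Ha] : cvgn (fun n => complex.Re (exp_sum z n)).
  by apply: H; [exact: ReD| |exact: Re_le_normc].
have /cvg_ex[/= b Hb] : cvgn (fun n => complex.Im (exp_sum z n)).
  by apply: H; [exact: ImD| |exact: Im_le_normc].
by apply: (cvgP (a +i* b : (C : numFieldType))); apply: cvg_ReIm.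
Qed.

Definition cexp z : C := limn (exp_sum z : nat -> (C : numFieldType)).

Lemma cexpP z : (exp_sum z : nat -> (C : numFieldType)) @ \oo --> (cexp z : (C : numFieldType)).
Proof. exact: cvg_exp_sum. Qed.

Lemma cvg_normc0 (u : nat -> C) (b : nat -> R) : (forall n, normc (u n) <= b n) ->
  b @ \oo --> 0 -> (u : nat -> (C : numFieldType)) @ \oo --> (0 : (C : numFieldType)).
Proof.
move=> ub h A /nbhs_normcP[d d0 dA].
have /cvgrPdist_lt/(_ _ d0) H1 := h.
rewrite /nbhs /=; apply: filterS H1 => n; rewrite sub0r normrN => bn.
by apply: dA; rewrite subr0 (le_lt_trans (ub n))// (le_lt_trans _ bn)// ler_norm.
Qed.

Lemma cexpD z w : cexp (z + w) = cexp z * cexp w.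
Proof.
have h0 : (fun n => exp_sum z n * exp_sum w n - exp_sum (z + w) n :
    (C : numFieldType)) @ \oo --> (0 : (C : numFieldType)).
  apply: (cvg_normc0 (exp_sum_defect_bound z w)).
  rewrite -(subrr (expR (normc z + normc w))) {1}expRD.
  by apply: cvgB; [apply: cvgM|]; exact: cvg_exp_sum_real.
have h1 : (fun n => exp_sum z n * exp_sum w n - exp_sum (z + w) n :
    (C : numFieldType)) @ \oo --> (cexp z * cexp w - cexp (z + w) : (C : numFieldType)).
  by apply: cvgB; [apply: cvgM|]; exact: cexpP.
have e : cexp z * cexp w - cexp (z + w) = 0.
  exact: (cvg_unique (@norm_hausdorff (C : numFieldType) (C : numFieldType)) h1 h0).
by apply/esym/eqP; rewrite -subr_eq0 e.
Qed.

Let exp_sum_pair (x : C) N : exp_sum x (2 * N.+1) =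
  exp_sum x (2 * N) + x ^+ (2 * N) / (2 * N)`!%:R + x ^+ (2 * N).+1 / (2 * N).+1`!%:R.
Proof. by rewrite mulnS /exp_sum !big_ord_recr. Qed.

Let expr_even_opp (x : C) N : (- x) ^+ (2 * N) = x ^+ (2 * N).
Proof. by rewrite !exprM sqrrN. Qed.

Let expr_i_even z N : ('i%C * z) ^+ (2 * N) = (-1) ^+ N * z ^+ (2 * N).
Proof.
have e : ('i%C * z) ^+ 2 = -1 * z ^+ 2 by rewrite exprMn sqr_i.
by rewrite !exprM e exprMn.
Qed.

Lemma cos_sum z N : \sum_(n < N) (-1) ^+ n / (2 * n)`!%:R * z ^+ (2 * n) =
  (exp_sum ('i%C * z) (2 * N) + exp_sum (- ('i%C * z)) (2 * N)) / 2.
Proof.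
elim: N => [|N ih]; first by rewrite /exp_sum !big_ord0 addr0 mul0r.
rewrite big_ord_recr /= ih !exp_sum_pair !exprS expr_even_opp expr_i_even.
by field; rewrite !pnatr_eq0 -!lt0n !fact_gt0.
Qed.

Lemma sin_sum z N : \sum_(n < N) (-1) ^+ n / (2 * n).+1`!%:R * z ^+ (2 * n).+1 =
  (exp_sum ('i%C * z) (2 * N) - exp_sum (- ('i%C * z)) (2 * N)) / (2 * 'i%C).
Proof.
have i0 : 'i%C != 0 :> C by rewrite eq_complex /= oner_eq0 andbF.
elim: N => [|N ih]; first by rewrite /exp_sum !big_ord0 subrr mul0r.
rewrite big_ord_recr /= ih !exp_sum_pair !exprS expr_even_opp expr_i_even.
by field; rewrite i0 !pnatr_eq0 -!lt0n !fact_gt0.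
Qed.

Let cexp2P z : (fun N => exp_sum z (2 * N) : (C : numFieldType)) @ \oo -->
  (cexp z : (C : numFieldType)).
Proof.
move=> A /(cexpP (z := z))[N _ NA]; exists N => // n /= Nn.
by apply: NA; rewrite /= (leq_trans Nn)// leq_pmull.
Qed.

Lemma cvg_cos_sum z :
  (fun N => \sum_(n < N) (-1) ^+ n / (2 * n)`!%:R * z ^+ (2 * n) : (C : numFieldType))
  @ \oo --> ((cexp ('i%C * z) + cexp (- ('i%C * z))) / 2 : (C : numFieldType)).
Proof.
under eq_fun do rewrite cos_sum.
apply: cvgMl; apply: cvgD; exact: cexp2P.
Qed.

Lemma cvg_sin_sum z :
  (fun N => \sum_(n < N) (-1) ^+ n / (2 * n).+1`!%:R * z ^+ (2 * n).+1 : (C : numFieldType))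
  @ \oo --> ((cexp ('i%C * z) - cexp (- ('i%C * z))) / (2 * 'i%C) : (C : numFieldType)).
Proof.
under eq_fun do rewrite sin_sum.
apply: cvgMl; apply: cvgB; exact: cexp2P.
Qed.

End ComplexExp.

(** * Evaluation of the star-exponential *)

Section Formula.
Local Open Scope complex_scope.
Variable R : realType.
Local Notation C := R[i].
Local Notation H := (quat R).
Local Notation HC := (quat R[i]).
Variables (J : H).
Hypothesis JJ : imS J.

Lemma cvg_slice_point (a : nat -> C) (l : C) :
  (a : nat -> (C : numFieldType)) @ \oo --> (l : (C : numFieldType)) ->
  (fun n => slice_point J (a n)) @ \oo --> slice_point J l.
Proof.
by move=> al A Al; exact: (al _ (@slice_point_continuous R J l A Al)).
Qed.

Lemma cvg_slice_pointM (a : nat -> C) (l : C) (v : H) :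
  (a : nat -> (C : numFieldType)) @ \oo --> (l : (C : numFieldType)) ->
  (fun n => slice_point J (a n) * v) @ \oo --> slice_point J l * v.
Proof.
have cont : continuous ((fun z => slice_point J z * v) : (C : numFieldType) -> H).
  apply: (@bounded_additive_continuous R _ (ql1norm v + ql1norm (J * v))).
  - by move=> z w; rewrite slice_pointB mulrBl.
  - by rewrite addr_ge0// ql1norm_ge0.
  - move=> z; rewrite /slice_point mulrDl -!scalerAl mul1r.
    rewrite (le_trans (ql1normD _ _))// !ql1normZ mulrDl.
    by rewrite lerD// mulrC ler_wpM2l ?ql1norm_ge0 ?Re_le_normc ?Im_le_normc.
by move=> al A Al; exact: (al _ (cont l A Al)).
Qed.

Lemma limn_quat (u : nat -> H) (l : H) : u @ \oo --> l -> limn u = l.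
Proof. by move=> ul; apply: cvg_lim => //; exact: norm_hausdorff. Qed.

Lemma series_slice_point (k : nat -> R) (a : nat -> C) n :
  series (fun n => k n *: slice_point J (a n)) n =
  slice_point J (\sum_(i < n) (k i)%:C * a i).
Proof.
rewrite /series /= big_mkord; elim: n => [|n ih]; first by rewrite !big_ord0 slice_point0.
by rewrite !big_ord_recr /= ih slice_pointD slice_pointZ.
Qed.

(** With x = ic the elements (1 + v / x) / 2 and (1 - v / x) / 2 are
    complementary idempotents on which w acts as w_0 + x and w_0 - x; the formula
    is the resulting decomposition of w^n. *)
Lemma quat_pow (w : HC) (c : C) n : c != 0 -> c ^+ 2 = qnorm2 (vect w) ->
  w ^+ n = (((q0 w + 'i%C * c) ^+ n + (q0 w - 'i%C * c) ^+ n) / 2)%:A +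
    (((q0 w + 'i%C * c) ^+ n - (q0 w - 'i%C * c) ^+ n) / (2 * ('i%C * c))) *: vect w.
Proof.
move=> c0 c2; set x := 'i%C * c.
have x2 : x * x = - qnorm2 (vect w).
  by rewrite -c2 /x -expr2 exprMn sqr_i mulN1r.
have i0 : 'i%C != 0 :> C by rewrite eq_complex /= oner_eq0 andbF.
have x0 : x != 0 by rewrite mulf_neq0.
elim: n => [|n ih].
  by rewrite !expr0 subrr mul0r scale0r addr0 (_ : (1 + 1) / 2 = 1) ?scale1r//; field.
have step (a b : C) : w * (a%:A + b *: vect w) =
    (q0 w * a - qnorm2 (vect w) * b)%:A + (q0 w * b + a) *: vect w.
  by apply: quat_eq; rewrite /= /qnorm2 /=; ring.
have xq : qnorm2 (vect w) = - (x * x) by rewrite x2 opprK.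
rewrite exprS ih step xq !exprS; congr (_%:A + _ *: _); field; exact: x0.
Qed.

Section Evaluation.
Variables (D : set C) (Omega : set H) (f s : H -> H) (F G : C -> HC) (z c : C).
Hypothesis D_conj : conj_invariant D.
Hypothesis fF : represents D F f.
Hypothesis sG : represents D G s.
Hypothesis Dz : D z.
Hypothesis Gz : G z = c%:A.
Hypothesis c2 : c ^+ 2 = qnorm2 (vect (F z)).
Hypothesis c0 : c != 0.

Let q := slice_point J z.
Let V := slice_eval J (vect (F z)).
Let w0 := q0 (F z).

Lemma slice_eval_pow (a : C) n : slice_eval J (a%:A ^+ n) = slice_point J (a ^+ n).
Proof.
by rewrite -slice_eval_scalar; congr slice_eval; elim: n => [|n ih];
  rewrite ?expr0 ?scale1r// !exprS ih -scalerAl mul1r scalerA.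
Qed.

Let natC n : ((n`!%:R : R)^-1)%:C = (n`!%:R)^-1 :> C.
Proof. by rewrite fmorphV rmorph_nat. Qed.

Lemma exp_star_scal : exp_star (real_part f) q = slice_point J (cexp w0).
Proof.
apply: limn_quat.
have rf := represents_real_part D_conj fF.
rewrite (_ : series _ = (fun N => slice_point J (exp_sum w0 N))).
  exact: (@cvg_slice_point (exp_sum w0) _ (@cexpP R w0)).
apply/funext => N.
rewrite (_ : (fun n => _) = (fun n => (n`!%:R)^-1 *: slice_point J (w0 ^+ n))).
  rewrite series_slice_point; congr slice_point; apply: eq_bigr => i _.
  by rewrite natC mulrC.
apply/funext => n; congr (_ *: _).
by rewrite (represents_eval (represents_starpow D_conj n rf) JJ Dz) slice_eval_pow.
Qed.

Lemma cos_star_scal : cos_star s q =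
  slice_point J ((cexp ('i%C * c) + cexp (- ('i%C * c))) / 2).
Proof.
apply: limn_quat.
rewrite (_ : series _ = (fun N => slice_point J
  (\sum_(n < N) (-1) ^+ n / (2 * n)`!%:R * c ^+ (2 * n)))).
  exact: (@cvg_slice_point _ _ (@cvg_cos_sum R c)).
apply/funext => N.
rewrite (_ : (fun n => _) =
    (fun n => ((-1) ^+ n / (2 * n)`!%:R) *: slice_point J (c ^+ (2 * n)))).
  rewrite series_slice_point; congr slice_point; apply: eq_bigr => i _.
  by rewrite rmorphM /= natC rmorphXn /= rmorphN1.
apply/funext => n; congr (_ *: _).
by rewrite (represents_eval (represents_starpow D_conj _ sG) JJ Dz) Gz slice_eval_pow.
Qed.

Lemma sin_star_scal : sin_star s q =
  slice_point J ((cexp ('i%C * c) - cexp (- ('i%C * c))) / (2 * 'i%C)).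
Proof.
apply: limn_quat.
rewrite (_ : series _ = (fun N => slice_point J
  (\sum_(n < N) (-1) ^+ n / (2 * n).+1`!%:R * c ^+ (2 * n).+1))).
  exact: (@cvg_slice_point _ _ (@cvg_sin_sum R c)).
apply/funext => N.
rewrite (_ : (fun n => _) =
    (fun n => ((-1) ^+ n / (2 * n).+1`!%:R) *: slice_point J (c ^+ (2 * n).+1))).
  rewrite series_slice_point; congr slice_point; apply: eq_bigr => i _.
  by rewrite rmorphM /= natC rmorphXn /= rmorphN1.
apply/funext => n; congr (_ *: _).
by rewrite (represents_eval (represents_starpow D_conj _ sG) JJ Dz) Gz slice_eval_pow.
Qed.

Lemma exp_star_eval : exp_star f q =
  slice_point J ((cexp (w0 + 'i%C * c) + cexp (w0 - 'i%C * c)) / 2) +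
  slice_point J ((cexp (w0 + 'i%C * c) - cexp (w0 - 'i%C * c)) / (2 * ('i%C * c))) * V.
Proof.
apply: limn_quat.
pose a N := (exp_sum (w0 + 'i%C * c) N + exp_sum (w0 - 'i%C * c) N) / 2.
pose b N := (exp_sum (w0 + 'i%C * c) N - exp_sum (w0 - 'i%C * c) N) / (2 * ('i%C * c)).
rewrite (_ : series _ = (fun N => slice_point J (a N) + slice_point J (b N) * V)).
  apply: cvgD.
    by apply: (@cvg_slice_point a); apply: cvgMl; apply: cvgD; exact: cexpP.
  by apply: (@cvg_slice_pointM b); apply: cvgMl; apply: cvgB; exact: cexpP.
apply/funext; elim => [|N ih].
  rewrite /series /= big_geq// /a /b /exp_sum !big_ord0 addr0 subr0 !mul0r.
  by rewrite slice_point0 mul0r addr0.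
rewrite /series /= big_nat_recr//=; move: ih; rewrite /series /= => ->.
rewrite (represents_eval (represents_starpow D_conj _ fF) JJ Dz).
rewrite (quat_pow N c0 c2) slice_evalD slice_eval_scalar (slice_evalZ _ _ JJ) -/V -/w0 scalerDr scalerAl.
rewrite -!slice_pointZ addrACA -mulrDl -!slice_pointD natC /a /b /exp_sum !big_ord_recr /=.
by congr (slice_point J _ + slice_point J _ * V); ring.
Qed.

Lemma exp_star_formula : exp_star f q = exp_star (real_part f) q *
  (cos_star s q + sin_star s q / s q * vector_part f q).
Proof.
have i0 : 'i%C != 0 :> C by rewrite eq_complex /= oner_eq0 andbF.
have sq : s q = slice_point J c by rewrite (represents_eval sG JJ Dz) Gz slice_eval_scalar.
have vq : vector_part f q = V by exact: represents_eval (represents_vector_part D_conj fF) JJ Dz.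
rewrite exp_star_eval exp_star_scal cos_star_scal sin_star_scal sq vq.
rewrite -slice_pointV// -slice_pointM// [RHS]mulrDr [X in _ = _ + X]mulrA -!slice_pointM// !cexpD.
have e1 (a p m : C) : (a * p + a * m) / 2 = a * ((p + m) / 2) by field.
have e2 (a p m j : C) : j != 0 -> (a * p - a * m) / (2 * (j * c)) = a * ((p - m) / (2 * j) / c).
  by move=> j0; field; rewrite c0 j0.
by rewrite e1 e2.
Qed.

End Evaluation.

End Formula.

(** * The square root of the symmetrization *)

Section FinalHelpers.
Local Open Scope complex_scope.
Variable R : realType.
Local Notation C := R[i].
Local Notation H := (quat R).
Local Notation HC := (quat R[i]).
Implicit Types (D : set C) (Omega : set H).

(** Any planar set defining Omega is its trace on the slice of i. *)
Lemma circularization_inj D D' : conj_invariant D -> conj_invariant D' ->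
  circularization D = circularization D' -> D = D'.
Proof.
move=> cD cD' e; have JJ := imS_i R.
apply/seteqP; split=> z.
  by move/(D_slice_point cD erefl JJ); rewrite e; move/(D_slice_point cD' erefl JJ).
by move/(D_slice_point cD' erefl JJ); rewrite -e; move/(D_slice_point cD erefl JJ).
Qed.

Lemma qnorm2_bar (w : HC) : qnorm2 (bar w) = (qnorm2 w)^*.
Proof. by rewrite barE /qnorm2 /= !rmorphD !rmorphXn. Qed.

(** Stem functions are real at real points, where the norm is a sum of squares
    of real numbers. *)
Lemma bar_fixed_qnorm2_ge0 (w : HC) : w = bar w -> 0 <= qnorm2 w.
Proof.
rewrite barE => e.
have sq (c : C) : c = c^* -> 0 <= c ^+ 2.
  case: c => a b [] /eqP; rewrite -addr_eq0 -mulr2n mulrn_eq0 /= => /eqP ->.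
  by rewrite -[a +i* 0]/(a%:C) -rmorphXn /= ler0c sqr_ge0.
have := congr1 (@q0 C) e; have := congr1 (@q1 C) e.
have := congr1 (@q2 C) e; have := congr1 (@q3 C) e => /= e3 e2 e1 e0.
by rewrite /qnorm2 !addr_ge0// sq.
Qed.

(** Slice-preserving stem functions are complex-valued functions. *)
Lemma real_stem_scalar (w : HC) : qreal (part1 w) -> qreal (part2 w) -> exists c : C, w = c%:A.
Proof.
move=> [a ea] [b eb]; exists (a +i* b).
by apply: part_inj; rewrite ?part1_scalar ?part2_scalar.
Qed.

Lemma slice_point_neq0 J (c : C) : imS J -> slice_point J c != 0 -> c != 0.
Proof. by move=> _; apply: contra_neq => ->; rewrite slice_point0. Qed.

Lemma scalar_stem D (T : C -> C) : (forall z, D z -> T z^* = (T z)^*) ->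
  stem D (fun z => (T z)%:A : HC).
Proof.
move=> Tc z Dz; rewrite Tc//; apply: part_inj.
  by rewrite part1_bar !part1_scalar; case: (T z).
by rewrite part2_bar !part2_scalar -scaleNr; case: (T z).
Qed.

Lemma scalar_holo D (T : C -> C) : (forall z, D z -> cderivable T z) ->
  holo_coords D (fun z => (T z)%:A : HC).
Proof.
move=> dT k z Dz; have mul (a : C) : cderivable (fun w => T w * a) z.
  by apply: (@cderivableM R T (fun=> a)); [exact: dT|exact: cderivable_cst].
by case: k => [|[|[|k]]]; exact: mul.
Qed.

End FinalHelpers.

Section StemOfRoot.
Local Open Scope complex_scope.
Variable R : realType.
Local Notation C := R[i].
Local Notation H := (quat R).
Local Notation HC := (quat R[i]).
Variables (Omega : set H) (f : H -> H) (D : set C) (F : C -> HC).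
Hypothesis D_conj : conj_invariant D.
Hypothesis OmegaE : Omega = circularization D.
Hypothesis hF : holo_coords D F.
Hypothesis rf : represents D F f.

Let V z := vect (F z).
Let S z := qnorm2 (V z).

Let rV : represents D V (vector_part f).
Proof. exact: represents_vector_part. Qed.

Let VV : regular_stem D V.
Proof. by split; [case: rV|exact: holo_vect]. Qed.

Let rS : represents D (fun z => (S z)%:A) (symmetrization (vector_part f)).
Proof. exact: represents_symmetrization. Qed.

Let symE z J : D z -> imS J ->
  symmetrization (vector_part f) (slice_point J z) = slice_point J (S z).
Proof. by move=> Dz JJ; rewrite (represents_eval rS)// slice_eval_scalar. Qed.

Lemma exp_star_of_root s : slice_preserving_regular Omega s ->
  (forall q, Omega q -> star s s q = symmetrization (vector_part f) q) ->
  forall q, Omega q -> symmetrization (vector_part f) q != 0 ->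
  exp_star f q = exp_star (real_part f) q *
    (cos_star s q + sin_star s q / s q * vector_part f q).
Proof.
move=> [D' [G [[cD' OmegaE' sG hG sind] Greal]]] sq q Oq.
have eD : D' = D by apply: circularization_inj => //; rewrite -OmegaE'.
rewrite {}eD in cD' OmegaE' sG hG sind Greal.
have rG : represents D G s by [].
have [z [J [Dz JJ ->]]] := Omega_ex OmegaE Oq.
rewrite symE// => /(slice_point_neq0 JJ) Sz0.
have [g1 g2] := Greal z Dz; have [c Gz] := real_stem_scalar g1 g2.
have c2 : c ^+ 2 = S z.
  have := represents_uniq D_conj OmegaE (represents_star D_conj rG rG) rS sq Dz.
  rewrite Gz => /(congr1 (@q0 _)); rewrite -scalerAl mul1r scalerA.
  by rewrite /= !mulr1 expr2.
apply: (exp_star_formula JJ D_conj rf rG Dz Gz c2).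
by apply: contra_neq Sz0 => c0; rewrite -c2 c0 expr0n.
Qed.

Variable I : H.
Hypothesis I_unit : imS I.
Hypothesis Omega_open : open Omega.
Hypothesis Omega_connected : connected Omega.
Hypothesis Omega_I_simply_connected : forall q, (Omega `&` slice_plane I) q ->
  simply_connected R (connected_component (Omega `&` slice_plane I) q).
Hypothesis fvs_neq0 : exists2 q, Omega q & symmetrization (vector_part f) q != 0.
Hypothesis fv_no_odd_zero : ~ exists p n, [/\ Omega p, vector_part f p = 0, ~ qreal p,
  isolated_multiplicity Omega (vector_part f) p n & odd n].

Lemma slice_preserving_root : exists s, slice_preserving_regular Omega s /\
  forall q, Omega q -> star s s q = symmetrization (vector_part f) q.
Proof.
have D_open z : D z -> locally z D := D_open D_conj OmegaE I_unit Omega_open (z := z).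
have S_holo z : D z -> cderivable S z by move=> Dz; apply: (holo_qnorm2 VV.2 Dz).
have S_conj z : D z -> S z^* = (S z)^* by move=> Dz; rewrite /S VV.1// qnorm2_bar.
have S_real (x : R) : D x%:C -> 0 <= S x%:C.
  move=> Dx; apply: bar_fixed_qnorm2_ge0.
  by have := VV.1 _ Dx; rewrite conjc_real.
have S_neq0 : exists2 z, D z & S z != 0.
  have [q Oq] := fvs_neq0; have [z [J [Dz JJ ->]]] := Omega_ex OmegaE Oq.
  by rewrite symE// => /(slice_point_neq0 JJ); exists z.
have S_even z k G : D z -> G z != 0 -> locally z (cderivable G) ->
    locally z (fun w => S w = (w - z) ^+ k * G w) -> ~~ odd k.
  move=> Dz Gz dG SG; have Sk : has_order S z k by exists G.
  case: z Dz {Gz dG SG} Sk => x y Dz Sk; have [y0|y0] := eqVneq y 0.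
    rewrite y0 in Dz Sk; apply: (@nonneg_order_even R S x) => //.
    apply: locallyS (D_open _ Dz) => -[a b] Dw /= b0; rewrite b0 in Dw *.
    exact: S_real.
  apply/negP => ko; apply: fv_no_odd_zero.
  exact: (odd_order_zero D_conj OmegaE D_open y0 Dz rV VV Sk ko).
have [T TP] := holomorphic_sqrt D_conj OmegaE I_unit Omega_open Omega_connected
  S_holo S_conj S_neq0 S_real S_even Omega_I_simply_connected.
have T_conj z : D z -> T z^* = (T z)^* by move=> /TP[].
have T_holo z : D z -> cderivable T z by move=> /TP[].
have sT := scalar_stem T_conj.
exists (slice_fun (fun z => (T z)%:A)).
have rT := represents_slice_fun D_conj sT (fun z _ => erefl).
split.
  exists D, (fun z => (T z)%:A); split.
    split => //; first by apply/holomorphicE; exact: scalar_holo.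
    by case: rT.
  move=> z Dz; split; first by exists (complex.Re (T z)); rewrite part1_scalar.
  by exists (complex.Im (T z)); rewrite part2_scalar.
move=> q Oq; have [z [J [Dz JJ ->]]] := Omega_ex OmegaE Oq.
rewrite symE// (represents_eval (represents_star D_conj rT rT) JJ Dz).
by rewrite -scalerAl mul1r scalerA slice_eval_scalar -expr2; have [_ -> _] := TP z Dz.
Qed.

End StemOfRoot.

Theorem corollary4p7 (R : realType) (Omega : set (quat R))
    (f : quat R -> quat R) (I : quat R)
    (Omega_neq0 : Omega !=set0)
    (Omega_domain : circular_domain Omega)
    (f_regular : slice_regular Omega f)
    (I_unit : imS I)
    (Omega_I_simply_connected : forall q, (Omega `&` slice_plane I) q ->
      simply_connected R (connected_component (Omega `&` slice_plane I) q))
    (fvs_neq0 : exists2 q, Omega q & symmetrization (vector_part f) q != 0)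
    (fv_no_odd_zero : ~ exists p n, [/\ Omega p, vector_part f p = 0, ~ qreal p,
      isolated_multiplicity Omega (vector_part f) p n & odd n]) :
  (exists s, slice_preserving_regular Omega s /\
     forall q, Omega q -> star s s q = symmetrization (vector_part f) q) /\
  (forall s, slice_preserving_regular Omega s ->
     (forall q, Omega q -> star s s q = symmetrization (vector_part f) q) ->
     forall q, Omega q -> symmetrization (vector_part f) q != 0 ->
       exp_star f q =
       exp_star (real_part f) q *
         (cos_star s q + sin_star s q / s q * vector_part f q)).
Proof.
have [_ Omega_open Omega_connected] := Omega_domain.
have [D [F [D_conj OmegaE sF /holomorphicE hF fF]]] := f_regular.
split; first exact: (slice_preserving_root D_conj OmegaE hF (conj sF fF) I_unit Omega_open
  Omega_connected Omega_I_simply_connected fvs_neq0 fv_no_odd_zero).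
exact: (exp_star_of_root D_conj OmegaE (conj sF fF)).
Qed.
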